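(* Consider the system $$\mathfrak r^1_t+(\mathfrak r^1+\mathfrak r^2+1)\mathfrak r^1_x=0,\qquad \mathfrak r^2_t+(\mathfrak r^1+\mathfrak r^2-1)\mathfrak r^2_x=0,\qquad \mathfrak r^3_t+(\mathfrak r^1+\mathfrak r^2)\mathfrak r^3_x=0$$ for unknown functions $\mathfrak r^1,\mathfrak r^2,\mathfrak r^3$ of $(t,x)$. A generating set for the space of hydrodynamic conservation laws of this system up to the point symmetry group $G$ of this system consists of the conservation laws with conserved currents $$\mathrm{DHC}=\left(e^{\mathfrak r^1-\mathfrak r^2}\mathfrak r^3,\ (\mathfrak r^1+\mathfrak r^2)e^{\mathfrak r^1-\mathfrak r^2}\mathfrak r^3\right),$$ $$\mathrm{EHC}(\Psi)=\big(\Psi_{\mathfrak r^1}-\Psi_{\mathfrak r^2},\ (\mathfrak r^1+\mathfrak r^2+1)\Psi_{\mathfrak r^1}-(\mathfrak r^1+\mathfrak r^2-1)\Psi_{\mathfrak r^2}\big),$$ where $\Psi=\Psi(\mathfrak r^1,\mathfrak r^2)$ runs through the solution set of the equation $2\Psi_{\mathfrak r^1\mathfrak r^2}=\Psi_{\mathfrak r^2}-\Psi_{\mathfrak r^1}$, which is reduced by the transformation $\tilde\Psi=e^{(\mathfrak r^2-\mathfrak r^1)/2}\Psi$ to the Klein--Gordon equation $\tilde\Psi_{\mathfrak r^1\mathfrak r^2}=-\tilde\Psi/4$.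
   Context: A conserved current of the system is a pair $(\rho,\sigma)$ of differential functions (density and flux) with $\mathrm D_t\rho+\mathrm D_x\sigma=0$ on all solutions of the system, where $\mathrm D_t,\mathrm D_x$ are the total derivative operators; conservation laws are equivalence classes of conserved currents modulo trivial ones (sums of null divergences and pairs vanishing on solutions). A conservation law is hydrodynamic if it has a density that is a function of $\mathfrak r^1,\mathfrak r^2,\mathfrak r^3$ only. A generating set of a space of conservation laws is a set of conservation laws that generates the space via taking linear combinations and acting with point symmetries of the system. The point symmetry group $G$ consists of the transformations $$\tilde t=T^1t+T^0,\ \ \tilde x=T^1x+T^1U^0t+X^0,\ \ \tilde{\mathfrak r}^1=\mathfrak r^1+\tfrac12(U^0+V^0),\ \ \tilde{\mathfrak r}^2=\mathfrak r^2+\tfrac12(U^0-V^0),\ \ \tilde{\mathfrak r}^3=W(\mathfrak r^3),$$ with arbitrary constants $T^0,T^1,X^0,U^0,V^0$, $T^1\neq0$, and $W$ a smooth function with nonvanishing derivative. Considerations are local. *)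

(* Defs.v *)
From Stdlib Require Import Reals List.
From Coquelicot Require Import Coquelicot.
Open Scope R_scope.

Inductive dep := I1 | I2 | I3.

(* [cu i k l] stands for the derivative of r^i, k times in t and l times in x. *)
Inductive coord := ct | cx | cu (i : dep) (k l : nat).

Definition coord_eq_dec (a b : coord) : {a = b} + {a <> b}.
Proof. repeat decide equality. Defined.

Definition jet := coord -> R.

Notation rr i := (cu i 0 0).

(* The neighbourhoods of [z0] in the product topology of [jet]: they restrict
   finitely many jet coordinates only. *)
Definition box (L : list coord) (eps : R) (z0 z : jet) : Prop :=
  forall a, In a L -> Rabs (z a - z0 a) < eps.

Definition near (z0 : jet) (P : jet -> Prop) : Prop :=
  exists (L : list coord) (eps : R), 0 < eps /\ forall z, box L eps z0 z -> P z.

Definition upd (z : jet) (a : coord) (s : R) : jet :=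
  fun b => if coord_eq_dec a b then s else z b.

Definition pd (a : coord) (F : jet -> R) : jet -> R :=
  fun z => Derive (fun s => F (upd z a s)) (z a).

Definition pds (w : list coord) (F : jet -> R) : jet -> R :=
  fold_right pd F w.

Definition jet_continuous_at (F : jet -> R) (z : jet) : Prop :=
  forall e, 0 < e -> near z (fun z' => Rabs (F z' - F z) < e).

(* Differential functions defined near [z0]: on some neighbourhood, [F] depends
   on finitely many jet coordinates only and is C^oo, i.e. all its iterated
   partial derivatives exist and are (jointly) continuous. Values of [F]
   outside of the neighbourhood are irrelevant. *)
Definition diff_fun (z0 : jet) (F : jet -> R) : Prop :=
  exists (L : list coord) (eps : R), 0 < eps /\
    (forall z z', box L eps z0 z -> box L eps z0 z' ->
       (forall a, In a L -> z a = z' a) -> F z = F z') /\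
    (forall z, box L eps z0 z -> forall w : list coord,
       jet_continuous_at (pds w F) z /\
       forall a, ex_derive (fun s => pds w F (upd z a s)) (z a)).

Definition sum_dep (f : dep -> R) : R := f I1 + f I2 + f I3.

(* Total derivatives; on differential functions only finitely many terms of the
   series are nonzero. *)
Definition Dt (F : jet -> R) : jet -> R := fun z =>
  pd ct F z + sum_dep (fun i => Series (fun k => Series (fun l =>
    z (cu i (S k) l) * pd (cu i k l) F z))).

Definition Dx (F : jet -> R) : jet -> R := fun z =>
  pd cx F z + sum_dep (fun i => Series (fun k => Series (fun l =>
    z (cu i k (S l)) * pd (cu i k l) F z))).

Definition speed (i : dep) (z : jet) : R :=
  match i with
  | I1 => z (rr I1) + z (rr I2) + 1
  | I2 => z (rr I1) + z (rr I2) - 1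
  | I3 => z (rr I1) + z (rr I2)
  end.

Definition equation (i : dep) (z : jet) : Prop :=
  z (cu i 1 0) + speed i z * z (cu i 0 1) = 0.

Definition jet_of (r : dep -> R -> R -> R) (t x : R) : jet := fun a =>
  match a with
  | ct => t
  | cx => x
  | cu i k l => Derive_n (fun t' => Derive_n (fun x' => r i t' x') l x) k t
  end.

(* [r] is a C^oo solution on some neighbourhood of [(t, x)]. *)
Definition solution (r : dep -> R -> R -> R) (t x : R) : Prop :=
  (forall i, diff_fun (jet_of r t x) (fun z => r i (z ct) (z cx))) /\
  locally_2d (fun t' x' => forall i, equation i (jet_of r t' x')) t x.

Definition vanishes_on_solutions (z0 : jet) (F : jet -> R) : Prop :=
  near z0 (fun z => forall r t x,
    solution r t x -> z = jet_of r t x -> F z = 0).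

Record current := Current { density : jet -> R; flux : jet -> R }.

Definition lin_comb (a : R) (C : current) (b : R) (C' : current) : current :=
  Current (fun z => a * density C z + b * density C' z)
          (fun z => a * flux C z + b * flux C' z).

Definition divergence (C : current) : jet -> R :=
  fun z => Dt (density C) z + Dx (flux C) z.

Definition diff_pair (z0 : jet) (C : current) : Prop :=
  diff_fun z0 (density C) /\ diff_fun z0 (flux C).

Definition conserved_current (z0 : jet) (C : current) : Prop :=
  diff_pair z0 C /\ vanishes_on_solutions z0 (divergence C).

Definition null_divergence (z0 : jet) (C : current) : Prop :=
  diff_pair z0 C /\ near z0 (fun z => divergence C z = 0).

Definition vanishing_pair (z0 : jet) (C : current) : Prop :=
  diff_pair z0 C /\
  vanishes_on_solutions z0 (density C) /\ vanishes_on_solutions z0 (flux C).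

Definition trivial_current (z0 : jet) (C : current) : Prop :=
  exists N V, null_divergence z0 N /\ vanishing_pair z0 V /\
    near z0 (fun z => density C z = density N z + density V z /\
                      flux C z = flux N z + flux V z).

(* A conservation law is represented by any of its conserved currents; sets of
   conservation laws are predicates that respect [equivalent]. *)
Definition equivalent (z0 : jet) (C C' : current) : Prop :=
  trivial_current z0 (lin_comb 1 C (-1) C').

Definition hydrodynamic (z0 : jet) (C : current) : Prop :=
  conserved_current z0 C /\
  exists C', conserved_current z0 C' /\ equivalent z0 C C' /\
    exists f : R -> R -> R -> R,
      near z0 (fun z => density C' z = f (z (rr I1)) (z (rr I2)) (z (rr I3))).

Record transformation := Transformation
  { gT0 : R; gT1 : R; gX0 : R; gU0 : R; gV0 : R; gW : R -> R }.

(* [g] belongs to the group and is defined near the base point of [z0]. *)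
Definition point_symmetry (z0 : jet) (g : transformation) : Prop :=
  gT1 g <> 0 /\
  diff_fun z0 (fun z => gW g (z (rr I3))) /\
  near z0 (fun z => Derive (gW g) (z (rr I3)) <> 0).

Definition new_t (g : transformation) (z : jet) : R := gT1 g * z ct + gT0 g.

Definition new_x (g : transformation) (z : jet) : R :=
  gT1 g * z cx + gT1 g * gU0 g * z ct + gX0 g.

Definition new_r (g : transformation) (i : dep) (z : jet) : R :=
  match i with
  | I1 => z (rr I1) + (gU0 g + gV0 g) / 2
  | I2 => z (rr I2) + (gU0 g - gV0 g) / 2
  | I3 => gW g (z (rr I3))
  end.

(* The total derivatives in the new variables, obtained by inverting
   Dx = T1 Dx~ and Dt = T1 Dt~ + T1 U0 Dx~. *)
Definition new_Dx (g : transformation) (F : jet -> R) : jet -> R :=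
  fun z => / gT1 g * Dx F z.

Definition new_Dt (g : transformation) (F : jet -> R) : jet -> R :=
  fun z => / gT1 g * (Dt F z - gU0 g * Dx F z).

Definition prolong (g : transformation) (z : jet) : jet := fun a =>
  match a with
  | ct => new_t g z
  | cx => new_x g z
  | cu i k l => Nat.iter k (new_Dt g) (Nat.iter l (new_Dx g) (new_r g i)) z
  end.

(* The action on currents, rho dx - sigma dt being identified with
   rho~ dx~ - sigma~ dt~, where dx~ = T1 dx + T1 U0 dt and dt~ = T1 dt. This is
   the pullback along [g], i.e. the action of the inverse of [g]; it turns a
   current near [prolong g z] into a current near [z]. *)
Definition act (g : transformation) (C : current) : current :=
  Current
    (fun z => gT1 g * density C (prolong g z))
    (fun z => gT1 g * (flux C (prolong g z)
                       - gU0 g * density C (prolong g z))).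

Definition DHC : current :=
  Current
    (fun z => exp (z (rr I1) - z (rr I2)) * z (rr I3))
    (fun z => (z (rr I1) + z (rr I2))
              * (exp (z (rr I1) - z (rr I2)) * z (rr I3))).

Definition d1 (f : R -> R -> R) : R -> R -> R :=
  fun a b => Derive (fun s => f s b) a.

Definition d2 (f : R -> R -> R) : R -> R -> R :=
  fun a b => Derive (fun s => f a s) b.

Definition EHC (Psi : R -> R -> R) : current :=
  let P1 := fun z : jet => d1 Psi (z (rr I1)) (z (rr I2)) in
  let P2 := fun z : jet => d2 Psi (z (rr I1)) (z (rr I2)) in
  Current
    (fun z => P1 z - P2 z)
    (fun z => (z (rr I1) + z (rr I2) + 1) * P1 z
              - (z (rr I1) + z (rr I2) - 1) * P2 z).

Definition smooth2 (z0 : jet) (Psi : R -> R -> R) : Prop :=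
  diff_fun z0 (fun z => Psi (z (rr I1)) (z (rr I2))).

Definition solves_Psi_eq (z0 : jet) (Psi : R -> R -> R) : Prop :=
  locally_2d (fun a b => 2 * d2 (d1 Psi) a b = d2 Psi a b - d1 Psi a b)
    (z0 (rr I1)) (z0 (rr I2)).

Definition solves_Klein_Gordon (z0 : jet) (Psi : R -> R -> R) : Prop :=
  locally_2d (fun a b => d2 (d1 Psi) a b = - Psi a b / 4)
    (z0 (rr I1)) (z0 (rr I2)).

Inductive generator (z0 : jet) : current -> Prop :=
| gen_DHC : generator z0 DHC
| gen_EHC Psi :
    smooth2 z0 Psi -> solves_Psi_eq z0 Psi -> generator z0 (EHC Psi).

(* Closure of the generating set under linear combinations and point
   symmetries; the base jet varies, as the symmetries move it. *)
Inductive span : jet -> current -> Prop :=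
| span_gen z C : generator z C -> span z C
| span_lin z a C b C' : span z C -> span z C' -> span z (lin_comb a C b C')
| span_act z g C :
    point_symmetry z g -> span (prolong g z) C -> span z (act g C).

Definition generated (z0 : jet) (C : current) : Prop :=
  diff_pair z0 C /\ exists C', span z0 C' /\ equivalent z0 C C'.

(* Main.v *)
(** Replacing the t-derivatives of a jet by means of the system gives a map [evolve] from jets
    to jets of (formal) solutions.  If [evolve z0 = z0] and [F] vanishes on solutions near [z0],
    then [F (evolve z) = 0] for all [z] near [z0]: by the Cauchy-Kovalevskaya construction with
    polynomial initial data, every finite part of [evolve z] is realized by an actual solution.
    Let [rho] be a density depending on the Riemann invariants only and [G] the flux composed
    with [evolve].  Then [Dx G] equals [sum_i V^i rho_i r^i_x] identically in the x-jets;
    descending induction on the order shows that [G] does not depend on x-derivatives, does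
    not depend on [x], and has [G_i = V^i rho_i].  Compatibility of these equations gives
    [rho = e^(r1 - r2) W(r3) + g(r1, r2)], and [g], [G(r1, r2)] determine [Psi_1] and [Psi_2]
    algebraically.  With [rho = 0] the same argument shows that a conserved current is trivial
    once its density vanishes, so the density determines the conservation law.
    If [evolve z0 <> z0], no solution jets lie near [z0] and all currents are trivial there. *)
From Stdlib Require Import Reals List Arith Lra Lia Classical FunctionalExtensionality.
From Coquelicot Require Import Coquelicot.
Require Import Defs.
Open Scope R_scope.

(** * Neighbourhoods of jets and smooth functions *)

(** A condition known only at jets of solutions becomes an identity in free variables once there are
    enough solutions, and supplying them shapes the first half. The formal solution with the
    x-derivatives of a given jet as data need not converge, but a differential function sees
    finitely many coordinates, so polynomial data matching the jet up to that order suffice. Their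
    Taylor coefficients are bounded by one constant [A] on [|x| < 1], and the majorant
    [A * weight k * B ^ k * bin (2 * k) l] survives the recursion in [k]: [bin (2 * k)] lists the
    coefficients of [(1 - x)^-(2 k + 1)], a shape kept by multiplying with an x-derivative, and
    [weight k = 1 / (k + 1)^2] is stable under convolution up to a factor. For the converse, the
    span is handled by a property finer than conservation, [hydro_pair]: density and flux depend on
    the Riemann invariants only and satisfy [sigma_i = V^i rho_i]. It is stable under symmetries by
    a computation of order zero, so no prolonged jets of solutions have to be transported. *)

Lemma upd_same z a s : upd z a s a = s.
Proof. unfold upd; destruct (coord_eq_dec a a); congruence. Qed.

Lemma upd_other z a s b : a <> b -> upd z a s b = z b.
Proof. intros H; unfold upd; destruct (coord_eq_dec a b); congruence. Qed.

Lemma upd_self z a : upd z a (z a) = z.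
Proof.
  apply functional_extensionality; intros b; unfold upd.
  destruct (coord_eq_dec a b); congruence.
Qed.

Lemma upd_upd z a s s' : upd (upd z a s) a s' = upd z a s'.
Proof.
  apply functional_extensionality; intros b; unfold upd.
  destruct (coord_eq_dec a b); congruence.
Qed.

Lemma upd_comm z a b s s' :
  a <> b -> upd (upd z a s) b s' = upd (upd z b s') a s.
Proof.
  intros H; apply functional_extensionality; intros c; unfold upd.
  destruct (coord_eq_dec a c), (coord_eq_dec b c); congruence.
Qed.

Lemma near_imp z (P Q : jet -> Prop) :
  (forall y, P y -> Q y) -> near z P -> near z Q.
Proof. intros H (L & e & He & HP); exists L, e; auto. Qed.

Lemma near_and {z} {P Q : jet -> Prop} :
  near z P -> near z Q -> near z (fun y => P y /\ Q y).
Proof.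
  intros (L & e & He & HP) (L' & e' & He' & HQ).
  exists (L ++ L'), (Rmin e e'); split; [now apply Rmin_pos|].
  intros y Hy; split; [apply HP|apply HQ]; intros a Ha;
    (eapply Rlt_le_trans; [apply Hy; apply in_or_app; auto|]).
  - apply Rmin_l.
  - apply Rmin_r.
Qed.

Lemma near_all z (P : jet -> Prop) : (forall y, P y) -> near z P.
Proof. intros H; exists nil, 1; split; [lra|auto]. Qed.

Lemma near_point z (P : jet -> Prop) : near z P -> P z.
Proof.
  intros (L & e & He & HP); apply HP; intros a _.
  now rewrite Rminus_eq_0, Rabs_R0.
Qed.

Lemma near_coord z a e : 0 < e -> near z (fun y => Rabs (y a - z a) < e).
Proof.
  intros He; exists (a :: nil), e; split; auto.
  intros y Hy; apply Hy; now left.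
Qed.

Lemma near_box L e z0 z : box L e z0 z -> near z (box L e z0).
Proof.
  induction L as [|a L IH]; intros H.
  - apply near_all; intros y b [].
  - assert (Ha : Rabs (z a - z0 a) < e) by (apply H; now left).
    assert (HL : near z (box L e z0)) by (apply IH; intros b Hb; apply H; now right).
    assert (Hc := near_coord z a (e - Rabs (z a - z0 a)) ltac:(lra)).
    eapply near_imp; [|exact (near_and Hc HL)].
    intros y [Hy1 Hy2] b [<-|Hb]; [|now apply Hy2].
    assert (Ht := Rabs_triang (y a - z a) (z a - z0 a)).
    replace (y a - z a + (z a - z0 a)) with (y a - z0 a) in Ht by ring; lra.
Qed.

Lemma near_open z P : near z P -> near z (fun y => near y P).
Proof.
  intros (L & e & He & HP); exists L, e; split; auto.
  intros y Hy; eapply near_imp; [exact HP|now apply near_box].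
Qed.

(** A neighbourhood constrains finitely many coordinates, so continuity of each coordinate
    separately is enough. *)
Lemma near_curve (g : R -> jet) s0 (P : jet -> Prop) :
  (forall a, continuous (fun s => g s a) s0) ->
  near (g s0) P -> locally s0 (fun s => P (g s)).
Proof.
  intros Hg (L & e & He & HP).
  assert (H : locally s0 (fun s => box L e (g s0) (g s))).
  { clear HP; induction L as [|a L IH].
    - apply filter_forall; intros s b [].
    - assert (Ha : locally s0 (fun s => Rabs (g s a - g s0 a) < e)).
      { exact (Hg a _ (locally_ball (g s0 a) (mkposreal e He))). }
      generalize (filter_and _ _ Ha IH); apply filter_imp.
      intros s [H1 H2] b [<-|Hb]; auto. }
  revert H; apply filter_imp; auto.
Qed.

Lemma continuous_upd z a b : continuous (fun s => upd z a s b) (z a).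
Proof.
  unfold upd; destruct (coord_eq_dec a b);
    [apply continuous_id|apply continuous_const].
Qed.

Lemma near_line z a P : near z P -> locally (z a) (fun s => P (upd z a s)).
Proof.
  intros H; apply near_curve.
  - intros b; apply continuous_upd.
  - now rewrite upd_self.
Qed.

Lemma near_map (g : jet -> jet) z (P : jet -> Prop) :
  (forall a, jet_continuous_at (fun y => g y a) z) ->
  near (g z) P -> near z (fun y => P (g y)).
Proof.
  intros Hg (L & e & He & HP).
  assert (H : near z (fun y => box L e (g z) (g y))).
  { clear HP; induction L as [|a L IH].
    - apply near_all; intros s b [].
    - eapply near_imp; [|exact (near_and (Hg a e He) IH)].
      intros s [H1 H2] b [<-|Hb]; auto. }
  revert H; apply near_imp; auto.
Qed.

Lemma box_incl L L' e e' z0 z :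
  incl L L' -> e' <= e -> box L' e' z0 z -> box L e z0 z.
Proof. intros HL He H a Ha; eapply Rlt_le_trans; eauto. Qed.

Lemma jet_continuous_const c z : jet_continuous_at (fun _ => c) z.
Proof.
  intros e He; apply near_all; intros _; now rewrite Rminus_eq_0, Rabs_R0.
Qed.

Lemma jet_continuous_coord a z : jet_continuous_at (fun y => y a) z.
Proof. intros e He; now apply near_coord. Qed.

Lemma jet_continuous_plus F G z :
  jet_continuous_at F z -> jet_continuous_at G z ->
  jet_continuous_at (fun y => F y + G y) z.
Proof.
  intros HF HG e He.
  generalize (near_and (HF (e/2) ltac:(lra)) (HG (e/2) ltac:(lra))).
  apply near_imp; intros y [H1 H2].
  replace (F y + G y - (F z + G z)) with ((F y - F z) + (G y - G z)) by ring.
  eapply Rle_lt_trans; [apply Rabs_triang|lra].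
Qed.

Lemma jet_continuous_mult F G z :
  jet_continuous_at F z -> jet_continuous_at G z ->
  jet_continuous_at (fun y => F y * G y) z.
Proof.
  intros HF HG e He.
  assert (HpF := Rabs_pos (F z)); assert (HpG := Rabs_pos (G z)).
  set (m := 1 + Rabs (F z) + Rabs (G z)).
  assert (Hm : 0 < m) by (unfold m; lra).
  assert (Hd : 0 < Rmin 1 (e / m)).
  { apply Rmin_pos; [lra|]; apply Rdiv_lt_0_compat; lra. }
  generalize (near_and (HF _ Hd) (HG _ Hd)).
  apply near_imp; intros y [H1 H2].
  set (d := Rmin 1 (e / m)) in *.
  assert (Hd1 : d <= 1) by apply Rmin_l.
  assert (Hd2 : d * m <= e).
  { apply Rle_trans with (e / m * m); [|right; field; lra].
    apply Rmult_le_compat_r; [lra|apply Rmin_r]. }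
  replace (F y * G y - F z * G z)
    with ((F y - F z) * (G y - G z) + (F y - F z) * G z + F z * (G y - G z)) by ring.
  eapply Rle_lt_trans; [apply Rabs_triang|].
  eapply Rle_lt_trans; [apply Rplus_le_compat_r, Rabs_triang|].
  rewrite !Rabs_mult.
  assert (P1 := Rabs_pos (F y - F z)); assert (P2 := Rabs_pos (G y - G z)).
  unfold m in Hd2. nra.
Qed.

Lemma jet_continuous_ext F G z :
  near z (fun y => F y = G y) -> jet_continuous_at F z -> jet_continuous_at G z.
Proof.
  intros He HF e e0.
  assert (Hz := near_point _ _ He); simpl in Hz.
  generalize (near_and He (HF e e0)); apply near_imp.
  intros y [H1 H2]; now rewrite <- H1, <- Hz.
Qed.

(** * Partial derivatives in a single jet coordinate *)

Definition is_pd (a : coord) (F : jet -> R) (z : jet) (d : R) : Prop :=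
  is_derive (fun s => F (upd z a s)) (z a) d.

Lemma is_pd_unique {a F z d} : is_pd a F z d -> pd a F z = d.
Proof. apply is_derive_unique. Qed.

Lemma is_pd_ext a F G z d :
  near z (fun y => F y = G y) -> is_pd a F z d -> is_pd a G z d.
Proof.
  intros H; apply is_derive_ext_loc; apply (near_line z a _ H).
Qed.

Lemma pd_ext a F G z : near z (fun y => F y = G y) -> pd a F z = pd a G z.
Proof. intros H; apply Derive_ext_loc; apply (near_line z a _ H). Qed.

Lemma is_derive_Rmult (f g : R -> R) x df dg :
  is_derive f x df -> is_derive g x dg ->
  is_derive (fun t => f t * g t) x (df * g x + f x * dg).
Proof.
  intros Hf Hg; apply is_derive_Reals.
  apply (derivable_pt_lim_mult f g x df dg); now apply is_derive_Reals.
Qed.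

Lemma is_derive_Rplus (f g : R -> R) x df dg :
  is_derive f x df -> is_derive g x dg ->
  is_derive (fun t => f t + g t) x (df + dg).
Proof. intros Hf Hg; exact (is_derive_plus f g x df dg Hf Hg). Qed.

Lemma is_pd_const a c z : is_pd a (fun _ => c) z 0.
Proof. apply (is_derive_const c (z a)). Qed.

Lemma is_pd_coord a b z :
  is_pd a (fun y => y b) z (if coord_eq_dec a b then 1 else 0).
Proof.
  unfold is_pd, upd; destruct (coord_eq_dec a b).
  - apply (is_derive_id (z a)).
  - apply (is_derive_const (z b) (z a)).
Qed.

Lemma is_pd_plus a F G z d d' :
  is_pd a F z d -> is_pd a G z d' -> is_pd a (fun y => F y + G y) z (d + d').
Proof. apply is_derive_Rplus. Qed.

Lemma is_pd_mult a F G z d d' :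
  is_pd a F z d -> is_pd a G z d' ->
  is_pd a (fun y => F y * G y) z (d * G z + F z * d').
Proof.
  intros HF HG.
  generalize (is_derive_Rmult _ _ _ _ _ HF HG); now rewrite upd_self.
Qed.

(** * Smoothness on open sets of jets *)

Definition open_jets (B : jet -> Prop) : Prop := forall z, B z -> near z B.

Lemma box_open L e z0 : open_jets (box L e z0).
Proof. intros z; apply near_box. Qed.

Definition sm_on (B : jet -> Prop) (F : jet -> R) : Prop :=
  forall z, B z -> forall w : list coord,
    jet_continuous_at (pds w F) z /\
    forall a, ex_derive (fun s => pds w F (upd z a s)) (z a).

Lemma sm_on_pds B F w : sm_on B F -> sm_on B (pds w F).
Proof.
  intros H z Hz w'. destruct (H z Hz (w' ++ w)) as [H1 H2].
  unfold pds in *. rewrite fold_right_app in H1.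
  split; auto. intros a; generalize (H2 a); now rewrite fold_right_app.
Qed.

Lemma sm_on_pd B F a : sm_on B F -> sm_on B (pd a F).
Proof. apply (sm_on_pds B F (a :: nil)). Qed.

Lemma sm_on_is_pd B F z a : sm_on B F -> B z -> is_pd a F z (pd a F z).
Proof. intros H Hz; apply Derive_correct, (H z Hz nil). Qed.

Lemma sm_on_continuous B F z : sm_on B F -> B z -> jet_continuous_at F z.
Proof. intros H Hz; apply (H z Hz nil). Qed.

Lemma sm_on_sub (B B' : jet -> Prop) F :
  (forall z, B' z -> B z) -> sm_on B F -> sm_on B' F.
Proof. intros H HF z Hz; apply HF; auto. Qed.

(** By induction on [w], every [pds w F] agrees on [B] with a member of [S]; openness of [B] allows
    such an equality to be differentiated. Smoothness proofs thereby reduce to exhibiting a class of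
    continuous functions that is closed under partial derivatives. *)
Lemma sm_on_coind (B : jet -> Prop) (S : (jet -> R) -> Prop) :
  open_jets B ->
  (forall F, S F -> forall z, B z -> jet_continuous_at F z) ->
  (forall F, S F -> forall a, exists G, S G /\
     forall z, B z -> is_pd a F z (G z)) ->
  forall F, S F -> sm_on B F.
Proof.
  intros HB Hc Hd F HF.
  assert (H : forall w, exists G, S G /\ forall z, B z -> pds w F z = G z).
  { induction w as [|a w (G & HG & IH)]; [now exists F|].
    destruct (Hd G HG a) as (G' & HG' & HG'').
    exists G'; split; auto; intros z Hz; simpl.
    rewrite <- (is_pd_unique (HG'' z Hz)).
    apply pd_ext; revert IH; intros IH.
    generalize (HB z Hz); apply near_imp; exact IH. }
  intros z Hz w; destruct (H w) as (G & HG & HwG).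
  assert (Hn : near z (fun y => G y = pds w F y)).
  { generalize (HB z Hz); apply near_imp; intros; symmetry; auto. }
  split; [apply (jet_continuous_ext G); auto|].
  intros a; destruct (Hd G HG a) as (G' & _ & HG').
  exists (G' z); apply (is_pd_ext a G); auto.
Qed.

Lemma sm_on_ext (B : jet -> Prop) F G :
  open_jets B -> (forall z, B z -> F z = G z) -> sm_on B F -> sm_on B G.
Proof.
  intros HB HE HF.
  apply (sm_on_coind B (fun G => exists F, sm_on B F /\ forall z, B z -> F z = G z));
    auto; [| |now exists F].
  - intros H (K & HK & HKH) z Hz; apply (jet_continuous_ext K).
    + generalize (HB z Hz); apply near_imp; auto.
    + now apply (sm_on_continuous B).
  - intros H (K & HK & HKH) a; exists (pd a K); split.
    + exists (pd a K); split; auto; now apply sm_on_pd.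
    + intros z Hz; apply (is_pd_ext a K).
      * generalize (HB z Hz); apply near_imp; auto.
      * now apply (sm_on_is_pd B).
Qed.

(** The derivative of a product is a sum of products, so the natural classes for [sm_on_coind] are
    closed under [pd] only after passing to the algebra they generate. Constants enter through
    [S]. *)
Inductive alg (S : (jet -> R) -> Prop) : (jet -> R) -> Prop :=
| alg_base F : S F -> alg S F
| alg_plus F G : alg S F -> alg S G -> alg S (fun z => F z + G z)
| alg_mult F G : alg S F -> alg S G -> alg S (fun z => F z * G z).

Lemma sm_on_alg (B : jet -> Prop) (S : (jet -> R) -> Prop) :
  open_jets B ->
  (forall F, S F -> forall z, B z -> jet_continuous_at F z) ->
  (forall F, S F -> forall a, exists G, alg S G /\
     forall z, B z -> is_pd a F z (G z)) ->
  forall F, alg S F -> sm_on B F.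
Proof.
  intros HB Hc Hd; apply sm_on_coind; auto.
  - intros F HF z Hz; induction HF.
    + now apply Hc.
    + now apply jet_continuous_plus.
    + now apply jet_continuous_mult.
  - intros F HF a; induction HF as [F HF|F G HF (F' & H1 & H2) HG (G' & H3 & H4)
                                  |F G HF (F' & H1 & H2) HG (G' & H3 & H4)].
    + now apply Hd.
    + exists (fun z => F' z + G' z); split; [now apply alg_plus|].
      intros z Hz; apply is_pd_plus; auto.
    + exists (fun z => F' z * G z + F z * G' z); split.
      * apply alg_plus; now apply alg_mult.
      * intros z Hz; apply is_pd_mult; auto.
Qed.

Lemma sm_on_base_alg (B : jet -> Prop) F :
  open_jets B -> alg (sm_on B) F -> sm_on B F.
Proof.
  intros HB; apply sm_on_alg; auto.
  - intros G HG z Hz; now apply (sm_on_continuous B).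
  - intros G HG a; exists (pd a G); split.
    + apply alg_base; now apply sm_on_pd.
    + intros z Hz; now apply (sm_on_is_pd B).
Qed.

Lemma sm_on_plus (B : jet -> Prop) F G :
  open_jets B -> sm_on B F -> sm_on B G -> sm_on B (fun z => F z + G z).
Proof.
  intros HB HF HG; apply sm_on_base_alg; auto.
  apply alg_plus; now apply alg_base.
Qed.

Lemma sm_on_mult (B : jet -> Prop) F G :
  open_jets B -> sm_on B F -> sm_on B G -> sm_on B (fun z => F z * G z).
Proof.
  intros HB HF HG; apply sm_on_base_alg; auto.
  apply alg_mult; now apply alg_base.
Qed.

Lemma sm_on_const (B : jet -> Prop) c : open_jets B -> sm_on B (fun _ => c).
Proof.
  intros HB.
  apply (sm_on_coind B (fun F => exists c, F = fun _ => c)); auto; [| |now exists c].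
  - intros F [d ->] z _; apply jet_continuous_const.
  - intros F [d ->] a; exists (fun _ => 0); split; [now exists 0|].
    intros z _; apply is_pd_const.
Qed.

Lemma sm_on_coord (B : jet -> Prop) a : open_jets B -> sm_on B (fun z => z a).
Proof.
  intros HB.
  apply (sm_on_coind B (fun F => (exists b, F = fun z => z b) \/ sm_on B F));
    auto; [| |left; now exists a].
  - intros F [[b ->]|HF] z Hz; [apply jet_continuous_coord|].
    now apply (sm_on_continuous B).
  - intros F [[b ->]|HF] c.
    + exists (fun _ => if coord_eq_dec c b then 1 else 0); split.
      * right; now apply sm_on_const.
      * intros z _; apply is_pd_coord.
    + exists (pd c F); split; [right; now apply sm_on_pd|].
      intros z Hz; now apply (sm_on_is_pd B).
Qed.

(** * Differential functions on a box *)

Definition dep_on (B : jet -> Prop) (L : list coord) (F : jet -> R) : Prop :=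
  forall z z', B z -> B z' -> (forall a, In a L -> z a = z' a) -> F z = F z'.

Definition diff_on (L : list coord) (e : R) (z0 : jet) (F : jet -> R) : Prop :=
  dep_on (box L e z0) L F /\ sm_on (box L e z0) F.

Lemma diff_fun_iff z0 F : diff_fun z0 F <-> exists L e, 0 < e /\ diff_on L e z0 F.
Proof.
  split.
  - intros (L & e & H0 & H1 & H2); exists L, e; split; [auto|split; auto].
  - intros (L & e & H0 & H1 & H2); exists L, e; auto.
Qed.

Lemma diff_on_incl L L' e e' z0 F :
  incl L L' -> e' <= e -> diff_on L e z0 F -> diff_on L' e' z0 F.
Proof.
  intros HL He [H1 H2]; split.
  - intros z z' Hz Hz' H; apply H1; eauto using box_incl.
  - eapply sm_on_sub; [|exact H2]; intros z; now apply box_incl.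
Qed.

Lemma diff_fun_common z0 (l : list (jet -> R)) :
  (forall F, In F l -> diff_fun z0 F) ->
  exists L e, 0 < e /\ forall F, In F l -> diff_on L e z0 F.
Proof.
  induction l as [|F l IH]; intros H.
  - exists nil, 1; split; [lra|intros F []].
  - destruct IH as (L & e & He & HL); [intros G HG; apply H; now right|].
    destruct (proj1 (diff_fun_iff z0 F) (H F (or_introl eq_refl))) as (L' & e' & He' & HL').
    exists (L ++ L'), (Rmin e e'); split; [now apply Rmin_pos|].
    intros G [<-|HG].
    + eapply diff_on_incl; [apply incl_appr, incl_refl|apply Rmin_r|exact HL'].
    + eapply diff_on_incl; [apply incl_appl, incl_refl|apply Rmin_l|auto].
Qed.

Lemma diff_fun_common_near z0 (l : list (jet -> R)) P :
  (forall F, In F l -> diff_fun z0 F) -> near z0 P ->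
  exists L e, 0 < e /\ (forall F, In F l -> diff_on L e z0 F) /\
    forall z, box L e z0 z -> P z.
Proof.
  intros H (L' & e' & He' & HP).
  destruct (diff_fun_common z0 l H) as (L & e & He & HL).
  exists (L ++ L'), (Rmin e e'); split; [now apply Rmin_pos|split].
  - intros F HF; eapply diff_on_incl; [apply incl_appl, incl_refl|apply Rmin_l|auto].
  - intros z Hz; apply HP; eapply box_incl;
      [apply incl_appr, incl_refl|apply Rmin_r|exact Hz].
Qed.

Lemma diff_fun_near2 z0 F G P :
  diff_fun z0 F -> diff_fun z0 G -> near z0 P ->
  exists L e, 0 < e /\ diff_on L e z0 F /\ diff_on L e z0 G /\ forall z, box L e z0 z -> P z.
Proof.
  intros HF HG HP.
  destruct (diff_fun_common_near z0 (F :: G :: nil) P) as (L & e & He & HL & HB); auto.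
  { intros H [<-|[<-|[]]]; auto. }
  exists L, e; repeat split; try apply HL; simpl; auto.
Qed.

Lemma diff_fun_near z0 F P :
  diff_fun z0 F -> near z0 P ->
  exists L e, 0 < e /\ diff_on L e z0 F /\ forall z, box L e z0 z -> P z.
Proof.
  intros HF HP; destruct (diff_fun_near2 z0 F F P HF HF HP) as (L & e & He & HL & _ & HB).
  now exists L, e.
Qed.

Lemma box_center L e z0 : 0 < e -> box L e z0 z0.
Proof. intros He a _; now rewrite Rminus_eq_0, Rabs_R0. Qed.

Lemma near_box0 L e z0 : 0 < e -> near z0 (box L e z0).
Proof. intros He; now apply near_box, box_center. Qed.

Lemma diff_fun_ext z0 F G :
  near z0 (fun z => F z = G z) -> diff_fun z0 F -> diff_fun z0 G.
Proof.
  intros HE HF.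
  destruct (diff_fun_near z0 F _ HF HE) as (L & e & He & [H1 H2] & HP).
  apply diff_fun_iff; exists L, e; split; [auto|split].
  - intros z z' Hz Hz' Ha; rewrite <- !HP by auto; auto.
  - apply (sm_on_ext _ F); auto using box_open.
Qed.

Lemma diff_fun_const z0 c : diff_fun z0 (fun _ => c).
Proof.
  apply diff_fun_iff; exists nil, 1; split; [lra|split].
  - intros z z' _ _ _; auto.
  - apply sm_on_const, box_open.
Qed.

Lemma diff_fun_coord z0 a : diff_fun z0 (fun z => z a).
Proof.
  apply diff_fun_iff; exists (a :: nil), 1; split; [lra|split].
  - intros z z' _ _ H; apply H; now left.
  - apply sm_on_coord, box_open.
Qed.

Lemma diff_fun_binary (op : R -> R -> R) z0 F G :
  (forall B, open_jets B -> sm_on B F -> sm_on B G -> sm_on B (fun z => op (F z) (G z))) ->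
  diff_fun z0 F -> diff_fun z0 G -> diff_fun z0 (fun z => op (F z) (G z)).
Proof.
  intros Hop HF HG.
  destruct (diff_fun_near2 z0 F G _ HF HG (near_all _ _ (fun _ => I)))
    as (L & e & He & [F1 F2] & [G1 G2] & _).
  apply diff_fun_iff; exists L, e; split; [auto|split].
  - intros z z' Hz Hz' H; rewrite (F1 z z'), (G1 z z'); auto.
  - apply Hop; auto using box_open.
Qed.

Lemma diff_fun_plus z0 F G :
  diff_fun z0 F -> diff_fun z0 G -> diff_fun z0 (fun z => F z + G z).
Proof. apply (diff_fun_binary Rplus); intros B; apply sm_on_plus. Qed.

Lemma diff_fun_mult z0 F G :
  diff_fun z0 F -> diff_fun z0 G -> diff_fun z0 (fun z => F z * G z).
Proof. apply (diff_fun_binary Rmult); intros B; apply sm_on_mult. Qed.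

Lemma diff_fun_minus z0 F G :
  diff_fun z0 F -> diff_fun z0 G -> diff_fun z0 (fun z => F z - G z).
Proof.
  intros HF HG; apply (diff_fun_ext z0 (fun z => F z + (-1) * G z)).
  - apply near_all; intros z; ring.
  - apply diff_fun_plus; auto; apply diff_fun_mult; auto; apply diff_fun_const.
Qed.

Lemma diff_fun_continuous z0 F : diff_fun z0 F -> jet_continuous_at F z0.
Proof.
  intros H; apply diff_fun_iff in H; destruct H as (L & e & He & _ & H).
  apply (sm_on_continuous _ _ _ H), box_center, He.
Qed.

(** Moving a coordinate outside [L] stays in the box and does not change the function, so that
    derivative is 0. For a coordinate in [L], the two one-variable functions agree near the common
    value of that coordinate. *)
Lemma dep_on_pds L e z0 F w :
  dep_on (box L e z0) L F -> dep_on (box L e z0) L (pds w F).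
Proof.
  intros H; induction w as [|a w IH]; auto.
  intros z z' Hz Hz' Ha; simpl; unfold pd.
  destruct (in_dec coord_eq_dec a L) as [Hi|Hi].
  - rewrite (Ha a Hi); apply Derive_ext_loc.
    assert (H1 := near_line z a _ (near_box L e z0 z Hz)).
    assert (H2 := near_line z' a _ (near_box L e z0 z' Hz')).
    rewrite (Ha a Hi) in H1.
    generalize (filter_and _ _ H1 H2); apply filter_imp.
    intros s [S1 S2]; apply IH; auto.
    intros b Hb; unfold upd; destruct (coord_eq_dec a b); auto.
  - assert (Hc : forall y, box L e z0 y ->
        Derive (fun s => pds w F (upd y a s)) (y a) = 0).
    { intros y Hy; rewrite (Derive_ext _ (fun _ => pds w F y)); [apply Derive_const|].
      intros s; apply IH; auto.
      - intros b Hb; rewrite upd_other; [now apply Hy|congruence].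
      - intros b Hb; rewrite upd_other; [auto|congruence]. }
    now rewrite !Hc.
Qed.

Lemma diff_on_pd_out L e z0 F a z :
  diff_on L e z0 F -> box L e z0 z -> ~ In a L -> pd a F z = 0.
Proof.
  intros [H _] Hz Ha; unfold pd.
  rewrite (Derive_ext _ (fun _ => F z)); [apply Derive_const|].
  intros s; apply H; auto.
  - intros b Hb; rewrite upd_other; [now apply Hz|congruence].
  - intros b Hb; rewrite upd_other; [auto|congruence].
Qed.

Lemma diff_on_pds L e z0 F w : diff_on L e z0 F -> diff_on L e z0 (pds w F).
Proof. intros [H1 H2]; split; [now apply dep_on_pds|now apply sm_on_pds]. Qed.

Lemma diff_fun_pd z0 F a : diff_fun z0 F -> diff_fun z0 (pd a F).
Proof.
  intros H; apply diff_fun_iff in H; destruct H as (L & e & He & H).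
  apply diff_fun_iff; exists L, e; split; auto.
  now apply (diff_on_pds L e z0 F (a :: nil)).
Qed.

(** * Chain rule, composition, symmetry of second derivatives *)

Lemma is_derive_eps (f : R -> R) x l :
  is_derive f x l <-> forall e, 0 < e ->
    locally x (fun y => Rabs (f y - f x - l * (y - x)) <= e * Rabs (y - x)).
Proof.
  split.
  - intros [_ H] e He.
    assert (Hx : is_filter_lim (locally x) x) by (intros P HP; exact HP).
    generalize (H x Hx (mkposreal e He)); apply filter_imp.
    intros y Hy; unfold minus, plus, opp, scal, norm in Hy; simpl in Hy.
    unfold mult, abs in Hy; simpl in Hy.
    replace (f y - f x - l * (y - x)) with (f y + - f x + - ((y + - x) * l)) by ring.
    exact Hy.
  - intros H; split; [apply is_linear_scal_l|].
    intros y Hy e.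
    assert (Hxy := is_filter_lim_locally_unique _ _ Hy); simpl in Hxy; subst y.
    generalize (H e (cond_pos e)); apply filter_imp.
    intros y Hy'; unfold minus, plus, opp, scal, norm; simpl.
    unfold mult, abs; simpl.
    replace (f y + - f x + - ((y + - x) * l)) with (f y - f x - l * (y - x)) by ring.
    exact Hy'.
Qed.

(** A chain rule for an [f] that need not be a function of [h]: to first order its increment is [d]
    times that of [h]. The form with [<=] also covers points where [h y = h x]. *)
Lemma is_derive_near_linear (f h : R -> R) x v d :
  is_derive h x v ->
  (forall e, 0 < e -> locally x (fun y =>
     Rabs (f y - f x - d * (h y - h x)) <= e * Rabs (h y - h x))) ->
  is_derive f x (d * v).
Proof.
  intros Hh Hf; apply is_derive_eps; intros e He.
  assert (Hpv := Rabs_pos v); assert (Hpd := Rabs_pos d).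
  (* Each of the two error terms gets half of [e]. The bound 1 in [e2] gives
     [|h y - h x| <= (|v| + 1) |y - x|], which explains the denominator of [e1]. *)
  set (e1 := e / (2 * (Rabs v + 1))).
  set (e2 := Rmin 1 (e / (2 * (Rabs d + 1)))).
  assert (He1 : 0 < e1) by (apply Rdiv_lt_0_compat; lra).
  assert (He2 : 0 < e2).
  { apply Rmin_pos; [lra|apply Rdiv_lt_0_compat; lra]. }
  generalize (filter_and _ _ (Hf e1 He1) (proj1 (is_derive_eps h x v) Hh e2 He2)).
  apply filter_imp; intros y [H1 H2].
  assert (Hpy := Rabs_pos (y - x)).
  assert (Hh' : Rabs (h y - h x) <= (Rabs v + 1) * Rabs (y - x)).
  { replace (h y - h x) with ((h y - h x - v * (y - x)) + v * (y - x)) by ring.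
    eapply Rle_trans; [apply Rabs_triang|]; rewrite Rabs_mult.
    assert (e2 <= 1) by apply Rmin_l. nra. }
  replace (f y - f x - d * v * (y - x))
    with ((f y - f x - d * (h y - h x)) + d * (h y - h x - v * (y - x))) by ring.
  eapply Rle_trans; [apply Rabs_triang|]; rewrite Rabs_mult.
  assert (E1 : e1 * ((Rabs v + 1) * Rabs (y - x)) = e / 2 * Rabs (y - x)).
  { unfold e1; field; lra. }
  assert (E2 : Rabs d * e2 <= e / 2).
  { apply Rle_trans with ((Rabs d + 1) * (e / (2 * (Rabs d + 1)))).
    - apply Rmult_le_compat; try lra; apply Rmin_r.
    - right; field; lra. }
  assert (e1 * Rabs (h y - h x) <= e / 2 * Rabs (y - x)).
  { rewrite <- E1; apply Rmult_le_compat_l; lra. }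
  assert (Rabs d * Rabs (h y - h x - v * (y - x)) <= e / 2 * Rabs (y - x)).
  { apply Rle_trans with (Rabs d * (e2 * Rabs (y - x))).
    - apply Rmult_le_compat_l; lra.
    - rewrite <- Rmult_assoc; apply Rmult_le_compat_r; lra. }
  lra.
Qed.

(** Repeated entries are counted once: the coordinate lists arise by concatenation and may contain
    duplicates, while a total derivative has one term per coordinate. *)
Fixpoint lsum (L : list coord) (h : coord -> R) : R :=
  match L with
  | nil => 0
  | a :: L' => (if in_dec coord_eq_dec a L' then 0 else h a) + lsum L' h
  end.

Lemma lsum_ext L h h' : (forall a, In a L -> h a = h' a) -> lsum L h = lsum L h'.
Proof.
  induction L as [|a L IH]; simpl; intros H; auto.
  rewrite IH by auto; destruct (in_dec coord_eq_dec a L); rewrite ?H; auto.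
Qed.

Lemma lsum_plus L h h' : lsum L (fun a => h a + h' a) = lsum L h + lsum L h'.
Proof.
  induction L as [|a L IH]; simpl; [ring|].
  rewrite IH; destruct (in_dec coord_eq_dec a L); ring.
Qed.

Lemma lsum_zero L h : (forall a, In a L -> h a = 0) -> lsum L h = 0.
Proof.
  induction L as [|a L IH]; simpl; intros H; auto.
  rewrite IH by auto; destruct (in_dec coord_eq_dec a L); rewrite ?H; auto; ring.
Qed.

Lemma lsum_single L h b :
  In b L -> (forall a, In a L -> a <> b -> h a = 0) -> lsum L h = h b.
Proof.
  induction L as [|a L IH]; simpl; intros Hb H; [easy|].
  destruct (in_dec coord_eq_dec a L) as [Hi|Hi].
  - rewrite IH; auto; [ring|]. destruct Hb as [<-|Hb]; auto.
  - destruct (coord_eq_dec a b) as [<-|Hab].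
    + rewrite lsum_zero; [ring|]. intros c Hc; apply H; auto; congruence.
    + rewrite IH; auto; [rewrite H; auto; ring|].
      destruct Hb; [congruence|auto].
Qed.

(** Enlarging [M] by one coordinate at a time leads from [z] to [z'] through jets that differ in one
    coordinate, which splits an increment of a function into one-variable increments. *)
Definition mix (M : list coord) (z z' : jet) : jet :=
  fun a => if in_dec coord_eq_dec a M then z' a else z a.

Lemma mix_in M z z' a : In a M -> mix M z z' a = z' a.
Proof. intros H; unfold mix; destruct (in_dec coord_eq_dec a M); easy. Qed.

Lemma mix_out M z z' a : ~ In a M -> mix M z z' a = z a.
Proof. intros H; unfold mix; destruct (in_dec coord_eq_dec a M); easy. Qed.

Lemma mix_cons_in a M z z' : In a M -> mix (a :: M) z z' = mix M z z'.
Proof.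
  intros H; apply functional_extensionality; intros b; unfold mix.
  destruct (in_dec coord_eq_dec b (a :: M)), (in_dec coord_eq_dec b M);
    simpl in *; auto; intuition congruence.
Qed.

Lemma mix_cons_out a M z z' :
  ~ In a M -> mix (a :: M) z z' = upd (mix M z z') a (z' a).
Proof.
  intros H; apply functional_extensionality; intros b; unfold mix, upd.
  destruct (in_dec coord_eq_dec b (a :: M)), (in_dec coord_eq_dec b M),
    (coord_eq_dec a b); subst; simpl in *; tauto.
Qed.

Lemma box_mix M L e z0 z z' : box L e z0 z -> box L e z0 z' -> box L e z0 (mix M z z').
Proof. intros H H' a Ha; unfold mix; destruct (in_dec coord_eq_dec a M); auto. Qed.

Lemma box_upd L e z0 z a s :
  box L e z0 z -> Rabs (s - z0 a) < e -> box L e z0 (upd z a s).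
Proof. intros H H' b Hb; unfold upd; destruct (coord_eq_dec a b); subst; auto. Qed.

Lemma box_upd_between L e z0 z a s s' c :
  box L e z0 (upd z a s) -> box L e z0 (upd z a s') ->
  Rmin s s' <= c <= Rmax s s' -> box L e z0 (upd z a c).
Proof.
  intros H H' Hc b Hb; specialize (H b Hb); specialize (H' b Hb).
  unfold upd in *; destruct (coord_eq_dec a b); auto; subst.
  apply Rabs_def2 in H; apply Rabs_def2 in H'; apply Rabs_def1;
    unfold Rmin, Rmax in Hc; destruct (Rle_dec s s'); lra.
Qed.

Lemma pd_mvt L e z0 F D a z s s' :
  box L e z0 (upd z a s) -> box L e z0 (upd z a s') ->
  (forall y, box L e z0 y -> is_pd a F y (D y)) ->
  exists c, Rmin s s' <= c <= Rmax s s' /\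
    F (upd z a s') - F (upd z a s) = D (upd z a c) * (s' - s).
Proof.
  intros H H' HD.
  destruct (MVT_gen (fun t => F (upd z a t)) s s' (fun t => D (upd z a t)))
    as (c & Hc & HE).
  - intros t Ht.
    assert (Hd := HD (upd z a t) (box_upd_between L e z0 z a s s' t H H' ltac:(lra))).
    unfold is_pd in Hd; rewrite upd_same in Hd.
    revert Hd; apply is_derive_ext; intros u; now rewrite upd_upd.
  - intros t Ht.
    assert (Hd := HD (upd z a t) (box_upd_between L e z0 z a s s' t H H' ltac:(lra))).
    unfold is_pd in Hd; rewrite upd_same in Hd.
    apply continuity_pt_filterlim, (ex_derive_continuous (fun t => F (upd z a t))).
    eexists; eapply is_derive_ext; [|exact Hd]; intros u; simpl; now rewrite upd_upd.
  - exists c; split; auto.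
Qed.

Lemma pd_zero_const L e z0 F a z s s' :
  box L e z0 (upd z a s) -> box L e z0 (upd z a s') ->
  (forall y, box L e z0 y -> is_pd a F y 0) -> F (upd z a s') = F (upd z a s).
Proof.
  intros H H' HD.
  destruct (pd_mvt L e z0 F (fun _ => 0) a z s s' H H' HD) as (c & _ & Hc); lra.
Qed.

(** The increment of [F] is telescoped along [mix M (g s0) (g s)]. Each step is one application of
    the mean value theorem in one coordinate, and continuity of [D a] at [g s0] replaces the
    intermediate point by [g s0]. For [M = L] the mixed jet agrees with [g s] wherever [F] looks. *)
Lemma chain_rule L e z0 F (g : R -> jet) s0 (v : coord -> R) (D : coord -> jet -> R) :
  dep_on (box L e z0) L F -> box L e z0 (g s0) ->
  (forall a, In a L -> forall y, box L e z0 y -> is_pd a F y (D a y)) ->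
  (forall a, In a L -> jet_continuous_at (D a) (g s0)) ->
  (forall a, In a L -> is_derive (fun s => g s a) s0 (v a)) ->
  is_derive (fun s => F (g s)) s0 (lsum L (fun a => D a (g s0) * v a)).
Proof.
  intros Hdep H0 HD HcD Hg.
  assert (Hmc : forall M, incl M L -> forall a,
            continuous (fun s => mix M (g s0) (g s) a) s0).
  { intros M HM a; unfold mix; destruct (in_dec coord_eq_dec a M) as [Hi|Hi].
    - apply (ex_derive_continuous (fun s => g s a)); exists (v a); auto.
    - apply continuous_const. }
  assert (Hm0 : forall M, mix M (g s0) (g s0) = g s0).
  { intros M; apply functional_extensionality; intros b; unfold mix.
    now destruct (in_dec coord_eq_dec b M). }
  assert (Hmb : forall M, incl M L -> forall P, near (g s0) P ->
            locally s0 (fun s => P (mix M (g s0) (g s)))).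
  { intros M HM P HP; apply near_curve; [now apply Hmc|now rewrite Hm0]. }
  assert (HM : forall M, incl M L ->
    is_derive (fun s => F (mix M (g s0) (g s))) s0 (lsum M (fun a => D a (g s0) * v a))).
  { induction M as [|a M IH]; intros HM; simpl.
    - apply (is_derive_ext (fun _ => F (g s0))); [reflexivity|].
      apply (is_derive_const (F (g s0)) s0).
    - assert (HM' : incl M L) by (intros b Hb; apply HM; now right).
      assert (Ha : In a L) by (apply HM; now left).
      specialize (IH HM').
      destruct (in_dec coord_eq_dec a M) as [Hi|Hi].
      + rewrite Rplus_0_l; revert IH; apply is_derive_ext.
        intros s; now rewrite mix_cons_in.
      + apply (is_derive_ext (fun s =>
          (F (mix (a :: M) (g s0) (g s)) - F (mix M (g s0) (g s)))
          + F (mix M (g s0) (g s)))); [intros s; simpl; ring|].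
        apply is_derive_Rplus; auto.
        apply (is_derive_near_linear _ (fun s => g s a)); [now apply Hg|].
        intros eta Heta.
        assert (Hn := near_and (near_box L e z0 _ H0) (HcD a Ha eta Heta)).
        destruct Hn as (L' & e' & He' & Hn).
        generalize (filter_and _ _ (Hmb _ HM' _ (near_box0 L' e' (g s0) He'))
                                   (Hmb _ HM _ (near_box0 L' e' (g s0) He'))).
        apply filter_imp; intros s [S1 S2].
        cbv beta.
        assert (Emix : mix M (g s0) (g s) = upd (mix M (g s0) (g s)) a (g s0 a)).
        { rewrite <- (mix_out M (g s0) (g s) a Hi); now rewrite upd_self. }
        rewrite Emix in S1.
        rewrite !Hm0, (mix_cons_out a M (g s0) (g s) Hi).
        rewrite mix_cons_out in S2 by auto.
        replace (F (mix M (g s0) (g s)))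
          with (F (upd (mix M (g s0) (g s)) a (g s0 a))) by now rewrite <- Emix.
        destruct (pd_mvt L e z0 F (D a) a (mix M (g s0) (g s)) (g s0 a) (g s a))
          as (c & Hc & HE); auto; [now apply Hn|now apply Hn|].
        rewrite HE, Rminus_diag.
        assert (Hb := box_upd_between _ _ _ _ _ _ _ _ S1 S2 Hc).
        replace (D a (upd (mix M (g s0) (g s)) a c) * (g s a - g s0 a) - 0
                 - D a (g s0) * (g s a - g s0 a))
          with ((D a (upd (mix M (g s0) (g s)) a c) - D a (g s0)) * (g s a - g s0 a))
          by ring.
        rewrite Rabs_mult; apply Rmult_le_compat_r; [apply Rabs_pos|].
        left; now apply Hn. }
  generalize (HM L (incl_refl L)); apply is_derive_ext_loc.
  generalize (Hmb L (incl_refl L) _ (near_box L e z0 _ H0)); apply filter_imp.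
  intros s Hs.
  apply Hdep; auto.
  - intros a Ha; specialize (Hs a Ha); rewrite mix_in in Hs; auto.
  - intros a Ha; now rewrite mix_in.
Qed.

Lemma diff_on_chain L e z0 F (g : R -> jet) s0 (v : coord -> R) :
  diff_on L e z0 F -> box L e z0 (g s0) ->
  (forall a, In a L -> is_derive (fun s => g s a) s0 (v a)) ->
  is_derive (fun s => F (g s)) s0 (lsum L (fun a => pd a F (g s0) * v a)).
Proof.
  intros [H1 H2] H0 Hv.
  apply (chain_rule L e z0 F g s0 v (fun a => pd a F)); auto.
  - intros a Ha y Hy; now apply (sm_on_is_pd _ _ _ _ H2).
  - intros a Ha; apply (sm_on_continuous (box L e z0)); auto; now apply sm_on_pd.
Qed.

(** The same telescoping as for the chain rule, where local bounds on the partial derivatives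
    already control each step. This yields joint continuity for functions known only through their
    partial derivatives, such as the power series solutions below. *)
Lemma continuous_of_bounded_pd L e z0 F D K z :
  0 <= K -> dep_on (box L e z0) L F -> box L e z0 z ->
  (forall a, In a L -> forall y, box L e z0 y -> is_pd a F y (D a y)) ->
  (forall a, In a L -> near z (fun y => Rabs (D a y) <= K)) ->
  jet_continuous_at F z.
Proof.
  intros HK Hdep Hz HD Hb.
  assert (HM : forall M, incl M L -> forall eps, 0 < eps ->
    near z (fun y => Rabs (F (mix M z y) - F z) < eps)).
  { induction M as [|a M IH]; intros HM eps Heps.
    - apply near_all; intros y; change (mix nil z y) with z.
      now rewrite Rminus_diag, Rabs_R0.
    - assert (HM' : incl M L) by (intros b Hi; apply HM; now right).
      assert (Ha : In a L) by (apply HM; now left).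
      destruct (in_dec coord_eq_dec a M) as [Hi|Hi].
      + generalize (IH HM' eps Heps); apply near_imp; intros y.
        now rewrite mix_cons_in.
      + destruct (near_and (near_box _ _ _ _ Hz) (Hb a Ha)) as (L' & e' & He' & Hn).
        assert (Hd : 0 < eps / (2 * (K + 1))) by (apply Rdiv_lt_0_compat; lra).
        generalize (near_and (near_box0 L' e' z He')
          (near_and (IH HM' (eps / 2) ltac:(lra)) (near_coord z a _ Hd))).
        apply near_imp; intros y [Y1 [Y2 Y3]].
        assert (Emix : mix M z y = upd (mix M z y) a (z a)).
        { rewrite <- (mix_out M z y a Hi); now rewrite upd_self. }
        assert (Hb1 : box L' e' z (upd (mix M z y) a (z a))).
        { rewrite <- Emix; apply box_mix; auto; now apply box_center. }
        assert (Hb2 : box L' e' z (upd (mix M z y) a (y a))).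
        { rewrite <- mix_cons_out by auto; apply box_mix; auto; now apply box_center. }
        destruct (pd_mvt L e z0 F (D a) a (mix M z y) (z a) (y a))
          as (c & Hc & HE); auto; [now apply Hn|now apply Hn|].
        rewrite <- Emix, <- mix_cons_out in HE by auto.
        assert (Hbc := box_upd_between _ _ _ _ _ _ _ _ Hb1 Hb2 Hc).
        destruct (Hn _ Hbc) as [_ HDb].
        replace (F (mix (a :: M) z y) - F z)
          with ((F (mix (a :: M) z y) - F (mix M z y)) + (F (mix M z y) - F z)) by ring.
        eapply Rle_lt_trans; [apply Rabs_triang|].
        rewrite HE, Rabs_mult.
        assert (Rabs (D a (upd (mix M z y) a c)) * Rabs (y a - z a)
                <= (K + 1) * (eps / (2 * (K + 1)))).
        { apply Rmult_le_compat; try apply Rabs_pos; lra. }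
        assert ((K + 1) * (eps / (2 * (K + 1))) = eps / 2) by (field; lra).
        lra. }
  intros eps Heps.
  generalize (near_and (HM L (incl_refl L) eps Heps) (near_box _ _ _ _ Hz)).
  apply near_imp; intros y [Y1 Y2].
  replace (F y) with (F (mix L z y)); auto.
  apply Hdep; auto using box_mix.
  intros a Ha; now apply mix_in.
Qed.

(** The neighbourhood given by continuity may constrain coordinates outside [L]; since [F] ignores
    them, they can be reset to their values in [z]. *)
Lemma jet_continuous_dep L e z0 F z eta :
  dep_on (box L e z0) L F -> box L e z0 z -> jet_continuous_at F z -> 0 < eta ->
  exists d, 0 < d /\ forall y, box L e z0 y -> box L d z y -> Rabs (F y - F z) < eta.
Proof.
  intros Hdep Hz Hc Heta.
  destruct (Hc eta Heta) as (L' & d & Hd & HF).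
  exists d; split; auto; intros y Hy Hyz.
  replace (F y) with (F (mix L z y)).
  - apply HF; intros a _; unfold mix; destruct (in_dec coord_eq_dec a L); auto.
    now rewrite Rminus_diag, Rabs_R0.
  - apply Hdep; auto using box_mix. intros a Ha; now apply mix_in.
Qed.

(** By the chain rule, a derivative of [pds w F] composed with [g] is a sum of products of such
    compositions with derivatives of the components of [g]. Hence the algebra generated by these
    compositions and the smooth functions is closed under differentiation. *)
Lemma sm_on_comp (B : jet -> Prop) L e y0 F (g : jet -> jet) :
  open_jets B -> diff_on L e y0 F ->
  (forall z, B z -> box L e y0 (g z)) ->
  (forall a, In a L -> sm_on B (fun z => g z a)) ->
  sm_on B (fun z => F (g z)).
Proof.
  intros HB HF Hg Hsm.
  set (S := fun G => sm_on B G \/ exists w, G = fun z => pds w F (g z)).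
  assert (HS : forall w, alg S (fun z => pds w F (g z))).
  { intros w; apply alg_base; right; now exists w. }
  apply (sm_on_alg B S); auto.
  - intros G [HG|[w ->]] z Hz; [now apply (sm_on_continuous B)|].
    intros eta Heta.
    destruct (diff_on_pds L e y0 F w HF) as [Hd Hs].
    destruct (jet_continuous_dep L e y0 (pds w F) (g z) eta) as (d & Hd0 & HdF); auto.
    { apply (sm_on_continuous (box L e y0)); auto. }
    assert (Hn : near z (fun y => box L d (g z) (g y))).
    { clear - Hd0 Hsm Hz. induction L as [|a L IH].
      - apply near_all; intros y b [].
      - generalize (near_and
          (sm_on_continuous B _ z (Hsm a (or_introl eq_refl)) Hz d Hd0)
          (IH (fun b Hb => Hsm b (or_intror Hb)))).
        apply near_imp; intros y [Y1 Y2] b [<-|Hb]; auto. }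
    generalize (near_and (HB z Hz) Hn); apply near_imp.
    intros y [Y1 Y2]; apply HdF; auto.
  - intros G [HG|[w ->]] a.
    + exists (pd a G); split; [apply alg_base; left; now apply sm_on_pd|].
      intros z Hz; now apply (sm_on_is_pd B).
    + exists (fun z => lsum L (fun b => pds (b :: w) F (g z) * pd a (fun y => g y b) z)).
      split.
      * assert (H0 : alg S (fun _ => 0)) by (apply alg_base; left; now apply sm_on_const).
        clear - Hsm HS H0; induction L as [|b L IH]; simpl; auto.
        apply (alg_plus S (fun z => if in_dec coord_eq_dec b L then 0 else _)).
        -- destruct (in_dec coord_eq_dec b L); auto.
           apply alg_mult; [apply (HS (b :: w))|].
           apply alg_base; left; apply sm_on_pd, Hsm; now left.
        -- apply IH; intros c Hc; apply Hsm; now right.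
      * intros z Hz; unfold is_pd.
        assert (HH := diff_on_chain L e y0 (pds w F) (fun s => g (upd z a s)) (z a)
          (fun b => pd a (fun y => g y b) z)).
        simpl in HH; rewrite upd_self in HH; apply HH; auto using diff_on_pds.
        intros b Hb; apply (sm_on_is_pd B _ z a (Hsm b Hb) Hz).
  - exact (HS nil).
Qed.

Lemma diff_fun_comp z0 F (g : jet -> jet) :
  diff_fun (g z0) F -> (forall a, diff_fun z0 (fun z => g z a)) ->
  diff_fun z0 (fun z => F (g z)).
Proof.
  intros HF Hg; apply diff_fun_iff in HF; destruct HF as (L & e & He & HF).
  assert (Hn : near z0 (fun z => box L e (g z0) (g z))).
  { apply near_map; [intros a; apply diff_fun_continuous, Hg|now apply near_box0]. }
  destruct (diff_fun_common_near z0 (map (fun a z => g z a) L)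
              (fun z => box L e (g z0) (g z))) as (M & d & Hd & HM & HP); auto.
  { intros G HG; apply in_map_iff in HG; destruct HG as (a & <- & _); auto. }
  assert (HM' : forall a, In a L -> diff_on M d z0 (fun z => g z a)).
  { intros a Ha; apply HM, in_map_iff; now exists a. }
  apply diff_fun_iff; exists M, d; split; [auto|split].
  - intros z z' Hz Hz' Ha; apply (proj1 HF); auto.
    intros b Hb; apply (proj1 (HM' b Hb)); auto.
  - apply (sm_on_comp _ L e (g z0) F g); auto using box_open.
    intros a Ha; apply (HM' a Ha).
Qed.

(** Composing with [mix M z0] leaves [F] unchanged and freezes the coordinates outside [M] at [z0],
    so only constraints on coordinates in [M] remain in the box. *)
Lemma diff_fun_dep z0 M F :
  dep_on (fun _ => True) M F -> diff_fun z0 F -> exists e, 0 < e /\ diff_on M e z0 F.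
Proof.
  intros Hdep HF; apply diff_fun_iff in HF; destruct HF as (L & e & He & HF).
  exists e; split; [auto|split].
  - intros z z' _ _; now apply Hdep.
  - apply (sm_on_ext _ (fun z => F (mix M z0 z))); [apply box_open| |].
    + intros z _; apply Hdep; auto; intros a Ha; now apply mix_in.
    + apply (sm_on_comp _ L e z0 F (mix M z0)); auto using box_open.
      * intros z Hz a Ha; unfold mix; destruct (in_dec coord_eq_dec a M); auto.
        now rewrite Rminus_diag, Rabs_R0.
      * intros a Ha; unfold mix; destruct (in_dec coord_eq_dec a M).
        -- apply sm_on_coord, box_open.
        -- apply sm_on_const, box_open.
Qed.

Lemma diff_fun_dep_common z0 M (l : list (jet -> R)) :
  (forall F, In F l -> dep_on (fun _ => True) M F /\ diff_fun z0 F) ->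
  exists e, 0 < e /\ forall F, In F l -> diff_on M e z0 F.
Proof.
  induction l as [|F l IH]; intros H.
  - exists 1; split; [lra|intros F []].
  - destruct IH as (e & He & Hl); [intros G HG; apply H; now right|].
    destruct (H F (or_introl eq_refl)) as [H1 H2].
    destruct (diff_fun_dep z0 M F H1 H2) as (e' & He' & HF).
    exists (Rmin e e'); split; [now apply Rmin_pos|].
    intros G [<-|HG]; eapply diff_on_incl; try apply incl_refl;
      [apply Rmin_r|exact HF|apply Rmin_l|auto].
Qed.

(** The smooth functions together with [F] form a class closed under [pd]. Continuity of [F] itself
    follows from the local boundedness of its continuous partial derivatives. *)
Lemma diff_fun_of_pd L e z0 F (D : coord -> jet -> R) :
  0 < e -> dep_on (box L e z0) L F ->
  (forall a, In a L -> forall z, box L e z0 z -> is_pd a F z (D a z)) ->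
  (forall a, In a L -> sm_on (box L e z0) (D a)) ->
  diff_on L e z0 F.
Proof.
  intros He Hdep HD Hsm; split; auto.
  assert (Hop := box_open L e z0).
  apply (sm_on_coind _ (fun G => G = F \/ sm_on (box L e z0) G)); auto.
  - intros G [->|HG] z Hz; [|now apply (sm_on_continuous (box L e z0))].
    assert (HK : exists K, 0 <= K /\ forall a, In a L ->
              near z (fun y => Rabs (D a y) <= K)).
    { clear - Hsm Hz. revert Hsm Hz; generalize (box L e z0); intros B Hsm Hz.
      induction L as [|a L IH].
      - exists 0; split; [lra|intros a []].
      - destruct IH as (K & HK & H); [intros b Hb; apply Hsm; now right|].
        exists (Rmax K (Rabs (D a z) + 1)); split.
        { eapply Rle_trans; [exact HK|apply Rmax_l]. }
        intros b [<-|Hb].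
        + generalize (sm_on_continuous B _ z (Hsm a (or_introl eq_refl)) Hz 1 Rlt_0_1).
          apply near_imp; intros y Hy.
          eapply Rle_trans; [|apply Rmax_r].
          replace (D a y) with ((D a y - D a z) + D a z) by ring.
          eapply Rle_trans; [apply Rabs_triang|lra].
        + generalize (H b Hb); apply near_imp; intros y Hy.
          eapply Rle_trans; [exact Hy|apply Rmax_l]. }
    destruct HK as (K & HK & HKb).
    now apply (continuous_of_bounded_pd L e z0 F D K).
  - intros G [->|HG] a.
    + destruct (in_dec coord_eq_dec a L) as [Hi|Hi].
      * exists (D a); auto.
      * exists (fun _ => 0); split; [right; now apply sm_on_const|].
        intros z Hz; unfold is_pd.
        apply (is_derive_ext (fun _ => F z)); [|apply (is_derive_const (F z))].
        intros s; apply Hdep; auto.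
        -- intros b Hb; rewrite upd_other; [now apply Hz|congruence].
        -- intros b Hb; rewrite upd_other; [auto|congruence].
    + exists (pd a G); split; [right; now apply sm_on_pd|].
      intros z Hz; now apply (sm_on_is_pd (box L e z0)).
Qed.

(** Schwarz's theorem on the two-dimensional plane through [z] in the directions [a] and [b]. *)
Lemma pd_comm B F a b z :
  open_jets B -> sm_on B F -> B z -> pd a (pd b F) z = pd b (pd a F) z.
Proof.
  intros HB HF Hz.
  destruct (coord_eq_dec a b) as [<-|Hab]; auto.
  assert (Hz0 : upd (upd z a (z a)) b (z b) = z) by now rewrite !upd_self.
  set (f := fun u v => F (upd (upd z a u) b v)).
  assert (Eb : forall u v, pd b F (upd (upd z a u) b v) = Derive (fun t => f u t) v).
  { intros u v; unfold pd, f; rewrite upd_same; apply Derive_ext.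
    intros t; now rewrite upd_upd. }
  assert (Ea : forall u v, pd a F (upd (upd z a u) b v) = Derive (fun t => f t v) u).
  { intros u v; unfold pd, f.
    rewrite upd_other by congruence. rewrite upd_same.
    apply Derive_ext; intros t.
    rewrite (upd_comm (upd z a u) b a) by congruence; now rewrite upd_upd. }
  assert (Eab : forall u v, pd a (pd b F) (upd (upd z a u) b v)
                = Derive (fun y => Derive (fun t => f y t) v) u).
  { intros u v; unfold pd at 1.
    rewrite upd_other by congruence. rewrite upd_same.
    apply Derive_ext; intros t.
    rewrite (upd_comm (upd z a u) b a), upd_upd by congruence; apply Eb. }
  assert (Eba : forall u v, pd b (pd a F) (upd (upd z a u) b v)
                = Derive (fun y => Derive (fun t => f t y) u) v).
  { intros u v; unfold pd at 1; rewrite upd_same; apply Derive_ext.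
    intros t; rewrite upd_upd; apply Ea. }
  assert (Hloc : forall P, near z P ->
            locally_2d (fun u v => P (upd (upd z a u) b v)) (z a) (z b)).
  { intros P (L & e & He & HP); exists (mkposreal e He); simpl.
    intros u v Hu Hv; apply HP.
    intros c _; unfold upd; destruct (coord_eq_dec b c); subst; auto.
    destruct (coord_eq_dec a c); subst; auto.
    now rewrite Rminus_diag, Rabs_R0. }
  assert (Hc : forall G, jet_continuous_at G z ->
            continuity_2d_pt (fun u v => G (upd (upd z a u) b v)) (z a) (z b)).
  { intros G HG eps.
    apply (Hloc (fun y => Rabs (G y - G (upd (upd z a (z a)) b (z b))) < eps)).
    rewrite Hz0; apply (HG eps), cond_pos. }
  assert (Eab0 := Eab (z a) (z b)); assert (Eba0 := Eba (z a) (z b)).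
  rewrite Hz0 in Eab0, Eba0; rewrite Eab0, Eba0; apply Schwarz.
  - generalize (Hloc _ (HB z Hz)).
    intros [d H]; exists d; intros u v Hu Hv; specialize (H u v Hu Hv).
    assert (Hz' : forall G, sm_on B G ->
       ex_derive (fun t => G (upd (upd z a t) b v)) u /\
       ex_derive (fun t => G (upd (upd z a u) b t)) v).
    { intros G HG; split.
      - assert (Hd := sm_on_is_pd B G _ a HG H); unfold is_pd in Hd.
        rewrite (upd_other _ b), upd_same in Hd by congruence.
        eexists; eapply is_derive_ext; [|exact Hd]; intros t; simpl.
        rewrite (upd_comm (upd z a u) b a), upd_upd by congruence; reflexivity.
      - assert (Hd := sm_on_is_pd B G _ b HG H); unfold is_pd in Hd.
        rewrite upd_same in Hd.
        eexists; eapply is_derive_ext; [|exact Hd]; intros t; simpl; now rewrite upd_upd. }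
    destruct (Hz' F HF) as [E1 E2]; split; [exact E1|split; [exact E2|split]].
    + destruct (Hz' (pd b F) (sm_on_pd B F b HF)) as [E3 _].
      revert E3; apply ex_derive_ext; intros t; apply Eb.
    + destruct (Hz' (pd a F) (sm_on_pd B F a HF)) as [_ E3].
      revert E3; apply ex_derive_ext; intros t; apply Ea.
  - apply (continuity_2d_pt_ext (fun u v => pd a (pd b F) (upd (upd z a u) b v))).
    + intros; apply Eab.
    + apply Hc, (sm_on_continuous B); auto; now apply sm_on_pd, sm_on_pd.
  - apply (continuity_2d_pt_ext (fun u v => pd b (pd a F) (upd (upd z a u) b v))).
    + intros; apply Eba.
    + apply Hc, (sm_on_continuous B); auto; now apply sm_on_pd, sm_on_pd.
Qed.

(** * Total derivatives as finite sums *)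

Lemma is_series_zero (f : nat -> R) : (forall k, f k = 0) -> is_series f 0.
Proof.
  intros H; apply filterlim_ext with (fun _ => 0); [|apply filterlim_const].
  intros k; rewrite sum_n_Reals; symmetry; apply sum_eq_R0; auto.
Qed.

Lemma Series_zero (f : nat -> R) : (forall k, f k = 0) -> Series f = 0.
Proof. intros H; now apply is_series_unique, is_series_zero. Qed.

Lemma Series_finite (f : nat -> R) n :
  (forall k, (n < k)%nat -> f k = 0) -> Series f = sum_f_R0 f n.
Proof.
  intros H.
  assert (H0 : forall k, f (S n + k)%nat = 0) by (intros k; apply H; lia).
  rewrite (Series_incr_n f (S n)); [|lia|].
  - rewrite (Series_zero _ H0); simpl; ring.
  - apply (ex_series_incr_n f (S n)).
    exists 0; now apply is_series_zero.
Qed.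

Lemma sum_f_R0_single (f : nat -> R) n k0 :
  (k0 <= n)%nat -> (forall k, k <> k0 -> f k = 0) -> sum_f_R0 f n = f k0.
Proof.
  intros Hk H; induction n as [|n IH].
  - now replace k0 with O by lia.
  - simpl; destruct (Nat.eq_dec k0 (S n)) as [->|Hne].
    + rewrite sum_eq_R0; [ring|intros k Hk'; apply H; lia].
    + rewrite IH, (H (S n)); [ring|lia|lia].
Qed.

Ltac rewrite_sums :=
  match goal with
  | |- ?a + (?b + ?c + ?d) = ?a + (?b' + ?c' + ?d') =>
      replace b with b'; [replace c with c'; [replace d with d'; [reflexivity|]|]|]
  end.

Definition total (n : nat) (h : coord -> R) : R :=
  h ct + h cx + sum_dep (fun i =>
    sum_f_R0 (fun k => sum_f_R0 (fun l => h (cu i k l)) n) n).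

Definition bounded_coord (n : nat) (a : coord) : Prop :=
  match a with cu _ k l => (k <= n)%nat /\ (l <= n)%nat | _ => True end.

Lemma bounded_coords (L : list coord) : exists n, forall a, In a L -> bounded_coord n a.
Proof.
  induction L as [|a L (n & IH)]; [exists O; intros a []|].
  exists (match a with cu _ k l => n + k + l | _ => n end)%nat.
  intros b [<-|Hb].
  - destruct a; simpl; auto; lia.
  - specialize (IH b Hb); destruct a, b; simpl in *; auto; lia.
Qed.

Lemma total_plus n h h' : total n (fun a => h a + h' a) = total n h + total n h'.
Proof.
  unfold total, sum_dep.
  assert (E : forall i, sum_f_R0 (fun k => sum_f_R0 (fun l => h (cu i k l) + h' (cu i k l)) n) n
    = sum_f_R0 (fun k => sum_f_R0 (fun l => h (cu i k l)) n) n
      + sum_f_R0 (fun k => sum_f_R0 (fun l => h' (cu i k l)) n) n).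
  { intros i; rewrite <- plus_sum; apply sum_eq; intros k _; apply plus_sum. }
  rewrite !E; ring.
Qed.

Lemma total_single n h a :
  bounded_coord n a -> (forall b, b <> a -> h b = 0) -> total n h = h a.
Proof.
  intros Ha H; unfold total, sum_dep.
  assert (Z : forall i, (forall k l, cu i k l <> a) ->
     sum_f_R0 (fun k => sum_f_R0 (fun l => h (cu i k l)) n) n = 0).
  { intros i Hi; apply sum_eq_R0; intros k _; apply sum_eq_R0; intros l _; auto. }
  destruct a as [| |i k l].
  - rewrite !Z, (H cx) by congruence; ring.
  - rewrite !Z, (H ct) by congruence; ring.
  - destruct Ha as [Hk Hl].
    assert (S : sum_f_R0 (fun k => sum_f_R0 (fun l => h (cu i k l)) n) n = h (cu i k l)).
    { rewrite (sum_f_R0_single _ n k Hk).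
      - apply (sum_f_R0_single (fun l => h (cu i k l))); auto; intros m Hm; apply H; congruence.
      - intros m Hm; apply sum_eq_R0; intros p _; apply H; congruence. }
    rewrite (H ct), (H cx) by congruence.
    destruct i; rewrite S; rewrite ?Z by congruence; ring.
Qed.

Lemma total_lsum n L h :
  (forall a, In a L -> bounded_coord n a) -> (forall a, ~ In a L -> h a = 0) ->
  total n h = lsum L h.
Proof.
  revert h; induction L as [|a L IH]; intros h Hn H; simpl.
  - unfold total, sum_dep; rewrite !H by auto.
    rewrite !sum_eq_R0; [ring| | |];
      intros k _; apply sum_eq_R0; intros l _; apply H; auto.
  - assert (Hn' : forall b, In b L -> bounded_coord n b) by (intros; apply Hn; now right).
    destruct (in_dec coord_eq_dec a L) as [Hi|Hi].
    + rewrite Rplus_0_l; apply IH; auto.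
      intros b Hb; apply H; intros [<-|Hc]; auto.
    + set (h1 := fun b => if coord_eq_dec a b then 0 else h b).
      set (d := fun b => if coord_eq_dec a b then h a else 0).
      replace h with (fun b => h1 b + d b) at 1.
      * rewrite total_plus, (IH h1); auto.
        -- rewrite (total_single n d a).
           ++ rewrite (lsum_ext L h1 h).
              ** unfold d; destruct (coord_eq_dec a a); [ring|congruence].
              ** intros b Hb; unfold h1; destruct (coord_eq_dec a b); congruence.
           ++ apply Hn; now left.
           ++ intros b Hb; unfold d; destruct (coord_eq_dec a b); congruence.
        -- intros b Hb; unfold h1; destruct (coord_eq_dec a b); auto.
           apply H; intros [|]; auto.
      * apply functional_extensionality; intros b; unfold h1, d.
        destruct (coord_eq_dec a b); subst; ring.
Qed.

(** The orders in [L] are bounded by some [n], so all series break off there; both sides equal the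
    finite sum [total n h]. *)
Lemma Series_lsum L h :
  (forall a, ~ In a L -> h a = 0) ->
  h ct + h cx + sum_dep (fun i => Series (fun k => Series (fun l => h (cu i k l))))
  = lsum L h.
Proof.
  intros H; destruct (bounded_coords L) as (n & Hn).
  assert (Hz : forall i k l, (n < k \/ n < l)%nat -> h (cu i k l) = 0).
  { intros i k l Hkl; apply H; intros Hi; destruct (Hn _ Hi); lia. }
  rewrite <- (total_lsum n L h) by auto.
  unfold total, sum_dep.
  assert (E : forall i, Series (fun k => Series (fun l => h (cu i k l)))
     = sum_f_R0 (fun k => sum_f_R0 (fun l => h (cu i k l)) n) n).
  { intros i; rewrite (Series_finite _ n).
    - apply sum_eq; intros k _; apply Series_finite; intros l Hl; apply Hz; auto.
    - intros k Hk; apply Series_zero; intros l; apply Hz; auto. }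
  now rewrite !E.
Qed.

(** The coefficients of the total derivative regarded as a vector field on jets: [shift_t z a] is
    the coefficient of the partial derivative by [a] in [Dt], and [shift_x] plays the same part for
    [Dx]. *)
Definition shift_t (z : jet) : jet := fun a =>
  match a with ct => 1 | cx => 0 | cu i k l => z (cu i (S k) l) end.

Definition shift_x (z : jet) : jet := fun a =>
  match a with ct => 0 | cx => 1 | cu i k l => z (cu i k (S l)) end.

Lemma Dt_lsum L F z :
  (forall a, ~ In a L -> pd a F z = 0) ->
  Dt F z = lsum L (fun a => pd a F z * shift_t z a).
Proof.
  intros H; rewrite <- Series_lsum.
  - unfold Dt, sum_dep; simpl; rewrite Rmult_1_r, Rmult_0_r, Rplus_0_r.
    rewrite_sums; apply Series_ext; intros k; apply Series_ext; intros l; ring.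
  - intros a Ha; now rewrite H, Rmult_0_l.
Qed.

Lemma Dx_lsum L F z :
  (forall a, ~ In a L -> pd a F z = 0) ->
  Dx F z = lsum L (fun a => pd a F z * shift_x z a).
Proof.
  intros H; rewrite <- Series_lsum.
  - unfold Dx, sum_dep; simpl; rewrite Rmult_1_r, Rmult_0_r, Rplus_0_l.
    rewrite_sums; apply Series_ext; intros k; apply Series_ext; intros l; ring.
  - intros a Ha; now rewrite H, Rmult_0_l.
Qed.

Lemma Dt_diff_on L e z0 F z :
  diff_on L e z0 F -> box L e z0 z -> Dt F z = lsum L (fun a => pd a F z * shift_t z a).
Proof. intros H Hz; apply Dt_lsum; intros a; now apply (diff_on_pd_out L e z0). Qed.

Lemma Dx_diff_on L e z0 F z :
  diff_on L e z0 F -> box L e z0 z -> Dx F z = lsum L (fun a => pd a F z * shift_x z a).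
Proof. intros H Hz; apply Dx_lsum; intros a; now apply (diff_on_pd_out L e z0). Qed.

Lemma lsum_lin L a b h h' :
  lsum L (fun c => a * h c + b * h' c) = a * lsum L h + b * lsum L h'.
Proof.
  induction L as [|c L IH]; simpl; [ring|].
  rewrite IH; destruct (in_dec coord_eq_dec c L); ring.
Qed.

Lemma pd_lin B F G a b c z :
  sm_on B F -> sm_on B G -> B z ->
  pd c (fun y => a * F y + b * G y) z = a * pd c F z + b * pd c G z.
Proof.
  intros HF HG Hz; apply is_pd_unique.
  replace (a * pd c F z + b * pd c G z)
    with ((0 * F z + a * pd c F z) + (0 * G z + b * pd c G z)) by ring.
  apply is_pd_plus; apply is_pd_mult; try apply is_pd_const;
    now apply (sm_on_is_pd B).
Qed.

Lemma D_lin z0 F G a b :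
  diff_fun z0 F -> diff_fun z0 G ->
  near z0 (fun z => Dt (fun y => a * F y + b * G y) z = a * Dt F z + b * Dt G z /\
                    Dx (fun y => a * F y + b * G y) z = a * Dx F z + b * Dx G z).
Proof.
  intros HF HG.
  destruct (diff_fun_near2 z0 F G _ HF HG (near_all _ _ (fun _ => I)))
    as (L & e & He & HF' & HG' & _).
  exists L, e; split; auto; intros z Hz.
  assert (Hp : forall c, pd c (fun y => a * F y + b * G y) z = a * pd c F z + b * pd c G z).
  { intros c; eapply pd_lin; [apply (proj2 HF')|apply (proj2 HG')|exact Hz]. }
  assert (H0 : forall c, ~ In c L -> pd c (fun y => a * F y + b * G y) z = 0).
  { intros c Hc; rewrite Hp, (diff_on_pd_out L e z0 F), (diff_on_pd_out L e z0 G); auto; ring. }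
  rewrite (Dt_lsum L _ z H0), (Dx_lsum L _ z H0).
  rewrite (Dt_diff_on L e z0 F), (Dt_diff_on L e z0 G), (Dx_diff_on L e z0 F),
    (Dx_diff_on L e z0 G) by auto.
  rewrite <- !lsum_lin; split; apply lsum_ext; intros c _; rewrite Hp; ring.
Qed.

Lemma D_ext F G z :
  near z (fun y => F y = G y) -> Dt F z = Dt G z /\ Dx F z = Dx G z.
Proof.
  intros H; unfold Dt, Dx, sum_dep.
  split; rewrite (pd_ext _ F G z H); rewrite_sums;
    apply Series_ext; intros k; apply Series_ext; intros l;
    now rewrite (pd_ext _ F G z H).
Qed.

Lemma D_ext_near F G z0 :
  near z0 (fun y => F y = G y) ->
  near z0 (fun z => Dt F z = Dt G z /\ Dx F z = Dx G z).
Proof. intros H; generalize (near_open _ _ H); apply near_imp; intros z; apply D_ext. Qed.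

(** The part of [diff_fun] required for replacing [evolve z] by the jet of a solution that agrees
    with it up to finite order. Divergences need only this much. *)
Definition locally_dep (z0 : jet) (F : jet -> R) : Prop :=
  exists L e, 0 < e /\ dep_on (box L e z0) L F.

Lemma locally_dep_plus z0 F G :
  locally_dep z0 F -> locally_dep z0 G -> locally_dep z0 (fun z => F z + G z).
Proof.
  intros (L & e & He & HF) (L' & e' & He' & HG).
  exists (L ++ L'), (Rmin e e'); split; [now apply Rmin_pos|].
  intros z z' Hz Hz' H; f_equal; [apply HF|apply HG];
    try (intros a Ha; apply H; apply in_or_app; auto);
    (eapply box_incl; [| |eassumption]);
    first [apply incl_appl, incl_refl|apply incl_appr, incl_refl|idtac];
    first [apply Rmin_l|apply Rmin_r].
Qed.

Lemma locally_dep_lsum z0 F L e (f : dep -> nat -> nat -> coord) (v : jet -> jet) D :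
  0 < e -> diff_on L e z0 F ->
  (forall z z' i k l, z (f i k l) = z' (f i k l) -> v z (cu i k l) = v z' (cu i k l)) ->
  (forall z z', v z ct = v z' ct /\ v z cx = v z' cx) ->
  (forall z, box L e z0 z -> D z = lsum L (fun a => pd a F z * v z a)) ->
  locally_dep z0 D.
Proof.
  intros He HF Hv Hv' HD.
  exists (L ++ map (fun a => match a with cu i k l => f i k l | a => a end) L), e; split; auto.
  intros z z' Hz Hz' Ha; rewrite !HD.
  - apply lsum_ext; intros a Hi; f_equal.
    + apply (dep_on_pds L e z0 F (a :: nil) (proj1 HF)).
      * intros b Hb; apply Hz, in_or_app; auto.
      * intros b Hb; apply Hz', in_or_app; auto.
      * intros b Hb; apply Ha, in_or_app; auto.
    + destruct a; try apply Hv'; apply Hv, Ha, in_or_app; right.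
      apply in_map_iff; exists (cu i k l); auto.
  - intros b Hb; apply Hz', in_or_app; auto.
  - intros b Hb; apply Hz, in_or_app; auto.
Qed.

Lemma locally_dep_D z0 F :
  diff_fun z0 F -> locally_dep z0 (Dt F) /\ locally_dep z0 (Dx F).
Proof.
  intros H; apply diff_fun_iff in H; destruct H as (L & e & He & HF); split.
  - apply (locally_dep_lsum z0 F L e (fun i k l => cu i (S k) l) shift_t); auto.
    intros z; now apply Dt_diff_on.
  - apply (locally_dep_lsum z0 F L e (fun i k l => cu i k (S l)) shift_x); auto.
    intros z; now apply Dx_diff_on.
Qed.

(** Dependence is required on all jets, not just near a base point, so that formulas for total
    derivatives and for compositions with a prolongation hold without shrinking neighbourhoods. *)
Definition rdep (F : jet -> R) : Prop :=
  dep_on (fun _ => True) (rr I1 :: rr I2 :: rr I3 :: nil) F.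

Lemma dep_pd_out L F a z : dep_on (fun _ => True) L F -> ~ In a L -> pd a F z = 0.
Proof.
  intros H Ha; unfold pd.
  rewrite (Derive_ext _ (fun _ => F z)); [apply Derive_const|].
  intros s; apply H; auto.
  intros b Hb; rewrite upd_other; [auto|congruence].
Qed.

Lemma lsum_rr h : lsum (rr I1 :: rr I2 :: rr I3 :: nil) h = sum_dep (fun i => h (rr i)).
Proof.
  unfold lsum, sum_dep.
  repeat match goal with |- context [in_dec ?d ?a ?l] =>
    destruct (in_dec d a l) as [Hi|_]; [simpl in Hi; intuition congruence|] end.
  ring.
Qed.

Lemma D_rdep F z : rdep F ->
  Dt F z = sum_dep (fun i => pd (rr i) F z * z (cu i 1 0)%nat) /\
  Dx F z = sum_dep (fun i => pd (rr i) F z * z (cu i 0 1)%nat).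
Proof.
  intros H; rewrite (Dt_lsum (rr I1 :: rr I2 :: rr I3 :: nil)),
    (Dx_lsum (rr I1 :: rr I2 :: rr I3 :: nil)), !lsum_rr.
  - split; reflexivity.
  - intros a; now apply dep_pd_out.
  - intros a; now apply dep_pd_out.
Qed.

(** * Taylor coefficients of solutions *)

(** Says that [A n] is the [n]-th derivative of [A 0] divided by [n!]. With this normalization
    products become plain Cauchy products. *)
Definition taylor_fam (U : R -> Prop) (A : nat -> R -> R) : Prop :=
  forall n x, U x -> is_derive (A n) x (INR (S n) * A (S n) x).

Lemma is_derive_sum (f : nat -> R -> R) (d : nat -> R) n x :
  (forall k, (k <= n)%nat -> is_derive (f k) x (d k)) ->
  is_derive (fun y => sum_f_R0 (fun k => f k y) n) x (sum_f_R0 d n).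
Proof.
  induction n as [|n IH]; intros H; simpl; [now apply H|].
  apply is_derive_Rplus; auto.
Qed.

(** The Leibniz rule; the factor [n + 1] on the right is split as [k + (n + 1 - k)], one part for
    each factor. *)
Lemma taylor_fam_mult U A B :
  taylor_fam U A -> taylor_fam U B ->
  taylor_fam U (fun n x => PS_mult (fun k => A k x) (fun k => B k x) n).
Proof.
  intros HA HB n x Hx; unfold PS_mult.
  replace (INR (S n) * sum_f_R0 (fun k => A k x * B (S n - k)%nat x) (S n))
    with (sum_f_R0 (fun k => INR (S k) * A (S k) x * B (n - k)%nat x
                      + A k x * (INR (S (n - k)) * B (S (n - k)) x)) n).
  - apply (is_derive_sum (fun k x => A k x * B (n - k)%nat x)); intros k _.
    now apply is_derive_Rmult; [apply HA|apply HB].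
  - rewrite plus_sum.
    replace (INR (S n) * sum_f_R0 (fun k => A k x * B (S n - k)%nat x) (S n))
      with (sum_f_R0 (fun k => INR k * (A k x * B (S n - k)%nat x)) (S n)
            + sum_f_R0 (fun k => INR (S n - k) * (A k x * B (S n - k)%nat x)) (S n)).
    + f_equal.
      * rewrite (decomp_sum _ (S n)) by lia; cbn [Nat.pred].
        change (INR 0) with 0; rewrite Rmult_0_l, Rplus_0_l.
        apply sum_eq; intros k _; simpl Nat.sub; ring.
      * rewrite tech5, Nat.sub_diag; change (INR 0) with 0; rewrite Rmult_0_l, Rplus_0_r.
        apply sum_eq; intros k Hk; rewrite Nat.sub_succ_l by auto; ring.
    + rewrite <- plus_sum, scal_sum; apply sum_eq; intros k Hk.
      rewrite minus_INR by auto; ring.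
Qed.

Lemma taylor_fam_sum U (A : nat -> nat -> R -> R) m :
  (forall j, (j <= m)%nat -> taylor_fam U (A j)) ->
  taylor_fam U (fun n x => sum_f_R0 (fun j => A j n x) m).
Proof.
  intros H n x Hx; rewrite scal_sum.
  apply (is_derive_sum (fun j => A j n) (fun j => A j (S n) x * INR (S n))).
  intros k Hk; rewrite Rmult_comm; now apply H.
Qed.

Lemma taylor_fam_scal U A c :
  taylor_fam U A -> taylor_fam U (fun n x => c * A n x).
Proof.
  intros H n x Hx.
  replace (INR (S n) * (c * A (S n) x)) with (c * (INR (S n) * A (S n) x)) by ring.
  apply (is_derive_scal (A n) x c), H, Hx.
Qed.

Lemma taylor_fam_shift U A :
  taylor_fam U A -> taylor_fam U (fun n x => INR (S n) * A (S n) x).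
Proof.
  intros H n x Hx; apply (is_derive_scal (A (S n)) x (INR (S n))), H, Hx.
Qed.

Lemma taylor_fam_plus_offset U A B (c : nat -> R) :
  (forall n, c (S n) = 0) -> taylor_fam U A -> taylor_fam U B ->
  taylor_fam U (fun n x => A n x + B n x + c n).
Proof.
  intros Hc HA HB n x Hx.
  replace (INR (S n) * (A (S n) x + B (S n) x + c (S n)))
    with (INR (S n) * A (S n) x + INR (S n) * B (S n) x + 0) by (rewrite Hc; ring).
  apply is_derive_Rplus; [apply is_derive_Rplus; auto|apply (is_derive_const (c n))].
Qed.

(** Each member is the derivative of the previous one divided by a nonzero number. The lemma serves
    to differentiate an identity to all orders at once. *)
Lemma taylor_fam_unique (U : R -> Prop) A B :
  (forall x, U x -> locally x U) -> taylor_fam U A -> taylor_fam U B ->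
  (forall x, U x -> A O x = B O x) -> forall n x, U x -> A n x = B n x.
Proof.
  intros HU HA HB H0 n; induction n as [|n IH]; intros x Hx; auto.
  assert (HD : Derive (A n) x = Derive (B n) x).
  { apply Derive_ext_loc; generalize (HU x Hx); now apply filter_imp. }
  rewrite (is_derive_unique _ _ _ (HA n x Hx)), (is_derive_unique _ _ _ (HB n x Hx)) in HD.
  apply Rmult_eq_reg_l in HD; auto; now apply not_0_INR.
Qed.

Lemma sum_f_R0_swap (f : nat -> nat -> R) m n :
  sum_f_R0 (fun j => sum_f_R0 (f j) m) n = sum_f_R0 (fun i => sum_f_R0 (fun j => f j i) n) m.
Proof.
  induction n as [|n IH]; simpl; auto.
  rewrite IH, <- plus_sum; apply sum_eq; auto.
Qed.

(** A coefficient of a product in two variables may be computed with the convolution in either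
    variable outermost. The recursion has it one way round, differentiation in [t] calls for the
    other. *)
Lemma sum_f_R0_mult_swap (a b : nat -> nat -> R) k l :
  sum_f_R0 (fun j => PS_mult (a j) (b (k - j)%nat) l) k
  = sum_f_R0 (fun n => PS_mult (fun j => a j n) (fun j => b j (l - n)%nat) k) l.
Proof. unfold PS_mult; apply sum_f_R0_swap. Qed.

Definition offset (i : dep) : R :=
  match i with I1 => 1 | I2 => -1 | I3 => 0 end.

(* Families [T j i n] are Taylor coefficients: of [t^j x^n] in the [i]-th unknown. *)
Definition speed_coef (T : nat -> dep -> nat -> R) (i : dep) (j n : nat) : R :=
  T j I1 n + T j I2 n + match j, n with O, O => offset i | _, _ => 0 end.

(** The coefficient of [t^k x^l] in [r_t = - V r_x], solved for the entry in row [k + 1]. *)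
Definition next_coef (T : nat -> dep -> nat -> R) (i : dep) (k l : nat) : R :=
  - / INR (S k) * sum_f_R0 (fun j =>
      PS_mult (speed_coef T i j) (fun n => INR (S n) * T (k - j)%nat i (S n)) l) k.

(** Row [k + 1] needs all earlier rows, so the recursion carries the whole table; [coef_table u k]
    is meaningful in the rows [j <= k] only. *)
Fixpoint coef_table (u : dep -> nat -> R) (k : nat) : nat -> dep -> nat -> R :=
  match k with
  | O => fun _ => u
  | S k' => fun j => if Nat.leb j k' then coef_table u k' j
                     else fun i l => next_coef (coef_table u k') i k' l
  end.

(* The coefficient of [t^k x^l] in the formal solution with [t = 0] data
   [sum_l u i l x^l]. *)
Definition cauchy_coef (u : dep -> nat -> R) (i : dep) (k l : nat) : R :=
  coef_table u k k i l.

Definition cauchy_table u j i n := cauchy_coef u i j n.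

Lemma coef_table_cauchy_coef u k j i l :
  (j <= k)%nat -> coef_table u k j i l = cauchy_coef u i j l.
Proof.
  revert j; induction k as [|k IH]; intros j Hj.
  - now replace j with O by lia.
  - destruct (Nat.eq_dec j (S k)) as [->|Hne]; auto.
    simpl; destruct (Nat.leb_spec j k); [auto|lia].
Qed.

Lemma speed_coef_ext T T' i j n :
  (forall i, T j i n = T' j i n) -> speed_coef T i j n = speed_coef T' i j n.
Proof. intros H; unfold speed_coef; now rewrite !H. Qed.

Lemma PS_mult_ext a b a' b' n :
  (forall k, (k <= n)%nat -> a k = a' k) -> (forall k, (k <= n)%nat -> b k = b' k) ->
  PS_mult a b n = PS_mult a' b' n.
Proof.
  intros Ha Hb; apply sum_eq; intros k Hk; rewrite Ha, Hb; auto; lia.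
Qed.

Lemma next_coef_ext T T' i k l :
  (forall j i n, (j <= k)%nat -> (j + n <= S (k + l))%nat -> T j i n = T' j i n) ->
  next_coef T i k l = next_coef T' i k l.
Proof.
  intros H; unfold next_coef; f_equal; apply sum_eq; intros j Hj.
  apply PS_mult_ext; intros n Hn.
  - apply speed_coef_ext; intros i'; apply H; lia.
  - rewrite H; auto; lia.
Qed.

Lemma cauchy_coef_O u i l : cauchy_coef u i 0 l = u i l.
Proof. reflexivity. Qed.

Lemma cauchy_coef_S u i k l :
  cauchy_coef u i (S k) l = next_coef (cauchy_table u) i k l.
Proof.
  unfold cauchy_coef at 1; cbn [coef_table]; destruct (Nat.leb_spec (S k) k); [lia|].
  apply next_coef_ext; intros j i' n Hj _; now apply coef_table_cauchy_coef.
Qed.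

(** Each step in [t] consumes one x-derivative, so the entry [(k, l)] reads the data up to order
    [k + l]. *)
Lemma cauchy_coef_ext u u' i k l :
  (forall i n, (n <= k + l)%nat -> u i n = u' i n) -> cauchy_coef u i k l = cauchy_coef u' i k l.
Proof.
  revert i l; induction k as [k IH] using lt_wf_ind; intros i l H.
  destruct k as [|k]; [apply H; lia|].
  rewrite !cauchy_coef_S; apply next_coef_ext; intros j i' n Hj Hn.
  apply IH; [lia|]; intros i'' m Hm; apply H; lia.
Qed.

Definition x_coefs (z : jet) : dep -> nat -> R := fun i l => z (cu i 0 l) / INR (fact l).

(* The jet with the same [t], [x] and pure x-derivatives as [z] whose other
   coordinates are given by the system and its differential consequences. *)
Definition evolve (z : jet) : jet := fun a =>
  match a with
  | cu i k l => INR (fact k) * INR (fact l) * cauchy_coef (x_coefs z) i k l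
  | a => z a
  end.

Lemma evolve_x z i l : evolve z (cu i 0 l) = z (cu i 0 l).
Proof.
  simpl; rewrite cauchy_coef_O; unfold x_coefs; field; apply INR_fact_neq_0.
Qed.

Lemma evolve_ext z z' N a :
  (forall i l, (l <= N)%nat -> z (cu i 0 l) = z' (cu i 0 l)) ->
  z ct = z' ct -> z cx = z' cx ->
  match a with cu _ k l => (k + l <= N)%nat | _ => True end ->
  evolve z a = evolve z' a.
Proof.
  intros H Ht Hx Ha; destruct a as [| |i k l]; auto; simpl.
  f_equal; apply cauchy_coef_ext; intros i' n Hn; unfold x_coefs; rewrite H; auto; lia.
Qed.

Lemma evolve_ext_all z z' :
  (forall i l, z (cu i 0 l) = z' (cu i 0 l)) -> z ct = z' ct -> z cx = z' cx ->
  evolve z = evolve z'.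
Proof.
  intros H Ht Hx; apply functional_extensionality; intros a.
  apply (evolve_ext _ _ (match a with cu _ k l => k + l | _ => O end)%nat); auto.
  destruct a; auto.
Qed.

Lemma diff_fun_sum z0 (f : nat -> jet -> R) n :
  (forall k, (k <= n)%nat -> diff_fun z0 (f k)) ->
  diff_fun z0 (fun z => sum_f_R0 (fun k => f k z) n).
Proof.
  induction n as [|n IH]; intros H; simpl; [now apply H|].
  apply (diff_fun_plus z0 (fun z => sum_f_R0 (fun k => f k z) n) (f (S n))); auto.
Qed.

Lemma diff_fun_scal z0 c F : diff_fun z0 F -> diff_fun z0 (fun z => c * F z).
Proof. intros H; apply diff_fun_mult; auto; apply diff_fun_const. Qed.

(** By the recursion, every coordinate of [evolve z] is a polynomial in finitely many coordinates of
    [z]. *)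
Lemma diff_fun_evolve z0 a : diff_fun z0 (fun z => evolve z a).
Proof.
  destruct a as [| |i k l]; try apply diff_fun_coord.
  apply (diff_fun_scal z0 (INR (fact k) * INR (fact l))
           (fun z => cauchy_coef (x_coefs z) i k l)).
  revert i l; induction k as [k IH] using lt_wf_ind; intros i l.
  destruct k as [|k].
  - apply (diff_fun_mult z0 (fun z => z (cu i 0 l)) (fun _ => / INR (fact l))).
    + apply diff_fun_coord.
    + apply diff_fun_const.
  - eapply diff_fun_ext; [apply near_all; intros z; symmetry; apply cauchy_coef_S|].
    unfold next_coef, PS_mult.
    apply (diff_fun_scal z0 (- / INR (S k))).
    apply (diff_fun_sum z0 (fun j z => sum_f_R0 (fun n =>
      speed_coef (cauchy_table (x_coefs z)) i j n
      * (INR (S (l - n)) * cauchy_coef (x_coefs z) i (k - j) (S (l - n)))) l)).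
    intros j Hj.
    apply (diff_fun_sum z0 (fun n z =>
      speed_coef (cauchy_table (x_coefs z)) i j n
      * (INR (S (l - n)) * cauchy_coef (x_coefs z) i (k - j) (S (l - n))))).
    intros n Hn; apply diff_fun_mult.
    + unfold speed_coef.
      apply diff_fun_plus; [apply diff_fun_plus; apply IH; lia|apply diff_fun_const].
    + apply diff_fun_scal, IH; lia.
Qed.

Lemma evolve_continuous z0 a : jet_continuous_at (fun z => evolve z a) z0.
Proof. apply diff_fun_continuous, diff_fun_evolve. Qed.

Lemma pds_t_comm B a k H z :
  open_jets B -> sm_on B H -> B z ->
  pd a (pds (repeat ct k) H) z = pds (repeat ct k) (pd a H) z.
Proof.
  intros HB HH; revert z; induction k as [|k IH]; intros z Hz; auto.
  simpl; rewrite (pd_comm B) by (auto; now apply sm_on_pds).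
  apply pd_ext; generalize (HB z Hz); now apply near_imp.
Qed.

Lemma jet_of_pds (r : dep -> R -> R -> R) i k l z :
  pds (repeat ct k) (pds (repeat cx l) (fun z => r i (z ct) (z cx))) z
  = jet_of r (z ct) (z cx) (cu i k l).
Proof.
  assert (Hx : forall l z, pds (repeat cx l) (fun z => r i (z ct) (z cx)) z
    = Derive_n (fun x' => r i (z ct) x') l (z cx)).
  { intros m; induction m as [|m IH]; intros y; auto.
    simpl; unfold pd; apply Derive_ext; intros s; apply IH. }
  simpl; revert z; induction k as [|k IH]; intros z; [apply Hx|].
  simpl; unfold pd; apply Derive_ext; intros s; apply IH.
Qed.

Definition tx : list coord := ct :: cx :: nil.

Lemma solution_rect r t0 x0 : solution r t0 x0 -> exists e, 0 < e /\
  (forall i, diff_on tx e (jet_of r t0 x0) (fun z => r i (z ct) (z cx))) /\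
  (forall t x, Rabs (t - t0) < e -> Rabs (x - x0) < e ->
     forall i, equation i (jet_of r t x)).
Proof.
  intros [H1 (d & H2)].
  destruct (diff_fun_dep_common (jet_of r t0 x0) tx
    (map (fun i z => r i (z ct) (z cx)) (I1 :: I2 :: I3 :: nil))) as (e & He & HL).
  { intros F HF; apply in_map_iff in HF; destruct HF as (i & <- & _); split; auto.
    intros z z' _ _ H; rewrite !H; unfold tx; simpl; auto. }
  assert (Hd := cond_pos d).
  exists (Rmin e d); split; [now apply Rmin_pos|split].
  - intros i; apply (diff_on_incl tx tx e); [apply incl_refl|apply Rmin_l|].
    apply HL, in_map_iff; exists i; split; auto; destruct i; simpl; auto.
  - intros t x Ht Hx; assert (Q := Rmin_r e d); apply H2; lra.
Qed.

Lemma box_tx e y z :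
  box tx e y z <-> Rabs (z ct - y ct) < e /\ Rabs (z cx - y cx) < e.
Proof.
  split; [intros H; split; apply H; unfold tx; simpl; auto|].
  intros [H1 H2] a [<-|[<-|[]]]; auto.
Qed.

(** In [jet_of] the t-derivatives are outermost, so the first claim is immediate, while the second
    moves the new x-derivative past them by symmetry of mixed derivatives. *)
Lemma solution_derive r t0 x0 e :
  (forall i, diff_on tx e (jet_of r t0 x0) (fun z => r i (z ct) (z cx))) ->
  forall t x, Rabs (t - t0) < e -> Rabs (x - x0) < e -> forall i k l,
  is_derive (fun t' => jet_of r t' x (cu i k l)) t (jet_of r t x (cu i (S k) l)) /\
  is_derive (fun x' => jet_of r t x' (cu i k l)) x (jet_of r t x (cu i k (S l))).
Proof.
  intros H t x Ht Hx i k l.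
  set (B := box tx e (jet_of r t0 x0)).
  set (z := jet_of r t x).
  assert (Hz : B z) by (apply box_tx; split; assumption).
  assert (HB : open_jets B) by apply box_open.
  assert (Hs := proj2 (H i)); fold B in Hs.
  assert (Hs' : sm_on B (pds (repeat cx l) (fun z => r i (z ct) (z cx))))
    by now apply sm_on_pds.
  assert (Hs'' := sm_on_pds B _ (repeat ct k) Hs').
  split.
  - assert (Hd := sm_on_is_pd B _ z ct Hs'' Hz).
    change (pd ct (pds (repeat ct k) (pds (repeat cx l) (fun z => r i (z ct) (z cx)))) z)
      with (pds (repeat ct (S k)) (pds (repeat cx l) (fun z => r i (z ct) (z cx))) z) in Hd.
    rewrite jet_of_pds in Hd; unfold is_pd in Hd.
    eapply is_derive_ext; [|exact Hd].
    intros s; simpl; now rewrite jet_of_pds.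
  - assert (Hd := sm_on_is_pd B _ z cx Hs'' Hz).
    rewrite (pds_t_comm B) in Hd by auto.
    change (pd cx (pds (repeat cx l) (fun z => r i (z ct) (z cx))))
      with (pds (repeat cx (S l)) (fun z => r i (z ct) (z cx))) in Hd.
    rewrite jet_of_pds in Hd; unfold is_pd in Hd.
    eapply is_derive_ext; [|exact Hd].
    intros s; simpl; now rewrite jet_of_pds.
Qed.

Lemma interval_open x0 e x :
  Rabs (x - x0) < e -> locally x (fun y => Rabs (y - x0) < e).
Proof.
  intros H; exists (mkposreal (e - Rabs (x - x0)) ltac:(lra)); simpl.
  intros y Hy; unfold ball in Hy; simpl in Hy; unfold AbsRing_ball in Hy.
  unfold abs, minus, plus, opp in Hy; simpl in Hy.
  assert (Ht := Rabs_triang (y + - x) (x - x0)).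
  replace (y + - x + (x - x0)) with (y - x0) in Ht by ring; lra.
Qed.

(** The Taylor coefficients [T] of a solution obey the recursion that defines [cauchy_coef]. They
    are considered at all points near [(t0, x0)], so that the equation can be differentiated by
    comparing Taylor families. *)
Lemma solution_evolve r t0 x0 :
  solution r t0 x0 -> evolve (jet_of r t0 x0) = jet_of r t0 x0.
Proof.
  intros Hr; destruct (solution_rect r t0 x0 Hr) as (e & He & Hd & Heq).
  assert (HD := solution_derive r t0 x0 e Hd).
  set (T := fun t x j i n => jet_of r t x (cu i j n) / (INR (fact j) * INR (fact n))).
  set (U := fun t => Rabs (t - t0) < e); set (V := fun x => Rabs (x - x0) < e).
  assert (Hf := INR_fact_neq_0).
  assert (HfS : forall n, INR (fact (S n)) = INR (S n) * INR (fact n)).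
  { intros n; rewrite <- mult_INR; reflexivity. }
  assert (HS : forall n, INR (S n) <> 0) by (intros n; now apply not_0_INR).
  assert (HTt : forall i n x, V x -> taylor_fam U (fun j t => T t x j i n)).
  { intros i n x Hx j t Ht; unfold T.
    replace (INR (S j) * (jet_of r t x (cu i (S j) n) / (INR (fact (S j)) * INR (fact n))))
      with (/ (INR (fact j) * INR (fact n)) * jet_of r t x (cu i (S j) n))
      by (rewrite HfS; field; auto).
    apply (is_derive_ext (fun t => / (INR (fact j) * INR (fact n)) * jet_of r t x (cu i j n))).
    { intros s; unfold Rdiv; apply Rmult_comm. }
    apply (is_derive_scal (fun t => jet_of r t x (cu i j n))), HD; auto. }
  assert (HTx : forall i j t, U t -> taylor_fam V (fun n x => T t x j i n)).
  { intros i j t Ht n x Hx; unfold T.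
    replace (INR (S n) * (jet_of r t x (cu i j (S n)) / (INR (fact j) * INR (fact (S n)))))
      with (/ (INR (fact j) * INR (fact n)) * jet_of r t x (cu i j (S n)))
      by (rewrite HfS; field; auto).
    apply (is_derive_ext (fun x => / (INR (fact j) * INR (fact n)) * jet_of r t x (cu i j n))).
    { intros s; unfold Rdiv; apply Rmult_comm. }
    apply (is_derive_scal (fun x => jet_of r t x (cu i j n))), HD; auto. }
  set (v := fun t x i j n => speed_coef (T t x) i j n).
  set (w := fun t x i j n => INR (S n) * T t x j i (S n)).
  assert (Hvt : forall i n x, V x -> taylor_fam U (fun j t => v t x i j n)).
  { intros i n x Hx; unfold v, speed_coef; apply taylor_fam_plus_offset; auto. }
  assert (Hvx : forall i j t, U t -> taylor_fam V (fun n x => v t x i j n)).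
  { intros i j t Ht; unfold v, speed_coef.
    apply (taylor_fam_plus_offset V _ _
             (fun n => match j, n with O, O => offset i | _, _ => 0 end)); auto.
    intros n; now destruct j. }
  assert (Hwt : forall i n x, V x -> taylor_fam U (fun j t => w t x i j n)).
  { intros i n x Hx; now apply taylor_fam_scal, HTt. }
  assert (Hwx : forall i j t, U t -> taylor_fam V (fun n x => w t x i j n)).
  { intros i j t Ht; now apply (taylor_fam_shift V (fun n x => T t x j i n)), HTx. }
  assert (HU : forall x, U x -> locally x U) by (intros x; apply interval_open).
  assert (HV : forall x, V x -> locally x V) by (intros x; apply interval_open).
  (* For [l = 0] this is the equation itself. Both sides are Taylor families in [x], so agreement at
     order 0 on an open set gives agreement at all orders. *)
  assert (Hx0 : forall i l t x, U t -> V x ->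
            T t x 1%nat i l = -1 * PS_mult (v t x i 0%nat) (w t x i 0%nat) l).
  { intros i l t x Ht Hx; revert l x Hx.
    intros l; apply (taylor_fam_unique V (fun l x => T t x 1%nat i l)
      (fun l x => -1 * PS_mult (v t x i 0%nat) (w t x i 0%nat) l)); auto.
    - apply taylor_fam_scal.
      apply (taylor_fam_mult V (fun n x => v t x i 0%nat n) (fun n x => w t x i 0%nat n));
        auto.
    - intros x Hx; assert (E := Heq t x Ht Hx i); unfold equation in E.
      unfold PS_mult, v, w, speed_coef, T; cbn [sum_f_R0 Nat.sub].
      change (INR (fact 0)) with 1; change (INR (fact 1)) with 1; change (INR 1) with 1.
      replace (speed i (jet_of r t x)) with
        (jet_of r t x (rr I1) + jet_of r t x (rr I2) + offset i) in E
        by (destruct i; unfold speed, offset; ring).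
      lra. }
  (* The same argument in [t], starting from [Hx0] at [k = 0]; the convolution in [t] is first moved
     inside. *)
  assert (Ht0 : forall i k l t x, U t -> V x ->
     INR (S k) * T t x (S k) i l
     = -1 * sum_f_R0 (fun j => PS_mult (v t x i j) (w t x i (k - j)%nat) l) k).
  { intros i k l t x Ht Hx; rewrite sum_f_R0_mult_swap; revert k t Ht; intros k.
    apply (taylor_fam_unique U (fun k t => INR (S k) * T t x (S k) i l)
      (fun k t => -1 * sum_f_R0 (fun n => PS_mult (fun j => v t x i j n)
                       (fun j => w t x i j (l - n)%nat) k) l)); auto.
    - apply (taylor_fam_shift U (fun k t => T t x k i l)); auto.
    - apply taylor_fam_scal.
      apply (taylor_fam_sum U (fun n k t => PS_mult (fun j => v t x i j n)
                       (fun j => w t x i j (l - n)%nat) k)).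
      intros n _; apply (taylor_fam_mult U (fun j t => v t x i j n)
                       (fun j t => w t x i j (l - n)%nat)); auto.
    - intros t Ht; rewrite Hx0 by auto; unfold PS_mult; simpl; ring. }
  assert (Hc : forall k i l, T t0 x0 k i l = cauchy_coef (x_coefs (jet_of r t0 x0)) i k l).
  { intros k; induction k as [k IH] using lt_wf_ind; intros i l; destruct k as [|k].
    - unfold T; rewrite cauchy_coef_O; unfold x_coefs; simpl (fact 0); simpl (INR 1).
      now rewrite Rmult_1_l.
    - rewrite cauchy_coef_S.
      rewrite (next_coef_ext _ (T t0 x0)) by (intros; symmetry; apply IH; lia).
      apply Rmult_eq_reg_l with (INR (S k)); auto.
      rewrite Ht0; [|unfold U; now rewrite Rminus_diag, Rabs_R0
                    |unfold V; now rewrite Rminus_diag, Rabs_R0].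
      unfold next_coef; fold (v t0 x0 i).
      change (fun j => PS_mult (speed_coef (T t0 x0) i j)
                 (fun n => INR (S n) * T t0 x0 (k - j)%nat i (S n)) l)
        with (fun j => PS_mult (v t0 x0 i j) (w t0 x0 i (k - j)%nat) l).
      field; auto. }
  apply functional_extensionality; intros [| |i k l]; auto.
  unfold evolve; rewrite <- Hc; unfold T; field; auto.
Qed.

(** * A majorant for the Cauchy problem *)

(** The binomial coefficient [p + q] over [p]; as a sequence in [q] it lists the Taylor coefficients
    of [(1 - x)^-(p + 1)] at 0. *)
Definition bin (p q : nat) : R := INR (fact (p + q)) / (INR (fact p) * INR (fact q)).

Lemma INR_fact_S n : INR (fact (S n)) = INR (S n) * INR (fact n).
Proof. rewrite <- mult_INR; reflexivity. Qed.

Lemma bin_S_r p q : INR (S q) * bin p (S q) = INR (S p) * bin (S p) q.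
Proof.
  unfold bin; rewrite Nat.add_succ_r, Nat.add_succ_l, (INR_fact_S p), (INR_fact_S q).
  field; repeat split; try apply INR_fact_neq_0; now apply not_0_INR.
Qed.

Lemma bin_S_r' p q : INR (S q) * bin p (S q) = INR (S (p + q)) * bin p q.
Proof.
  unfold bin; rewrite Nat.add_succ_r, (INR_fact_S (p + q)), (INR_fact_S q).
  field; repeat split; try apply INR_fact_neq_0; now apply not_0_INR.
Qed.

Lemma bin_0_l q : bin 0 q = 1.
Proof. unfold bin; simpl; field; apply INR_fact_neq_0. Qed.

Lemma bin_0_r p : bin p 0 = 1.
Proof. unfold bin; rewrite Nat.add_0_r; simpl; field; apply INR_fact_neq_0. Qed.

Lemma bin_pos p q : 0 < bin p q.
Proof.
  assert (H := INR_fact_lt_0); apply Rdiv_lt_0_compat; auto.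
  now apply Rmult_lt_0_compat.
Qed.

Lemma bin_pascal p q : bin (S p) (S q) = bin p (S q) + bin (S p) q.
Proof.
  unfold bin; rewrite !Nat.add_succ_r, !Nat.add_succ_l, !INR_fact_S.
  assert (E : INR (S (S (p + q))) = INR (S p) + INR (S q)).
  { rewrite <- plus_INR; f_equal; lia. }
  rewrite E; field; repeat split; try apply INR_fact_neq_0; now apply not_0_INR.
Qed.

Lemma bin_le p q : bin p q <= 2 ^ (p + q).
Proof.
  revert q; induction p as [|p IHp]; intros q.
  - rewrite bin_0_l; apply pow_R1_Rle; lra.
  - induction q as [|q IHq].
    + rewrite bin_0_r; apply pow_R1_Rle; lra.
    + rewrite bin_pascal; assert (H := IHp (S q)).
      rewrite Nat.add_succ_r in *; simpl plus in *; simpl pow in *; lra.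
Qed.

(* Both sides are Taylor coefficients of [(1 - x)^-(p + q + 2)]. *)
Lemma bin_convolution p q l :
  PS_mult (bin p) (bin q) l = bin (S (p + q)) l.
Proof.
  set (U := fun x => x < 1).
  set (A := fun p n x => bin p n * (/ (1 - x)) ^ (S (p + n))).
  assert (HA : forall p, taylor_fam U (A p)).
  { intros m n x Hx; unfold A; rewrite <- Rmult_assoc, bin_S_r', Nat.add_succ_r.
    replace (INR (S (m + n)) * bin m n * (/ (1 - x)) ^ S (S (m + n)))
      with (bin m n * (INR (S (m + n)) * (/ (1 - x)) ^ S (S (m + n)))) by ring.
    apply (is_derive_scal (fun x => (/ (1 - x)) ^ S (m + n))).
    unfold U in Hx.
    replace (INR (S (m + n)) * (/ (1 - x)) ^ S (S (m + n)))
      with (INR (S (m + n)) * (/ (1 - x)) ^ 2 * (/ (1 - x)) ^ pred (S (m + n)))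
      by (cbn [Nat.pred pow]; ring).
    apply (is_derive_pow (fun x => / (1 - x))); auto_derive; [lra|field; lra]. }
  assert (H := taylor_fam_unique U _ _ (fun x Hx => open_lt 1 x Hx)
    (taylor_fam_mult U _ _ (HA p) (HA q)) (HA (S (p + q)))).
  assert (H1 : U 0) by (unfold U; lra).
  specialize (fun h => H h l 0 H1); cbv beta in H.
  assert (E : forall m, (fun k => A m k 0) = bin m).
  { intros m; apply functional_extensionality; intros k; unfold A.
    rewrite Rminus_0_r, Rinv_1, pow1; ring. }
  rewrite !E in H. rewrite H.
  - unfold A; rewrite Rminus_0_r, Rinv_1, pow1; ring.
  - intros x Hx; unfold A, PS_mult; cbn [sum_f_R0 Nat.sub]; rewrite !bin_0_r.
    rewrite !Nat.add_0_r, !Rmult_1_l, <- pow_add; f_equal; lia.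
Qed.

(** A summable factor whose self-convolution is bounded by a multiple of itself. It lets a quadratic
    recursion close under a geometric bound, for which the growing number of terms of the
    convolution would otherwise be an obstacle. *)
Definition weight (n : nat) : R := / (INR (S n) * INR (S n)).

Lemma INR_S_pos n : 0 < INR (S n).
Proof. apply lt_0_INR; lia. Qed.

Lemma weight_pos n : 0 < weight n.
Proof. apply Rinv_0_lt_compat, Rmult_lt_0_compat; apply INR_S_pos. Qed.

Lemma weight_le_1 n : weight n <= 1.
Proof.
  unfold weight; rewrite <- Rinv_1; apply Rinv_le_contravar; [lra|].
  assert (1 <= INR (S n)) by (rewrite S_INR; assert (H := pos_INR n); lra). nra.
Qed.

(** Telescoping: [1 / (n + 1)^2 <= 1 / n - 1 / (n + 1)]. *)
Lemma sum_weight k : sum_f_R0 weight k <= 2 - / INR (S k).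
Proof.
  induction k as [|k IH].
  - unfold weight; simpl; lra.
  - rewrite tech5; assert (H := INR_S_pos k).
    assert (E : INR (S (S k)) = INR (S k) + 1) by apply S_INR.
    unfold weight at 2; rewrite E.
    assert (/ ((INR (S k) + 1) * (INR (S k) + 1)) <= / INR (S k) - / (INR (S k) + 1)).
    { apply Rmult_le_reg_l with (INR (S k) * ((INR (S k) + 1) * (INR (S k) + 1))).
      - repeat apply Rmult_lt_0_compat; lra.
      - apply Rle_trans with (INR (S k)); [right; field; lra|].
        apply Rle_trans with (INR (S k) + 1); [lra|right; field; lra]. }
    lra.
Qed.

Lemma sum_rev (f : nat -> R) k : sum_f_R0 (fun j => f (k - j)%nat) k = sum_f_R0 f k.
Proof.
  induction k as [|k IH]; auto.
  rewrite (decomp_sum (fun j => f (S k - j)%nat)) by lia; cbn [Nat.pred].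
  rewrite tech5, <- IH, Nat.sub_0_r, Rplus_comm; f_equal.
Qed.

(** With [a = j + 1] and [b = k - j + 1], the inequality [(a + b)^2 <= 2 (a^2 + b^2)] divided by
    [a^2 b^2 (a + b)^2] bounds each product by [2 * weight (S k)] times a sum of two weights. The
    weights sum to at most 2, whence 8. *)
Lemma weight_convolution k : PS_mult weight weight k <= 8 * weight (S k).
Proof.
  apply Rle_trans with (2 * weight (S k) * (sum_f_R0 weight k + sum_f_R0 weight k)).
  - rewrite <- (sum_rev weight k) at 2.
    rewrite <- plus_sum, scal_sum; apply sum_Rle; intros j Hj.
    unfold weight.
    assert (E : INR (S (S k)) = INR (S j) + INR (S (k - j))).
    { rewrite <- plus_INR; f_equal; lia. }
    rewrite E; assert (Ha := INR_S_pos j); assert (Hb := INR_S_pos (k - j)).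
    set (a := INR (S j)) in *; set (b := INR (S (k - j))) in *.
    replace (/ (a * a) * / (b * b))
      with ((a + b) * (a + b) * / ((a * a) * (b * b) * ((a + b) * (a + b)))) by (field; lra).
    replace ((/ (a * a) + / (b * b)) * (2 * / ((a + b) * (a + b))))
      with (2 * (a * a + b * b) * / ((a * a) * (b * b) * ((a + b) * (a + b)))) by (field; lra).
    apply Rmult_le_compat_r; [|assert (H := Rle_0_sqr (a - b)); unfold Rsqr in H; lra].
    left; apply Rinv_0_lt_compat; repeat apply Rmult_lt_0_compat; lra.
  - assert (H := sum_weight k); assert (H' := weight_pos (S k)).
    assert (H2 := Rinv_0_lt_compat _ (INR_S_pos k)). nra.
Qed.

Lemma Rabs_sum_le (f g : nat -> R) n :
  (forall k, (k <= n)%nat -> Rabs (f k) <= g k) ->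
  Rabs (sum_f_R0 f n) <= sum_f_R0 g n.
Proof.
  intros H; eapply Rle_trans; [apply sum_f_R0_triangle|].
  now apply sum_Rle.
Qed.

(** In the majorant, row [j] behaves like [(1 - x)^-(2 j + 1)]. Its product with the x-derivative of
    row [k - j] has exponent [-(2 k + 3)], which is the shape of row [k + 1]. Differentiation costs
    the factor [2 (k - j) + 1 <= 2 (k + 1)], which the division by [k + 1] in the recursion
    absorbs. *)
Lemma cauchy_coef_majorant u A :
  (forall i l, Rabs (u i l) <= A) -> forall k i l,
  Rabs (cauchy_coef u i k l) <= A * weight k * (16 * (2 * A + 1)) ^ k * bin (2 * k) l.
Proof.
  intros Hu.
  assert (HA : 0 <= A) by (eapply Rle_trans; [apply Rabs_pos|apply (Hu I1 O)]).
  (* [2 A + 1] bounds the speed, being a sum of two unknowns and an offset of modulus at most 1. The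
     factor 16 is 8 from the convolution of weights times 2 from the x-derivative. *)
  set (B := 16 * (2 * A + 1)).
  assert (HB : 0 < B) by (unfold B; lra).
  intros k; induction k as [k IH] using lt_wf_ind; intros i l; destruct k as [|k].
  - rewrite cauchy_coef_O, bin_0_l; unfold weight; simpl.
    replace (A * / (1 * 1) * 1 * 1) with A by field; apply Hu.
  - rewrite cauchy_coef_S; unfold next_coef.
    rewrite Rabs_mult, Rabs_Ropp, Rabs_inv, (Rabs_right (INR (S k)))
      by (left; apply INR_S_pos).
    assert (HS := INR_S_pos k).
    apply Rmult_le_reg_l with (INR (S k)); auto.
    rewrite <- Rmult_assoc, Rinv_r, Rmult_1_l by lra.
    assert (Hv : forall j n, (j <= k)%nat ->
      Rabs (speed_coef (cauchy_table u) i j n)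
      <= (2 * A + 1) * weight j * B ^ j * bin (2 * j) n).
    { intros j n Hj; unfold speed_coef, cauchy_table.
      eapply Rle_trans; [apply Rabs_triang|].
      assert (H1 := IH j ltac:(lia) I1 n); assert (H2 := IH j ltac:(lia) I2 n).
      set (m := weight j * B ^ j * bin (2 * j) n).
      assert (Hm : 0 < m).
      { unfold m; apply Rmult_lt_0_compat; [|apply bin_pos].
        apply Rmult_lt_0_compat; [apply weight_pos|now apply pow_lt]. }
      assert (H3 : Rabs (match j, n with O, O => offset i | _, _ => 0 end) <= m).
      { destruct j; [destruct n|]; try (rewrite Rabs_R0; lra).
        unfold m, weight; rewrite bin_0_r; simpl.
        replace (/ (1 * 1) * 1 * 1) with 1 by field.
        destruct i; simpl; unfold Rabs; destruct (Rcase_abs _); lra. }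
      assert (H4 := Rabs_triang (cauchy_coef u I1 j n) (cauchy_coef u I2 j n)).
      unfold m in *; lra. }
    apply Rle_trans with (sum_f_R0 (fun j =>
      (2 * A + 1) * A * B ^ k * (2 * INR (S k)) * bin (2 * S k) l
      * (weight j * weight (k - j))) k).
    + apply Rabs_sum_le; intros j Hj.
      apply Rle_trans with ((2 * A + 1) * A * B ^ k * (weight j * weight (k - j))
        * (INR (S (2 * (k - j))) * PS_mult (bin (2 * j)) (bin (S (2 * (k - j)))) l)).
      * unfold PS_mult at 2; rewrite !scal_sum; apply Rabs_sum_le; intros n Hn.
        rewrite Rabs_mult, (Rabs_mult (INR _)), (Rabs_right (INR _)) by (left; apply INR_S_pos).
        apply Rle_trans with
          (((2 * A + 1) * weight j * B ^ j * bin (2 * j) n) *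
           (INR (S (l - n)) *
            (A * weight (k - j) * B ^ (k - j) * bin (2 * (k - j)) (S (l - n))))).
        -- apply Rmult_le_compat; try apply Rabs_pos; auto.
           ++ apply Rmult_le_pos; [left; apply INR_S_pos|apply Rabs_pos].
           ++ apply Rmult_le_compat_l; [left; apply INR_S_pos|apply IH; lia].
        -- right.
           replace (B ^ k) with (B ^ j * B ^ (k - j))
             by (rewrite <- pow_add; f_equal; lia).
           replace (INR (S (l - n)) *
            (A * weight (k - j) * B ^ (k - j) * bin (2 * (k - j)) (S (l - n))))
            with (A * weight (k - j) * B ^ (k - j)
                  * (INR (S (l - n)) * bin (2 * (k - j)) (S (l - n)))) by ring.
           rewrite bin_S_r; ring.
      * rewrite bin_convolution.
        replace (S (2 * j + S (2 * (k - j))))%nat with (2 * S k)%nat by lia.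
        assert (H1 : INR (S (2 * (k - j))) <= 2 * INR (S k)).
        { replace 2 with (INR 2) by reflexivity; rewrite <- mult_INR; apply le_INR; lia. }
        assert (P1 := bin_pos (2 * S k) l); assert (P2 := weight_pos j).
        assert (P3 := weight_pos (k - j)); assert (P4 := pow_lt B k HB).
        assert (P5 : 0 <= (2 * A + 1) * A * B ^ k * (weight j * weight (k - j)) * bin (2 * S k) l).
        { apply Rmult_le_pos; [|lra]; apply Rmult_le_pos; [|apply Rmult_le_pos; lra].
          apply Rmult_le_pos; [apply Rmult_le_pos|]; lra. }
        apply Rle_trans with ((2 * A + 1) * A * B ^ k * (weight j * weight (k - j))
            * bin (2 * S k) l * (2 * INR (S k))); [|right; ring].
        apply Rle_trans with ((2 * A + 1) * A * B ^ k * (weight j * weight (k - j))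
            * bin (2 * S k) l * INR (S (2 * (k - j)))); [right; ring|].
        now apply Rmult_le_compat_l.
    + set (K := (2 * A + 1) * A * B ^ k * (2 * INR (S k)) * bin (2 * S k) l).
      assert (HK : 0 <= K).
      { unfold K; assert (P1 := bin_pos (2 * S k) l); assert (P4 := pow_lt B k HB).
        apply Rmult_le_pos; [|lra]; apply Rmult_le_pos; [|lra].
        apply Rmult_le_pos; [apply Rmult_le_pos|]; lra. }
      rewrite (sum_eq _ (fun j => weight j * weight (k - j) * K)) by (intros; ring).
      rewrite <- scal_sum.
      apply Rle_trans with (K * (8 * weight (S k))).
      * apply Rmult_le_compat_l; [auto|apply weight_convolution].
      * right; unfold K; simpl pow; unfold B at 2; ring.
Qed.

(** [bin (2 * k) l <= 2 ^ (2 * k + l)] contributes a factor 4 per step in [t], which turns 16 into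
    64. *)
Lemma cauchy_coef_bound u A :
  (forall i l, Rabs (u i l) <= A) -> forall k i l,
  Rabs (cauchy_coef u i k l) <= A * 2 ^ l * (64 * (2 * A + 1)) ^ k.
Proof.
  intros Hu k i l.
  assert (HA : 0 <= A) by (eapply Rle_trans; [apply Rabs_pos|apply (Hu I1 O)]).
  eapply Rle_trans; [apply (cauchy_coef_majorant u A Hu)|].
  replace (64 * (2 * A + 1)) with (16 * (2 * A + 1) * 2 ^ 2) by ring.
  rewrite (Rpow_mult_distr (16 * (2 * A + 1)) (2 ^ 2) k), <- pow_mult.
  assert (P1 := bin_le (2 * k) l); rewrite pow_add in P1.
  assert (P2 := bin_pos (2 * k) l).
  assert (P3 := weight_pos k); assert (P4 := weight_le_1 k).
  assert (P5 : 0 <= (16 * (2 * A + 1)) ^ k) by (apply pow_le; lra).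
  apply Rle_trans with (A * 1 * (16 * (2 * A + 1)) ^ k * (2 ^ (2 * k) * 2 ^ l)); [|right; ring].
  apply Rmult_le_compat; try lra.
  - apply Rmult_le_pos; auto; apply Rmult_le_pos; lra.
  - apply Rmult_le_compat_r; auto; apply Rmult_le_compat_l; lra.
Qed.

(** * Convergence *)

(** Staying within half of the guaranteed radius of convergence makes the terms at most [K / 2^n],
    so the sum is at most [2 K]. *)
Lemma PSeries_geometric a K M t :
  0 < M -> (forall n, Rabs (a n) <= K * M ^ n) -> Rabs t <= / (2 * M) ->
  ex_series (fun n => Rabs (a n * t ^ n)) /\ Rabs (PSeries a t) <= 2 * K.
Proof.
  intros HM Ha Ht.
  assert (Hb : forall n, Rabs (a n * t ^ n) <= K * (/ 2) ^ n).
  { intros n; rewrite Rabs_mult, <- RPow_abs.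
    apply Rle_trans with ((K * M ^ n) * (/ (2 * M)) ^ n).
    - apply Rmult_le_compat; auto; try apply Rabs_pos.
      + apply pow_le, Rabs_pos.
      + apply pow_incr; split; [apply Rabs_pos|auto].
    - rewrite Rmult_assoc, <- Rpow_mult_distr.
      replace (M * / (2 * M)) with (/ 2) by (field; lra); lra. }
  assert (Hg : is_series (fun n => K * (/ 2) ^ n) (2 * K)).
  { replace (2 * K) with (K * / (1 - / 2)) by field.
    apply (is_series_scal K (fun n => (/ 2) ^ n)), is_series_geom.
    rewrite Rabs_right; lra. }
  assert (He : ex_series (fun n => Rabs (a n * t ^ n))).
  { apply (@ex_series_le R_AbsRing R_CompleteNormedModule _ (fun n => K * (/ 2) ^ n)); [|eexists; exact Hg].
    intros n; unfold norm; simpl; unfold abs; simpl; rewrite Rabs_Rabsolu; auto. }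
  split; auto.
  unfold PSeries; eapply Rle_trans; [apply Series_Rabs; exact He|].
  rewrite <- (is_series_unique _ _ Hg); apply Series_le.
  - intros n; split; [apply Rabs_pos|auto].
  - eexists; exact Hg.
Qed.

Lemma CV_radius_geometric a K M t :
  0 < M -> (forall n, Rabs (a n) <= K * M ^ n) -> Rabs t <= / (2 * M) ->
  Rbar_lt (Rabs t) (CV_radius a).
Proof.
  intros HM Ha Ht.
  apply Rbar_lt_le_trans with (/ M).
  - simpl; eapply Rle_lt_trans; [exact Ht|].
    apply Rinv_lt_contravar; nra.
  - apply (proj1 (CV_radius_bounded a)); exists K; intros n.
    rewrite Rabs_mult, <- RPow_abs, (Rabs_right (/ M))
      by (left; now apply Rinv_0_lt_compat).
    apply Rle_trans with ((K * M ^ n) * (/ M) ^ n).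
    + apply Rmult_le_compat_r; auto; apply pow_le; left; now apply Rinv_0_lt_compat.
    + rewrite Rmult_assoc, <- Rpow_mult_distr, Rinv_r, pow1 by lra; lra.
Qed.

Lemma mvt_bound (f f1 : R -> R) x y C :
  (forall z, Rmin x y <= z <= Rmax x y -> is_derive f z (f1 z) /\ Rabs (f1 z) <= C) ->
  Rabs (f y - f x) <= C * Rabs (y - x).
Proof.
  intros H; destruct (MVT_gen f x y f1) as (c & Hc & ->).
  - intros z Hz; apply H; lra.
  - intros z Hz; apply continuity_pt_filterlim, (ex_derive_continuous f).
    exists (f1 z); now apply H.
  - rewrite Rabs_mult; apply Rmult_le_compat_r; [apply Rabs_pos|now apply H].
Qed.

(** Two applications of the mean value inequality; this gives the constant [C] instead of the sharp
    [C / 2]. *)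
Lemma taylor_bound (f f1 f2 : R -> R) x y C :
  (forall z, Rmin x y <= z <= Rmax x y ->
     is_derive f z (f1 z) /\ is_derive f1 z (f2 z) /\ Rabs (f2 z) <= C) ->
  Rabs (f y - f x - f1 x * (y - x)) <= C * Rabs (y - x) * Rabs (y - x).
Proof.
  intros H.
  assert (HC : 0 <= C).
  { eapply Rle_trans; [apply Rabs_pos|apply (H x)].
    split; [apply Rmin_l|apply Rmax_l]. }
  replace (f y - f x - f1 x * (y - x))
    with ((f y - f1 x * (y - x)) - (f x - f1 x * (x - x))) by ring.
  apply (mvt_bound (fun z => f z - f1 x * (z - x)) (fun z => f1 z - f1 x)).
  intros z Hz; split.
  - replace (f1 z - f1 x) with (f1 z + (- f1 x * 1)) by ring.
    apply (is_derive_ext (fun z => f z + (- f1 x) * (z - x))); [intros; simpl; ring|].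
    apply is_derive_Rplus; [now apply H|].
    apply (is_derive_scal (fun z => z - x)).
    auto_derive; [exact I|ring].
  - assert (Hzx : Rabs (z - x) <= Rabs (y - x)).
    { unfold Rmin, Rmax in Hz; destruct (Rle_dec x y);
        unfold Rabs; repeat destruct (Rcase_abs _); lra. }
    apply Rle_trans with (C * Rabs (z - x)).
    + apply (mvt_bound f1 f2); intros w Hw; apply (H w).
      unfold Rmin, Rmax in *; destruct (Rle_dec x y), (Rle_dec x z); lra.
    + now apply Rmult_le_compat_l.
Qed.

(** Termwise differentiation in a parameter. The bound on second derivatives makes the linearization
    error of the [n]-th coefficient at most [K2 * M ^ n * |y - x|^2], and these errors sum to at
    most [2 K2 |y - x|^2]. *)
Lemma PSeries_param_derive (a0 a1 a2 : nat -> R -> R) K0 K1 K2 M t x :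
  0 < M -> Rabs t <= / (2 * M) -> Rabs x < 1 ->
  (forall n y, Rabs y < 1 -> is_derive (a0 n) y (a1 n y) /\ is_derive (a1 n) y (a2 n y)) ->
  (forall n y, Rabs y < 1 -> Rabs (a0 n y) <= K0 * M ^ n) ->
  (forall n y, Rabs y < 1 -> Rabs (a1 n y) <= K1 * M ^ n) ->
  (forall n y, Rabs y < 1 -> Rabs (a2 n y) <= K2 * M ^ n) ->
  is_derive (fun y => PSeries (fun n => a0 n y) t) x (PSeries (fun n => a1 n x) t).
Proof.
  intros HM Ht Hx Hd H0 H1 H2; apply is_derive_eps; intros e He.
  assert (HK2 : 0 <= K2).
  { assert (P := Rabs_pos (a2 O x)); assert (Q := H2 O x Hx); simpl in Q; lra. }
  assert (Hr : 0 < Rmin (1 - Rabs x) (e / (2 * K2 + 1))).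
  { apply Rmin_pos; [lra|apply Rdiv_lt_0_compat; lra]. }
  exists (mkposreal _ Hr); simpl; intros y Hy.
  assert (Hy' : Rabs (y - x) < Rmin (1 - Rabs x) (e / (2 * K2 + 1))) by exact Hy.
  assert (Hy1 : Rabs y < 1).
  { assert (P := Rmin_l (1 - Rabs x) (e / (2 * K2 + 1))).
    assert (Q := Rabs_triang (y - x) x); replace (y - x + x) with y in Q by ring; lra. }
  assert (HE : forall b K, (forall n, Rabs (b n) <= K * M ^ n) -> ex_series (fun n => b n * t ^ n)).
  { intros b K Hb; apply ex_series_Rabs, (PSeries_geometric b K M t HM Hb Ht). }
  set (D := fun n => a0 n y - a0 n x - a1 n x * (y - x)).
  assert (HD : PSeries D t = PSeries (fun n => a0 n y) t - PSeries (fun n => a0 n x) t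
                             - PSeries (fun n => a1 n x) t * (y - x)).
  { unfold PSeries.
    rewrite <- Series_minus, <- Series_scal_r, <- Series_minus.
    - apply Series_ext; intros n; unfold D; ring.
    - apply (ex_series_minus (fun n => a0 n y * t ^ n) (fun n => a0 n x * t ^ n));
        eapply HE; intros n; apply H0; auto.
    - apply (ex_series_scal_r (y - x) (fun n => a1 n x * t ^ n)).
      eapply HE; intros n; apply H1; auto.
    - eapply HE; intros n; apply H0; auto.
    - eapply HE; intros n; apply H0; auto. }
  rewrite <- HD.
  apply Rle_trans with (2 * (K2 * Rabs (y - x) * Rabs (y - x))).
  - apply (PSeries_geometric D _ M t HM); auto; intros n.
    apply Rle_trans with (K2 * M ^ n * Rabs (y - x) * Rabs (y - x)); [|right; ring].
    apply (taylor_bound (a0 n) (a1 n) (a2 n)); intros z Hz.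
    assert (Hz1 : Rabs z < 1).
    { unfold Rmin, Rmax in Hz; destruct (Rle_dec x y);
        revert Hz Hx Hy1; unfold Rabs; repeat destruct (Rcase_abs _); lra. }
    split; [apply Hd; auto|split; [apply Hd; auto|apply H2; auto]].
  - assert (P := Rabs_pos (y - x)).
    assert (Q : Rabs (y - x) * (2 * K2 + 1) <= e).
    { apply Rle_trans with (e / (2 * K2 + 1) * (2 * K2 + 1)); [|right; field; lra].
      apply Rmult_le_compat_r; [lra|].
      assert (Q := Rmin_r (1 - Rabs x) (e / (2 * K2 + 1))); lra. }
    nra.
Qed.

(** The [l]-th Taylor coefficient at [x] of the polynomial with coefficients [c i m], [m <= N]. *)
Definition poly_coef (c : dep -> nat -> R) (N : nat) (x : R) (i : dep) (l : nat) : R :=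
  sum_f_R0 (fun m => if Nat.leb l m then c i m * bin l (m - l) * x ^ (m - l) else 0) N.

Lemma poly_coef_family c N i :
  taylor_fam (fun _ => True) (fun l x => poly_coef c N x i l).
Proof.
  intros l x _; unfold poly_coef; rewrite scal_sum.
  apply (is_derive_sum (fun m x => if Nat.leb l m then c i m * bin l (m - l) * x ^ (m - l) else 0)).
  intros m _; destruct (Nat.leb_spec l m) as [H|H], (Nat.leb_spec (S l) m) as [H'|H'];
    try lia.
  - replace (m - l)%nat with (S (m - S l)) by lia.
    replace (c i m * bin (S l) (m - S l) * x ^ (m - S l) * INR (S l))
      with (c i m * bin l (S (m - S l)) * (INR (S (m - S l)) * 1 * x ^ pred (S (m - S l)))).
    + apply (is_derive_scal (fun x => x ^ S (m - S l))).
      apply (is_derive_pow (fun x => x)); apply (is_derive_id x).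
    + cbn [Nat.pred].
      replace (c i m * bin l (S (m - S l)) * (INR (S (m - S l)) * 1 * x ^ (m - S l)))
        with (c i m * (INR (S (m - S l)) * bin l (S (m - S l))) * x ^ (m - S l)) by ring.
      rewrite bin_S_r; ring.
  - replace (m - l)%nat with O by lia; rewrite Rmult_0_l.
    apply (is_derive_ext (fun _ => c i m * bin l 0 * 1)); [reflexivity|].
    apply (is_derive_const (c i m * bin l 0 * 1)).
  - rewrite Rmult_0_l; apply (is_derive_const 0).
Qed.

Lemma poly_coef_0 c N i l : (l <= N)%nat -> poly_coef c N 0 i l = c i l.
Proof.
  intros Hl; unfold poly_coef; rewrite (sum_f_R0_single _ N l Hl).
  - rewrite Nat.leb_refl, Nat.sub_diag, bin_0_r; simpl; ring.
  - intros m Hm; destruct (Nat.leb_spec l m); auto.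
    replace (m - l)%nat with (S (m - S l)) by lia; simpl; ring.
Qed.

(** Uses [bin l (m - l) <= 2 ^ m] and [|x| < 1]. The bound is uniform in [l] and [x], as the
    majorant requires. *)
Lemma poly_coef_bound c N : exists A, forall x, Rabs x < 1 -> forall i l,
  Rabs (poly_coef c N x i l) <= A.
Proof.
  set (A := fun i => sum_f_R0 (fun m => Rabs (c i m) * 2 ^ m) N).
  assert (HA : forall i, 0 <= A i).
  { intros i; apply cond_pos_sum; intros m; apply Rmult_le_pos; [apply Rabs_pos|].
    apply pow_le; lra. }
  exists (A I1 + A I2 + A I3); intros x Hx i l.
  apply Rle_trans with (A i);
    [|assert (H1 := HA I1); assert (H2 := HA I2); assert (H3 := HA I3); destruct i; lra].
  apply Rabs_sum_le; intros m _.
  assert (P : 0 < 2 ^ m) by (apply pow_lt; lra).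
  destruct (Nat.leb_spec l m).
  - rewrite !Rabs_mult, Rmult_assoc; apply Rmult_le_compat_l; [apply Rabs_pos|].
    rewrite <- RPow_abs, (Rabs_right (bin _ _)) by (left; apply bin_pos).
    rewrite <- (Rmult_1_r (2 ^ m)); apply Rmult_le_compat.
    + left; apply bin_pos.
    + apply pow_le, Rabs_pos.
    + replace m with (l + (m - l))%nat at 2 by lia; apply bin_le.
    + rewrite <- (pow1 (m - l)); apply pow_incr; split; [apply Rabs_pos|lra].
  - rewrite Rabs_R0; apply Rmult_le_pos; [apply Rabs_pos|lra].
Qed.

(** The recursion consists of sums, products and index shifts, all of which preserve Taylor
    families. Expanding the data at a moving point [x] therefore gives rows that are related by
    differentiation in [x]. *)
Lemma taylor_fam_cauchy_coef V (u : R -> dep -> nat -> R) :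
  (forall i, taylor_fam V (fun l x => u x i l)) ->
  forall k i, taylor_fam V (fun l x => cauchy_coef (u x) i k l).
Proof.
  intros Hu k; induction k as [k IH] using lt_wf_ind; intros i; destruct k as [|k]; [apply Hu|].
  intros l x Hx; rewrite cauchy_coef_S.
  apply (is_derive_ext (fun x => next_coef (cauchy_table (u x)) i k l)).
  { intros y; symmetry; apply cauchy_coef_S. }
  revert l x Hx; unfold next_coef; apply taylor_fam_scal.
  apply (taylor_fam_sum V (fun j l x =>
    PS_mult (speed_coef (cauchy_table (u x)) i j)
            (fun n => INR (S n) * cauchy_coef (u x) i (k - j) (S n)) l)).
  intros j Hj; apply (taylor_fam_mult V
    (fun n x => speed_coef (cauchy_table (u x)) i j n)
    (fun n x => INR (S n) * cauchy_coef (u x) i (k - j) (S n))).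
  - unfold speed_coef, cauchy_table.
    apply (taylor_fam_plus_offset V _ _
             (fun n => match j, n with O, O => offset i | _, _ => 0 end)).
    + intros n; now destruct j.
    + apply IH; lia.
    + apply IH; lia.
  - apply (taylor_fam_shift V (fun n x => cauchy_coef (u x) i (k - j) n)).
    apply IH; lia.
Qed.

(* The [(k, l)] Taylor coefficient, at [(t, x)], of the solution of the Cauchy
   problem; [u x] lists the Taylor coefficients at [x] of the initial data. *)
Definition cauchy_family (u : R -> dep -> nat -> R) (i : dep) (k l : nat) (t x : R) : R :=
  PSeries (fun j => bin k j * cauchy_coef (u x) i (k + j) l) t.

Definition data_bound (u : R -> dep -> nat -> R) (A : R) : Prop :=
  forall x, Rabs x < 1 -> forall i l, Rabs (u x i l) <= A.

(** The constant of [cauchy_coef_bound], doubled to absorb [bin k j <= 2 ^ (k + j)] in the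
    re-expanded series. *)
Definition growth (A : R) : R := 2 * (64 * (2 * A + 1)).

Definition family_bound (A : R) (k l : nat) : R := A * 2 ^ l * growth A ^ k.

Lemma data_bound_nonneg u A : data_bound u A -> 0 <= A.
Proof.
  intros H; eapply Rle_trans; [apply Rabs_pos|apply (H 0 ltac:(rewrite Rabs_R0; lra) I1 O)].
Qed.

Lemma growth_pos u A : data_bound u A -> 0 < growth A.
Proof. intros H; apply data_bound_nonneg in H; unfold growth; lra. Qed.

Lemma family_coef_bound u A i k l x :
  data_bound u A -> Rabs x < 1 -> forall j,
  Rabs (bin k j * cauchy_coef (u x) i (k + j) l) <= family_bound A k l * growth A ^ j.
Proof.
  intros H Hx j; assert (HA := data_bound_nonneg u A H).
  rewrite Rabs_mult, (Rabs_right (bin k j)) by (left; apply bin_pos).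
  apply Rle_trans with (2 ^ (k + j) * (A * 2 ^ l * (64 * (2 * A + 1)) ^ (k + j))).
  - apply Rmult_le_compat; [left; apply bin_pos|apply Rabs_pos|apply bin_le|].
    apply cauchy_coef_bound; auto.
  - right; unfold family_bound, growth.
    rewrite !Rpow_mult_distr, !pow_add; ring.
Qed.

Lemma cauchy_family_bound u A i k l t x :
  data_bound u A -> Rabs x < 1 -> Rabs t <= / (2 * growth A) ->
  Rabs (cauchy_family u i k l t x) <= 2 * family_bound A k l.
Proof.
  intros H Hx Ht.
  apply (PSeries_geometric _ _ (growth A)); auto; [now apply (growth_pos u)|].
  now apply (family_coef_bound u).
Qed.

(** [bin k j] is the effect on coefficients of differentiating [k] times in [t] and dividing by
    [k!]; [bin_S_r] is the identity by which one more derivative raises [k]. *)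
Lemma cauchy_family_dt u A i k l t x :
  data_bound u A -> Rabs x < 1 -> Rabs t <= / (2 * growth A) ->
  is_derive (fun t => cauchy_family u i k l t x) t (INR (S k) * cauchy_family u i (S k) l t x).
Proof.
  intros H Hx Ht.
  replace (INR (S k) * cauchy_family u i (S k) l t x)
    with (PSeries (PS_derive (fun j => bin k j * cauchy_coef (u x) i (k + j) l)) t).
  - apply is_derive_PSeries.
    apply (CV_radius_geometric _ (family_bound A k l) (growth A)); auto;
      [now apply (growth_pos u)|now apply (family_coef_bound u)].
  - unfold cauchy_family; rewrite <- PSeries_scal; apply PSeries_ext; intros j.
    change (INR (S j) * (bin k (S j) * cauchy_coef (u x) i (k + S j) l)
            = INR (S k) * (bin (S k) j * cauchy_coef (u x) i (S k + j) l)).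
    rewrite <- !Rmult_assoc, bin_S_r, Nat.add_succ_r; reflexivity.
Qed.

(** The x-derivative of each coefficient is the next x-coefficient times its index. Parameter
    differentiation needs two such steps, and the scalar [c] in [a] collects the resulting index
    factors. *)
Lemma cauchy_family_dx u A i k l t x :
  (forall i, taylor_fam (fun x => Rabs x < 1) (fun l x => u x i l)) ->
  data_bound u A -> Rabs x < 1 -> Rabs t <= / (2 * growth A) ->
  is_derive (fun x => cauchy_family u i k l t x) x (INR (S l) * cauchy_family u i k (S l) t x).
Proof.
  intros Hu H Hx Ht.
  assert (Hf := taylor_fam_cauchy_coef _ u Hu).
  set (a := fun c l n x => c * (bin k n * cauchy_coef (u x) i (k + n) l)).
  assert (Ha : forall c l n x, Rabs x < 1 -> is_derive (a c l n) x (a (c * INR (S l)) (S l) n x)).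
  { intros c m n y Hy; unfold a.
    replace (c * INR (S m) * (bin k n * cauchy_coef (u y) i (k + n) (S m)))
      with (c * (bin k n * (INR (S m) * cauchy_coef (u y) i (k + n) (S m)))) by ring.
    apply (is_derive_scal (fun x => bin k n * cauchy_coef (u x) i (k + n) m)).
    apply (is_derive_scal (fun x => cauchy_coef (u x) i (k + n) m)).
    now apply (Hf (k + n)%nat i m y). }
  assert (Hb : forall c l n x, Rabs x < 1 ->
    Rabs (a c l n x) <= (Rabs c * family_bound A k l) * growth A ^ n).
  { intros c m n y Hy; unfold a; rewrite Rabs_mult, Rmult_assoc.
    apply Rmult_le_compat_l; [apply Rabs_pos|now apply (family_coef_bound u)]. }
  replace (INR (S l) * cauchy_family u i k (S l) t x)
    with (PSeries (fun n => a (1 * INR (S l)) (S l) n x) t).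
  - apply (is_derive_ext (fun x => PSeries (fun n => a 1 l n x) t)).
    { intros y; unfold a; apply PSeries_ext; intros n; ring. }
    apply (PSeries_param_derive (a 1 l) (a (1 * INR (S l)) (S l))
      (a (1 * INR (S l) * INR (S (S l))) (S (S l)))
      (Rabs 1 * family_bound A k l)
      (Rabs (1 * INR (S l)) * family_bound A k (S l))
      (Rabs (1 * INR (S l) * INR (S (S l))) * family_bound A k (S (S l))) (growth A)); auto.
    now apply (growth_pos u).
  - unfold cauchy_family; rewrite <- PSeries_scal; apply PSeries_ext; intros n.
    unfold a, PS_scal, scal; simpl; unfold mult; simpl; ring.
Qed.

Lemma PSeries_const_term o t :
  PSeries (fun j => match j with O => o | S _ => 0 end) t = o.
Proof.
  unfold PSeries; rewrite (Series_finite _ 0); [simpl; ring|].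
  intros [|k] Hk; [lia|ring].
Qed.

(** At x-order 0 the product [V r_x] has a single term in the x-convolution, so only the Cauchy
    product in [t] remains and the claim is the recursion summed over [t]. *)
Lemma cauchy_family_equation u A i t x :
  data_bound u A -> Rabs x < 1 -> Rabs t <= / (2 * growth A) ->
  cauchy_family u i 1 0 t x
  + (cauchy_family u I1 0 0 t x + cauchy_family u I2 0 0 t x + offset i)
    * cauchy_family u i 0 1 t x = 0.
Proof.
  intros H Hx Ht.
  assert (HM := growth_pos u A H).
  assert (Hb : forall i l n, Rabs (cauchy_coef (u x) i n l) <= family_bound A 0 l * growth A ^ n).
  { intros i' l n; generalize (family_coef_bound u A i' 0 l x H Hx n).
    now rewrite bin_0_l, Rmult_1_l. }
  assert (E0 : forall i l, cauchy_family u i 0 l t x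
                           = PSeries (fun n => cauchy_coef (u x) i n l) t).
  { intros i' l; apply PSeries_ext; intros n; now rewrite bin_0_l, Rmult_1_l. }
  rewrite !E0.
  set (o := fun j => match j with O => offset i | S _ => 0 end).
  assert (Ho : forall n, Rabs (o n) <= Rabs (offset i) * growth A ^ n).
  { intros [|n]; simpl; [lra|rewrite Rabs_R0; apply Rmult_le_pos; [apply Rabs_pos|]].
    left; apply (pow_lt _ (S n) HM). }
  assert (Hex : forall b K, (forall n, Rabs (b n) <= K * growth A ^ n) -> ex_pseries b t).
  { intros b K Hbd; apply CV_disk_correct.
    apply (PSeries_geometric b K (growth A) t HM Hbd Ht). }
  assert (Es : PSeries (fun n => cauchy_coef (u x) I1 n 0) t
               + PSeries (fun n => cauchy_coef (u x) I2 n 0) t + offset i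
    = PSeries (fun j => speed_coef (cauchy_table (u x)) i j 0) t).
  { rewrite <- (PSeries_const_term (offset i) t); fold o.
    assert (X1 := Hex _ _ (Hb I1 O)); assert (X2 := Hex _ _ (Hb I2 O)).
    assert (X3 := Hex _ _ Ho).
    rewrite <- (PSeries_plus _ _ t X1 X2), <- (PSeries_plus _ _ t (ex_pseries_plus _ _ t X1 X2) X3).
    apply PSeries_ext; intros n; unfold PS_plus, speed_coef, cauchy_table, o; now destruct n. }
  rewrite Es, <- PSeries_mult.
  - replace (cauchy_family u i 1 0 t x) with (PSeries (PS_scal (-1) (PS_mult
      (fun j => speed_coef (cauchy_table (u x)) i j 0)
      (fun n => cauchy_coef (u x) i n 1))) t).
    + rewrite PSeries_scal; ring.
    + apply PSeries_ext; intros n.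
      change (1 + n)%nat with (S n); rewrite cauchy_coef_S.
      transitivity (-1 * PS_mult
        (fun j => speed_coef (cauchy_table (u x)) i j 0)
        (fun n => cauchy_coef (u x) i n 1) n); [reflexivity|].
      unfold next_coef; replace (bin 1 n) with (INR (S n)).
      * rewrite <- Rmult_assoc, Ropp_mult_distr_r_reverse, Rinv_r by (now apply not_0_INR).
        f_equal; apply sum_eq; intros j _; unfold PS_mult, cauchy_table; cbn [sum_f_R0 Nat.sub].
        change (INR 1) with 1; ring.
      * assert (E := bin_S_r 0 n); rewrite bin_0_l in E; simpl (INR 1) in E; lra.
  - apply (CV_radius_geometric _ (family_bound A 0 0 + family_bound A 0 0 + Rabs (offset i))
      (growth A)); auto.
    intros n; unfold speed_coef, cauchy_table.
    eapply Rle_trans; [apply Rabs_triang|].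
    assert (Q := Rabs_triang (cauchy_coef (u x) I1 n 0) (cauchy_coef (u x) I2 n 0)).
    assert (Q1 := Hb I1 O n); assert (Q2 := Hb I2 O n).
    assert (Q3 := Ho n); unfold o in Q3.
    replace (match n with O => offset i | S _ => 0 end)
      with (match n with O => match O with O => offset i | S _ => 0 end | S _ => 0 end)
      in Q3 by (now destruct n).
    lra.
  - apply (CV_radius_geometric _ (family_bound A 0 1) (growth A)); auto.
Qed.

(** * Solutions with prescribed jets *)

Lemma is_derive_shift (f : R -> R) x a d :
  is_derive f (x - a) d -> is_derive (fun s => f (s - a)) x d.
Proof.
  intros H; replace d with (scal 1 d) by (unfold scal; simpl; unfold mult; simpl; ring).
  apply (is_derive_comp f (fun s => s - a)); auto.
  auto_derive; auto; ring.
Qed.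

Definition translate (f : R -> R -> R) (t0 x0 : R) : jet -> R :=
  fun z => f (z ct - t0) (z cx - x0).

(** The scalar [c] makes the multiples of the [cauchy_family] functions closed under
    differentiation; a vanishing derivative is written as a zero multiple to stay in that form. *)
Definition family_pd (u : R -> dep -> nat -> R) (t0 x0 c : R) (i : dep) (k l : nat)
    (a : coord) : jet -> R :=
  match a with
  | ct => fun z => c * INR (S k) * translate (cauchy_family u i (S k) l) t0 x0 z
  | cx => fun z => c * INR (S l) * translate (cauchy_family u i k (S l)) t0 x0 z
  | _ => fun z => 0 * translate (cauchy_family u i k l) t0 x0 z
  end.

Lemma cauchy_family_pd u A t0 x0 c i k l a z :
  (forall i, taylor_fam (fun x => Rabs x < 1) (fun l x => u x i l)) ->
  data_bound u A -> Rabs (z cx - x0) < 1 -> Rabs (z ct - t0) <= / (2 * growth A) ->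
  is_pd a (fun z => c * translate (cauchy_family u i k l) t0 x0 z) z
    (family_pd u t0 x0 c i k l a z).
Proof.
  intros Hu HA Hx Ht; unfold is_pd, family_pd, translate; destruct a as [| |j m n].
  - rewrite Rmult_assoc.
    apply (is_derive_scal (fun s => cauchy_family u i k l (s - t0) (z cx - x0))).
    apply (is_derive_shift (fun t => cauchy_family u i k l t (z cx - x0))).
    now apply (cauchy_family_dt u A).
  - rewrite Rmult_assoc.
    apply (is_derive_scal (fun s => cauchy_family u i k l (z ct - t0) (s - x0))).
    apply (is_derive_shift (fun x => cauchy_family u i k l (z ct - t0) x)).
    now apply (cauchy_family_dx u A).
  - rewrite Rmult_0_l.
    apply (is_derive_const (c * cauchy_family u i k l (z ct - t0) (z cx - x0))).
Qed.

(** The multiples of the [cauchy_family] functions are closed under partial derivatives and all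
    bounded on the box, so continuity comes for free from [continuous_of_bounded_pd]. *)
Lemma cauchy_family_smooth u A t0 x0 i y e :
  (forall i, taylor_fam (fun x => Rabs x < 1) (fun l x => u x i l)) ->
  data_bound u A -> y ct = t0 -> y cx = x0 ->
  e <= / (2 * growth A) -> e <= 1 ->
  sm_on (box tx e y) (translate (cauchy_family u i 0 0) t0 x0).
Proof.
  intros Hu HA Ht Hx He1 He2.
  set (B := box tx e y).
  set (Fam := fun F : jet -> R => exists c i k l,
                F = fun z => c * translate (cauchy_family u i k l) t0 x0 z).
  assert (HB : forall z, B z -> Rabs (z cx - x0) < 1 /\ Rabs (z ct - t0) <= / (2 * growth A)).
  { intros z Hz; apply box_tx in Hz; rewrite Ht, Hx in Hz; lra. }
  assert (HA0 := data_bound_nonneg u A HA); assert (HG := growth_pos u A HA).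
  assert (Hb : forall F, Fam F -> exists K, 0 <= K /\ forall z, B z -> Rabs (F z) <= K).
  { intros F (c & j & k & l & ->); exists (Rabs c * (2 * family_bound A k l)); split.
    - apply Rmult_le_pos; [apply Rabs_pos|]; unfold family_bound.
      assert (P1 := pow_le 2 l ltac:(lra)); assert (P2 := pow_le (growth A) k ltac:(lra)).
      apply Rmult_le_pos; [lra|]; apply Rmult_le_pos; auto; now apply Rmult_le_pos.
    - intros z Hz; rewrite Rabs_mult; apply Rmult_le_compat_l; [apply Rabs_pos|].
      apply cauchy_family_bound; auto; now apply HB. }
  assert (Hpd : forall c j k l a, Fam (family_pd u t0 x0 c j k l a)).
  { intros c j k l [| |i' m n]; [exists (c * INR (S k)), j, (S k), l
                                |exists (c * INR (S l)), j, k, (S l)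
                                |exists 0, j, k, l]; reflexivity. }
  apply (sm_on_ext B (fun z => 1 * translate (cauchy_family u i 0 0) t0 x0 z)).
  { apply box_open. }
  { intros z _; ring. }
  apply (sm_on_coind B Fam); [apply box_open| | |now exists 1, i, O, O].
  - intros F (c & j & k & l & ->) z Hz.
    destruct (Hb _ (Hpd c j k l ct)) as (K1 & P1 & H1).
    destruct (Hb _ (Hpd c j k l cx)) as (K2 & P2 & H2).
    apply (continuous_of_bounded_pd tx e y _ (family_pd u t0 x0 c j k l) (K1 + K2) z);
      auto; [lra| | |].
    + intros z1 z2 _ _ H; unfold translate; rewrite !H; auto; unfold tx; simpl; auto.
    + intros a _ z' Hz'; apply (cauchy_family_pd u A); auto; apply HB; auto.
    + intros a Ha; generalize (near_box _ _ _ _ Hz); apply near_imp; intros z' Hz'.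
      destruct Ha as [<-|[<-|[]]].
      * assert (Q := H1 z' Hz'); lra.
      * assert (Q := H2 z' Hz'); lra.
  - intros F (c & j & k & l & ->) a; exists (family_pd u t0 x0 c j k l a); split; auto.
    intros z Hz; apply (cauchy_family_pd u A); auto; apply HB; auto.
Qed.

Lemma Derive_n_taylor_fam A x0 :
  taylor_fam (fun _ => True) A -> forall l x,
  Derive_n (fun x' => A O (x' - x0)) l x = INR (fact l) * A l (x - x0).
Proof.
  intros HA l; induction l as [|l IH]; intros x; [simpl; ring|].
  simpl Derive_n; rewrite (Derive_ext _ (fun y => INR (fact l) * A l (y - x0))) by auto.
  apply is_derive_unique.
  rewrite INR_fact_S, (Rmult_comm (INR (S l))), Rmult_assoc.
  apply (is_derive_scal (fun y => A l (y - x0))), is_derive_shift, HA, I.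
Qed.

Lemma cauchy_problem t0 x0 (c : dep -> nat -> R) N : exists r,
  solution r t0 x0 /\
  forall i l, (l <= N)%nat -> jet_of r t0 x0 (cu i 0 l) = INR (fact l) * c i l.
Proof.
  set (u := poly_coef c N).
  destruct (poly_coef_bound c N) as (A & HA); fold u in HA.
  assert (HA' : data_bound u A) by exact HA.
  assert (Hu : forall i, taylor_fam (fun x => Rabs x < 1) (fun l x => u x i l)).
  { intros i l x _; now apply poly_coef_family. }
  set (r := fun i t x => cauchy_family u i 0 0 (t - t0) (x - x0)).
  (* Half of the guaranteed radius of convergence in [t], and the interval on which the data are
     bounded in [x]. *)
  set (e := Rmin (/ (2 * growth A)) 1).
  assert (HG := growth_pos u A HA').
  assert (He : 0 < e).
  { apply Rmin_pos; [apply Rinv_0_lt_compat|]; lra. }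
  assert (He1 : e <= / (2 * growth A)) by apply Rmin_l.
  assert (He2 : e <= 1) by apply Rmin_r.
  exists r; split; [split|].
  - intros i; apply diff_fun_iff; exists tx, e; split; auto; split.
    + intros z z' _ _ H; rewrite !H; auto; unfold tx; simpl; auto.
    + apply (cauchy_family_smooth u A); auto.
  - exists (mkposreal e He); simpl; intros t x Ht Hx i.
    assert (D1 := cauchy_family_dt u A i 0 0 (t - t0) (x - x0) HA' ltac:(lra) ltac:(lra)).
    assert (D2 := cauchy_family_dx u A i 0 0 (t - t0) (x - x0) Hu HA' ltac:(lra) ltac:(lra)).
    change (INR 1) with 1 in D1, D2; rewrite Rmult_1_l in D1, D2.
    apply (is_derive_shift (fun t => cauchy_family u i 0 0 t (x - x0))) in D1.
    apply (is_derive_shift (fun x => cauchy_family u i 0 0 (t - t0) x)) in D2.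
    assert (E1 : jet_of r t x (cu i 1 0) = cauchy_family u i 1 0 (t - t0) (x - x0)).
    { exact (is_derive_unique _ _ _ D1). }
    assert (E2 : jet_of r t x (cu i 0 1) = cauchy_family u i 0 1 (t - t0) (x - x0)).
    { exact (is_derive_unique _ _ _ D2). }
    unfold equation; rewrite E1, E2.
    assert (E := cauchy_family_equation u A i (t - t0) (x - x0) HA' ltac:(lra) ltac:(lra)).
    rewrite <- E; f_equal; f_equal; destruct i; unfold speed, offset, r; simpl; ring.
  - intros i l Hl; simpl.
    rewrite (Derive_n_ext _ (fun x' => u (x' - x0) i O)).
    + rewrite (Derive_n_taylor_fam (fun l x => u x i l) x0 (poly_coef_family c N i)).
      rewrite Rminus_diag; unfold u; now rewrite poly_coef_0.
    + intros x; unfold r, cauchy_family; rewrite Rminus_diag, PSeries_0.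
      rewrite bin_0_r, Rmult_1_l; reflexivity.
Qed.

(** * Functions vanishing on solutions *)

Definition order (a : coord) : nat := match a with cu _ k l => (k + l)%nat | _ => O end.

Lemma order_bound (L : list coord) : exists N, forall a, In a L -> (order a <= N)%nat.
Proof.
  destruct (bounded_coords L) as (n & Hn); exists (n + n)%nat; intros a Ha.
  specialize (Hn a Ha); destruct a; simpl in *; lia.
Qed.

Lemma evolve_solution_jet z N : exists r,
  solution r (z ct) (z cx) /\
  forall a, (order a <= N)%nat -> jet_of r (z ct) (z cx) a = evolve z a.
Proof.
  destruct (cauchy_problem (z ct) (z cx) (x_coefs z) N) as (r & Hr & Hj).
  exists r; split; auto; intros a Ha.
  rewrite <- (solution_evolve r _ _ Hr).
  apply (evolve_ext _ _ N); auto.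
  - intros i l Hl; rewrite Hj by auto; unfold x_coefs; field; apply INR_fact_neq_0.
  - destruct a; simpl in *; auto.
Qed.

Lemma vanishes_on_evolve z0 F :
  evolve z0 = z0 -> locally_dep z0 F -> vanishes_on_solutions z0 F ->
  near z0 (fun z => F (evolve z) = 0).
Proof.
  intros Hz0 (L & e & He & Hdep) (L' & e' & He' & Hv).
  destruct (order_bound (L ++ L')) as (N & HN).
  assert (Hn : near z0 (fun z => box (L ++ L') (Rmin e e') z0 (evolve z))).
  { apply (near_map evolve z0 (box (L ++ L') (Rmin e e') z0)).
    - intros a; apply evolve_continuous.
    - rewrite Hz0; apply near_box0; now apply Rmin_pos. }
  revert Hn; apply near_imp; intros z Hz.
  (* [N] bounds the orders of all coordinates that either box or [F] looks at, so the solution jet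
     obtained here can stand in for [evolve z]. *)
  destruct (evolve_solution_jet z N) as (r & Hr & Hj).
  set (y := jet_of r (z ct) (z cx)) in *.
  assert (Hy : box (L ++ L') (Rmin e e') z0 y).
  { intros a Ha; rewrite Hj by auto; now apply Hz. }
  rewrite <- (Hdep y (evolve z)).
  - apply (Hv y) with (r := r) (t := z ct) (x := z cx); auto.
    eapply box_incl; [apply incl_appr, incl_refl|apply Rmin_r|exact Hy].
  - eapply box_incl; [apply incl_appl, incl_refl|apply Rmin_l|exact Hy].
  - eapply box_incl; [apply incl_appl, incl_refl|apply Rmin_l|exact Hz].
  - intros a Ha; apply Hj, HN, in_or_app; auto.
Qed.

Lemma vanishes_of_evolve z0 F :
  near z0 (fun z => evolve z = z -> F z = 0) -> vanishes_on_solutions z0 F.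
Proof.
  apply near_imp; intros z Hz r t x Hr ->; apply Hz; now apply solution_evolve.
Qed.

(** Jets of solutions are fixed by [evolve]. A coordinate that [evolve] changes at [z0] is, by
    continuity, still changed at all nearby jets, so the claim is vacuous there. *)
Lemma vanishes_off_evolve z0 F : evolve z0 <> z0 -> vanishes_on_solutions z0 F.
Proof.
  intros H; apply vanishes_of_evolve.
  assert (Ha : exists a, evolve z0 a <> z0 a).
  { apply not_all_ex_not; intros Ha; apply H.
    now apply functional_extensionality. }
  destruct Ha as (a & Ha).
  assert (Hc : jet_continuous_at (fun z => evolve z a + (-1) * z a) z0).
  { apply jet_continuous_plus; [apply evolve_continuous|].
    apply jet_continuous_mult; [apply jet_continuous_const|apply jet_continuous_coord]. }
  assert (Hp : 0 < Rabs (evolve z0 a + (-1) * z0 a)) by (apply Rabs_pos_lt; lra).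
  generalize (Hc _ Hp); apply near_imp; intros z Hz Hez; exfalso.
  rewrite Hez in Hz; replace (z a + -1 * z a) with 0 in Hz by ring.
  rewrite Rminus_0_l, Rabs_Ropp in Hz; lra.
Qed.

(** By the chain rule, total derivatives become ordinary derivatives along the jets of a solution.
    This transfers equalities on solutions to total derivatives. *)
Lemma D_solution z0 F : diff_fun z0 F -> near z0 (fun z => forall r t x,
  solution r t x -> z = jet_of r t x ->
  is_derive (fun t' => F (jet_of r t' x)) t (Dt F z) /\
  is_derive (fun x' => F (jet_of r t x')) x (Dx F z)).
Proof.
  intros HF; apply diff_fun_iff in HF; destruct HF as (L & e & He & HF).
  exists L, e; split; auto; intros z Hz r t x Hr ->.
  destruct (solution_rect r t x Hr) as (d & Hd & Hdr & _).
  assert (HD := solution_derive r t x d Hdr t x).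
  rewrite !Rminus_diag, Rabs_R0 in HD; specialize (HD Hd Hd).
  rewrite (Dt_diff_on L e z0), (Dx_diff_on L e z0) by auto; split.
  - apply (diff_on_chain L e z0 F (fun t' => jet_of r t' x)); auto.
    intros [| |i k l] _; [apply (is_derive_id t)|apply (is_derive_const x)|apply HD].
  - apply (diff_on_chain L e z0 F (fun x' => jet_of r t x')); auto.
    intros [| |i k l] _; [apply (is_derive_const t)|apply (is_derive_id x)|apply HD].
Qed.

Lemma solution_curve r t x (P : jet -> Prop) :
  solution r t x -> near (jet_of r t x) P ->
  locally t (fun t' => P (jet_of r t' x) /\ solution r t' x) /\
  locally x (fun x' => P (jet_of r t x') /\ solution r t x').
Proof.
  intros Hr HP.
  destruct (solution_rect r t x Hr) as (d & Hd & Hdr & Heq).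
  assert (HD := solution_derive r t x d Hdr t x).
  rewrite !Rminus_diag, Rabs_R0 in HD; specialize (HD Hd Hd).
  assert (Hs : forall t' x', Rabs (t' - t) < d -> Rabs (x' - x) < d -> solution r t' x').
  { intros t' x' Ht Hx; split.
    - intros i; destruct (Hdr i) as [_ Hsm].
      assert (Hn : near (jet_of r t' x') (box tx d (jet_of r t x))).
      { apply near_box, box_tx; auto. }
      destruct Hn as (L & e & He & Hn).
      apply diff_fun_iff; exists (tx ++ L), e; split; auto; split.
      + intros z z' _ _ H; rewrite !H; auto; apply in_or_app; left; unfold tx; simpl; auto.
      + eapply sm_on_sub; [|exact Hsm]; intros z Hz; apply Hn.
        eapply box_incl; [apply incl_appr, incl_refl|apply Rle_refl|exact Hz].
    - assert (Hm : 0 < Rmin (d - Rabs (t' - t)) (d - Rabs (x' - x))) by (apply Rmin_pos; lra).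
      exists (mkposreal _ Hm); simpl; intros t1 x1 H1 H2 i.
      assert (M1 := Rmin_l (d - Rabs (t' - t)) (d - Rabs (x' - x))).
      assert (M2 := Rmin_r (d - Rabs (t' - t)) (d - Rabs (x' - x))).
      assert (T1 := Rabs_triang (t1 - t') (t' - t)).
      assert (T2 := Rabs_triang (x1 - x') (x' - x)).
      replace (t1 - t' + (t' - t)) with (t1 - t) in T1 by ring.
      replace (x1 - x' + (x' - x)) with (x1 - x) in T2 by ring.
      apply Heq; lra. }
  split; apply filter_and.
  - apply (near_curve (fun t' => jet_of r t' x)); auto.
    intros [| |i k l]; [apply continuous_id|apply continuous_const|].
    apply (ex_derive_continuous (fun t' => jet_of r t' x (cu i k l))).
    eexists; apply HD.
  - exists (mkposreal d Hd); intros t' Ht; apply Hs; [exact Ht|].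
    now rewrite Rminus_diag, Rabs_R0.
  - apply (near_curve (fun x' => jet_of r t x')); auto.
    intros [| |i k l]; [apply continuous_const|apply continuous_id|].
    apply (ex_derive_continuous (fun x' => jet_of r t x' (cu i k l))).
    eexists; apply HD.
  - exists (mkposreal d Hd); intros x' Hx; apply Hs; [|exact Hx].
    now rewrite Rminus_diag, Rabs_R0.
Qed.

Lemma D_vanishes z0 F :
  diff_fun z0 F -> vanishes_on_solutions z0 F ->
  vanishes_on_solutions z0 (Dt F) /\ vanishes_on_solutions z0 (Dx F).
Proof.
  intros HF Hv.
  assert (H := near_and (D_solution z0 F HF) (near_open _ _ Hv)).
  assert (H' : near z0 (fun z => forall r t x, solution r t x -> z = jet_of r t x ->
                 Dt F z = 0 /\ Dx F z = 0)).
  { revert H; apply near_imp; intros z [H1 H2] r t x Hr Hz.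
    destruct (H1 r t x Hr Hz) as [D1 D2]; subst z.
    destruct (solution_curve r t x _ Hr H2) as [C1 C2].
    split.
    - rewrite <- (is_derive_unique _ _ _ D1).
      rewrite (Derive_ext_loc _ (fun _ => 0)); [apply Derive_const|].
      revert C1; apply filter_imp; intros t' [K1 K2]; eapply K1; eauto.
    - rewrite <- (is_derive_unique _ _ _ D2).
      rewrite (Derive_ext_loc _ (fun _ => 0)); [apply Derive_const|].
      revert C2; apply filter_imp; intros x' [K1 K2]; eapply K1; eauto. }
  split; revert H'; apply near_imp; intros z Hz r t x Hr Hj;
    destruct (Hz r t x Hr Hj); auto.
Qed.

(** * Trivial currents and hydrodynamic fluxes *)

Lemma vanishes_ext z0 F G :
  near z0 (fun z => F z = G z) -> vanishes_on_solutions z0 F -> vanishes_on_solutions z0 G.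
Proof.
  intros H HF; generalize (near_and H HF); apply near_imp.
  intros z [H1 H2] r t x Hr Hz; rewrite <- H1; eauto.
Qed.

Lemma vanishes_lin z0 a b F G :
  vanishes_on_solutions z0 F -> vanishes_on_solutions z0 G ->
  vanishes_on_solutions z0 (fun z => a * F z + b * G z).
Proof.
  intros HF HG; generalize (near_and HF HG); apply near_imp.
  intros z [H1 H2] r t x Hr Hz; rewrite (H1 r t x), (H2 r t x) by auto; ring.
Qed.

Lemma vanishes_near z0 F : near z0 (fun z => F z = 0) -> vanishes_on_solutions z0 F.
Proof. apply near_imp; auto. Qed.

Lemma diff_pair_lin z0 a C b C' :
  diff_pair z0 C -> diff_pair z0 C' -> diff_pair z0 (lin_comb a C b C').
Proof.
  intros [H1 H2] [H3 H4]; split; simpl; apply diff_fun_plus; now apply diff_fun_scal.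
Qed.

Lemma divergence_lin z0 a C b C' : diff_pair z0 C -> diff_pair z0 C' ->
  near z0 (fun z => divergence (lin_comb a C b C') z
                    = a * divergence C z + b * divergence C' z).
Proof.
  intros [H1 H2] [H3 H4].
  generalize (near_and (D_lin z0 _ _ a b H1 H3) (D_lin z0 _ _ a b H2 H4)).
  apply near_imp; intros z [[E1 _] [_ E2]]; unfold divergence; simpl.
  rewrite E1, E2; ring.
Qed.

Lemma divergence_ext z0 C C' :
  near z0 (fun z => density C z = density C' z /\ flux C z = flux C' z) ->
  near z0 (fun z => divergence C z = divergence C' z).
Proof.
  intros H.
  assert (H1 : near z0 (fun z => density C z = density C' z))
    by (revert H; apply near_imp; tauto).
  assert (H2 : near z0 (fun z => flux C z = flux C' z))
    by (revert H; apply near_imp; tauto).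
  generalize (near_and (D_ext_near _ _ _ H1) (D_ext_near _ _ _ H2)).
  apply near_imp; intros z [[E1 _] [_ E2]]; unfold divergence; now rewrite E1, E2.
Qed.

Lemma null_divergence_zero z0 : null_divergence z0 (Current (fun _ => 0) (fun _ => 0)).
Proof.
  split; [split; apply diff_fun_const|].
  apply near_all; intros z; unfold divergence; simpl.
  assert (H : rdep (fun _ => 0)) by (intros y y' _ _ _; reflexivity).
  destruct (D_rdep _ z H) as [-> ->].
  unfold sum_dep; rewrite !(is_pd_unique (is_pd_const _ 0 z)); ring.
Qed.

Lemma trivial_of_vanishing z0 C : vanishing_pair z0 C -> trivial_current z0 C.
Proof.
  intros H; exists (Current (fun _ => 0) (fun _ => 0)), C.
  split; [apply null_divergence_zero|split; auto].
  apply near_all; intros z; simpl; split; ring.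
Qed.

Lemma trivial_divergence z0 C :
  trivial_current z0 C -> vanishes_on_solutions z0 (divergence C).
Proof.
  intros (N & V & [HN HN'] & (HV & HV1 & HV2) & HE).
  apply (vanishes_ext z0 (divergence (lin_comb 1 N 1 V))).
  { apply divergence_ext; revert HE; apply near_imp; intros z [E1 E2]; simpl.
    rewrite E1, E2; split; ring. }
  apply (vanishes_ext z0 (fun z => 1 * divergence N z + 1 * divergence V z)).
  { generalize (divergence_lin z0 1 N 1 V HN HV); apply near_imp; auto. }
  apply vanishes_lin; [now apply vanishes_near|].
  apply (vanishes_ext z0 (fun z => 1 * Dt (density V) z + 1 * Dx (flux V) z)).
  { apply near_all; intros z; unfold divergence; ring. }
  apply vanishes_lin; apply D_vanishes; auto; apply HV.
Qed.

Lemma trivial_plus z0 C1 C2 C :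
  trivial_current z0 C1 -> trivial_current z0 C2 ->
  near z0 (fun z => density C z = density C1 z + density C2 z /\
                    flux C z = flux C1 z + flux C2 z) ->
  trivial_current z0 C.
Proof.
  intros (N1 & V1 & [A1 A2] & (A3 & A4 & A5) & A6) (N2 & V2 & [B1 B2] & (B3 & B4 & B5) & B6) H.
  exists (lin_comb 1 N1 1 N2), (lin_comb 1 V1 1 V2); split; [split|split; [split; [|split]|]].
  - now apply diff_pair_lin.
  - generalize (near_and (divergence_lin z0 1 N1 1 N2 A1 B1) (near_and A2 B2)).
    apply near_imp; intros z (E & E1 & E2); rewrite E, E1, E2; ring.
  - now apply diff_pair_lin.
  - now apply vanishes_lin.
  - now apply vanishes_lin.
  - generalize (near_and H (near_and A6 B6)).
    apply near_imp; intros z ([E1 E2] & [E3 E4] & [E5 E6]); simpl.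
    rewrite E1, E2, E3, E4, E5, E6; split; ring.
Qed.

Lemma equivalent_trans z0 C C' C'' :
  equivalent z0 C C' -> equivalent z0 C' C'' -> equivalent z0 C C''.
Proof.
  intros H H'; apply (trivial_plus z0 _ _ _ H H').
  apply near_all; intros z; simpl; split; ring.
Qed.

Lemma equivalent_conserved z0 C C' :
  diff_pair z0 C -> conserved_current z0 C' -> equivalent z0 C C' -> conserved_current z0 C.
Proof.
  intros HC [HC' Hdiv] HE; split; auto.
  assert (Hd := diff_pair_lin z0 1 C (-1) C' HC HC').
  apply (vanishes_ext z0 (fun z => 1 * divergence (lin_comb 1 C (-1) C') z + 1 * divergence C' z)).
  - generalize (divergence_lin z0 1 C (-1) C' HC HC'); apply near_imp.
    intros z E; rewrite E; ring.
  - apply vanishes_lin; auto; now apply trivial_divergence.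
Qed.

Lemma equivalent_refl z0 C : diff_pair z0 C -> equivalent z0 C C.
Proof.
  intros H; apply trivial_of_vanishing; split; [now apply diff_pair_lin|].
  split; apply vanishes_near, near_all; intros z; simpl; ring.
Qed.

Lemma equivalent_off_evolve z0 C C' :
  evolve z0 <> z0 -> diff_pair z0 C -> diff_pair z0 C' -> equivalent z0 C C'.
Proof.
  intros H HC HC'; apply trivial_of_vanishing.
  split; [now apply diff_pair_lin|split; now apply vanishes_off_evolve].
Qed.

Lemma evolve_t z i : evolve z (cu i 1 0) = - (speed i z * z (cu i 0 1)%nat).
Proof.
  unfold evolve; rewrite cauchy_coef_S.
  unfold next_coef, PS_mult, speed_coef, cauchy_table; cbn [sum_f_R0 Nat.sub].
  rewrite !cauchy_coef_O; unfold x_coefs.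
  change (INR (fact 0)) with 1; change (INR (fact 1)) with 1; change (INR 1) with 1.
  replace (speed i z) with (z (rr I1) + z (rr I2) + offset i)
    by (destruct i; unfold speed, offset; ring).
  field.
Qed.

Lemma dep_pd L F a z z' :
  dep_on (fun _ => True) L F -> (forall b, In b L -> z b = z' b) -> pd a F z = pd a F z'.
Proof.
  intros H Hz; destruct (in_dec coord_eq_dec a L) as [Hi|Hi].
  - unfold pd; rewrite (Hz a Hi); apply Derive_ext; intros s; apply H; auto.
    intros b Hb; unfold upd; destruct (coord_eq_dec a b); auto.
  - now rewrite !(dep_pd_out L F a) by auto.
Qed.

(** [F] restricted to solutions, in the free coordinates [t], [x] and pure x-derivatives: the
    t-derivatives are eliminated, and the value at jets of solutions is unchanged. *)
Definition evolved (F : jet -> R) : jet -> R := fun z => F (evolve z).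

Lemma evolved_pd_t F i k l z : pd (cu i (S k) l) (evolved F) z = 0.
Proof.
  unfold pd, evolved.
  rewrite (Derive_ext _ (fun _ => F (evolve z))); [apply Derive_const|].
  intros s; f_equal; apply evolve_ext_all; intros; apply upd_other; congruence.
Qed.

(** [z] and [evolve z] share all the coordinates that [evolve] reads; with respect to the remaining
    ones, both derivatives vanish. *)
Lemma evolved_pd_evolve F a z : pd a (evolved F) (evolve z) = pd a (evolved F) z.
Proof.
  assert (E : (forall i k l, a <> cu i (S k) l) ->
              pd a (evolved F) (evolve z) = pd a (evolved F) z).
  { intros Ha; unfold pd, evolved.
    replace (evolve z a) with (z a).
    - apply Derive_ext; intros s; f_equal; apply evolve_ext_all;
        intros; unfold upd; destruct (coord_eq_dec a _); auto using evolve_x.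
    - destruct a as [| |i [|k] l]; auto; [symmetry; apply evolve_x|].
      now destruct (Ha i k l). }
  destruct a as [| |i [|k] l]; try (apply E; congruence).
  now rewrite !evolved_pd_t.
Qed.

Lemma Dx_evolved_evolve F z : Dx (evolved F) (evolve z) = Dx (evolved F) z.
Proof.
  unfold Dx, sum_dep; rewrite evolved_pd_evolve; rewrite_sums;
    apply Series_ext; intros [|k]; apply Series_ext; intros l;
    rewrite ?evolve_x, ?evolved_pd_evolve, ?evolved_pd_t; ring.
Qed.

Lemma diff_fun_evolved z0 F : evolve z0 = z0 -> diff_fun z0 F -> diff_fun z0 (evolved F).
Proof.
  intros Hz0 HF; apply (diff_fun_comp z0 F evolve).
  - now rewrite Hz0.
  - intros a; apply diff_fun_evolve.
Qed.

Lemma hydrodynamic_flux z0 C rho :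
  evolve z0 = z0 -> conserved_current z0 C -> rdep rho -> diff_fun z0 rho ->
  near z0 (fun z => density C z = rho z) ->
  near z0 (fun z =>
    pd cx (evolved (flux C)) z = 0 /\
    (forall i, pd (rr i) (evolved (flux C)) z = speed i z * pd (rr i) rho z) /\
    forall i l, pd (cu i 0 (S l)) (evolved (flux C)) z = 0).
Proof.
  intros Hz0 [[_ Hflux] Hdiv] Hrdep Hrho Hdens.
  set (G := evolved (flux C)).
  assert (HG : diff_fun z0 G) by now apply diff_fun_evolved.
  (* The flux and [G] coincide along a whole solution, not just at one jet. Their total
     x-derivatives are derivatives along the solution, hence coincide as well. *)
  assert (HvA : vanishes_on_solutions z0 (fun z => Dt rho z + Dx G z)).
  { generalize (near_and Hdiv (near_and (D_ext_near _ _ _ Hdens)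
      (near_and (D_solution z0 _ Hflux) (D_solution z0 G HG)))).
    apply near_imp; intros z (H1 & [H2 _] & H3 & H4) r t x Hr Hz.
    rewrite <- (H1 r t x Hr Hz); unfold divergence; rewrite H2; f_equal.
    destruct (H3 r t x Hr Hz) as [_ D3]; destruct (H4 r t x Hr Hz) as [_ D4].
    rewrite <- (is_derive_unique _ _ _ D3), <- (is_derive_unique _ _ _ D4).
    apply Derive_ext_loc.
    destruct (solution_curve r t x (fun _ => True) Hr (near_all _ _ (fun _ => I))) as [_ Hc].
    revert Hc; apply filter_imp; intros x' [_ Hs]; unfold G, evolved.
    now rewrite solution_evolve. }
  set (h := fun i z => speed i z * pd (rr i) rho z).
  assert (HK : near z0 (fun z => Dx G z = sum_dep (fun i => h i z * z (cu i 0 1)%nat))).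
  { assert (Hl : locally_dep z0 (fun z => Dt rho z + Dx G z)).
    { apply locally_dep_plus; now apply locally_dep_D. }
    generalize (vanishes_on_evolve z0 _ Hz0 Hl HvA); apply near_imp; intros z Hz.
    unfold G in Hz; rewrite Dx_evolved_evolve in Hz; fold G in Hz.
    rewrite (proj1 (D_rdep rho (evolve z) Hrdep)) in Hz.
    assert (E : forall i, pd (rr i) rho (evolve z) = pd (rr i) rho z).
    { intros i; apply (dep_pd _ _ _ _ _ Hrdep).
      intros b [<-|[<-|[<-|[]]]]; apply evolve_x. }
    unfold sum_dep in *; rewrite !E, !evolve_t in Hz; unfold h; lra. }
  destruct (diff_fun_near z0 G _ HG HK) as (L & e & He & HL & HB).
  set (B := box L e z0) in *.
  (* Vary the coordinate [a] of order [m + 1] in the identity [HK]. Since [G] is independent of [a],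
     all its partial derivatives stay fixed, and [a] enters [Dx G] only as the factor of the
     derivative by the coordinate of order [m]. On the right-hand side [a] occurs only if [m = 0],
     with factor [h i]. *)
  assert (Hstep : forall m,
    (forall z, B z -> forall i l, (m < l)%nat -> pd (cu i 0 l) G z = 0) ->
    forall z, B z -> forall i, pd (cu i 0 m) G z = if Nat.eqb m 0 then h i z else 0).
  { intros m Hm z Hz i.
    set (a := cu i 0 (S m)).
    assert (Hmove : forall y s, B y -> B (upd y a s) -> G (upd y a s) = G y).
    { intros y s Hy Hs; rewrite <- (upd_self y a) at 2.
      apply (pd_zero_const L e z0); auto; [now rewrite upd_self|].
      intros y' Hy'; rewrite <- (Hm y' Hy' i (S m)) by lia.
      apply (sm_on_is_pd B); auto; apply HL. }
    destruct (near_line z a B (near_box _ _ _ _ Hz)) as [d Hd].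
    set (s := z a + d / 2).
    assert (Hd0 := cond_pos d).
    assert (Hy : B (upd z a s)).
    { apply Hd; unfold ball; simpl; unfold AbsRing_ball, abs, minus, plus, opp, s; simpl.
      rewrite Rabs_right; lra. }
    set (y := upd z a s) in *.
    assert (Hpd : forall b, pd b G y = pd b G z).
    { intros b; destruct (coord_eq_dec a b) as [<-|Hab].
      - unfold a; now rewrite !Hm by (auto; lia).
      - unfold pd; replace (y b) with (z b) by (unfold y; now rewrite upd_other).
        apply Derive_ext_loc.
        assert (N1 := near_line z b B (near_box _ _ _ _ Hz)).
        assert (N2 := near_line y b B (near_box _ _ _ _ Hy)).
        replace (y b) with (z b) in N2 by (unfold y; now rewrite upd_other).
        generalize (filter_and _ _ N1 N2); apply filter_imp; intros s1 [S1 S2].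
        unfold y in *; rewrite upd_comm in S2 |- * by auto; now apply Hmove. }
    assert (E1 := HB z Hz); assert (E2 := HB y Hy).
    rewrite (Dx_diff_on L e z0 G) in E1, E2 by auto.
    assert (E3 : lsum L (fun b => pd b G y * shift_x y b)
                 = lsum L (fun b => pd b G z * shift_x z b) + pd (cu i 0 m) G z * (d / 2)).
    { transitivity (lsum L (fun b => pd b G z * shift_x z b
                      + pd b G z * (shift_x y b - shift_x z b))).
      - apply lsum_ext; intros b _; rewrite Hpd; ring.
      - rewrite lsum_plus; f_equal.
        assert (Hsh : forall b, b <> cu i 0 m -> shift_x y b - shift_x z b = 0).
        { intros b Hb; destruct b as [| |j k l]; simpl; try ring.
          unfold y; rewrite upd_other; [ring|unfold a; congruence]. }
        assert (Hsh' : shift_x y (cu i 0 m) - shift_x z (cu i 0 m) = d / 2).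
        { simpl; unfold y, a; rewrite upd_same; unfold s, a; ring. }
        destruct (in_dec coord_eq_dec (cu i 0 m) L) as [Hi|Hi].
        + rewrite (lsum_single L _ (cu i 0 m)); auto.
          * now rewrite Hsh'.
          * intros b _ Hb; rewrite Hsh by auto; ring.
        + rewrite (diff_on_pd_out L e z0 G (cu i 0 m)) by auto.
          rewrite lsum_zero; [ring|].
          intros b Hb; rewrite Hsh; [ring|congruence]. }
    assert (Eh : forall j, h j y = h j z).
    { intros j; unfold h; f_equal.
      - unfold speed, y; rewrite !upd_other by (unfold a; congruence); reflexivity.
      - apply (dep_pd _ _ _ _ _ Hrdep).
        intros b [<-|[<-|[<-|[]]]]; unfold y; rewrite upd_other; auto; unfold a; congruence. }
    rewrite E3 in E2; unfold sum_dep in E1, E2; rewrite !Eh in E2.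
    assert (Hd2 : d / 2 <> 0) by lra.
    apply Rmult_eq_reg_r with (d / 2); auto.
    destruct m as [|m]; simpl Nat.eqb; cbv iota.
    - assert (Ey : forall j, y (cu j 0 1)%nat = z (cu j 0 1)%nat + if coord_eq_dec (rr i) (rr j) then d / 2 else 0).
      { intros j; unfold y, upd, a, s.
        destruct (coord_eq_dec (cu i 0 1) (cu j 0 1)) as [E|E],
          (coord_eq_dec (rr i) (rr j)) as [E'|E']; try congruence.
        - inversion E; subst; reflexivity.
        - ring. }
      rewrite !Ey in E2.
      destruct i; simpl in E2; lra.
    - assert (Ey : forall j, y (cu j 0 1)%nat = z (cu j 0 1)%nat).
      { intros j; unfold y; rewrite upd_other; auto; unfold a; congruence. }
      rewrite !Ey in E2; lra. }
  destruct (bounded_coords L) as (n & Hn).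
  assert (Hdown : forall k m, (n <= m + k)%nat -> forall z, B z -> forall i l, (m < l)%nat ->
             pd (cu i 0 l) G z = 0).
  { induction k as [|k IH]; intros m Hmk z Hz i l Hl.
    - apply (diff_on_pd_out L e z0); auto; intros Hi; destruct (Hn _ Hi); lia.
    - destruct (Nat.eq_dec l (S m)) as [->|Hne].
      + rewrite (Hstep (S m)); auto. intros; apply (IH (S m)); auto; lia.
      + apply (IH (S m)); auto; lia. }
  assert (Hall : forall z, B z -> forall i l, (0 < l)%nat -> pd (cu i 0 l) G z = 0)
    by (apply (Hdown n); lia).
  exists L, e; split; auto; intros z Hz; fold B in Hz.
  assert (Hr : forall i, pd (rr i) G z = h i z) by (intros i; now apply (Hstep O Hall)).
  split; [|split; [exact Hr|intros i l; apply Hall; auto; lia]].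
  assert (E := HB z Hz).
  (* These are the coordinates on which [G] may still depend; [ct] has coefficient 0 in [Dx]. The
     terms with [h i] cancel against [HK] and leave the derivative by [x], which must be 0. *)
  rewrite (Dx_lsum (cx :: rr I1 :: rr I2 :: rr I3 :: ct :: nil)) in E.
  - unfold lsum in E.
    repeat match type of E with context [in_dec ?d ?a ?l] =>
      destruct (in_dec d a l) as [Hi|_]; [simpl in Hi; intuition congruence|] end.
    rewrite !Hr in E; unfold sum_dep in E; simpl in E; lra.
  - intros [| |i [|k] [|l]] Ha; try (destruct Ha; simpl; tauto).
    + destruct Ha; destruct i; simpl; auto.
    + apply Hall; auto; lia.
    + apply evolved_pd_t.
    + apply evolved_pd_t.
Qed.

(** With zero density all derivatives of the evolved flux vanish except the one by [t], so on
    solutions the flux is a function [c] of [t]. The pair [(0, c)] is a null divergence, and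
    subtracting it leaves a pair that vanishes on solutions. *)
Lemma trivial_of_density_zero z0 C :
  evolve z0 = z0 -> conserved_current z0 C -> near z0 (fun z => density C z = 0) ->
  trivial_current z0 C.
Proof.
  intros Hz0 HC Hd.
  assert (HG : diff_fun z0 (evolved (flux C))).
  { apply diff_fun_evolved; auto; apply HC. }
  assert (H := hydrodynamic_flux z0 C (fun _ => 0) Hz0 HC
    (fun _ _ _ _ _ => eq_refl) (diff_fun_const z0 0) Hd).
  set (G := evolved (flux C)) in *.
  set (c := fun z : jet => G (upd z0 ct (z ct))).
  assert (Hc : diff_fun z0 c).
  { apply (diff_fun_comp z0 G (fun z => upd z0 ct (z ct))).
    - now rewrite upd_self.
    - intros a; unfold upd; destruct (coord_eq_dec ct a);
        [apply diff_fun_coord|apply diff_fun_const]. }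
  assert (Hconst : near z0 (fun z => G z = c z)).
  { destruct (diff_fun_near z0 G _ HG H) as (L & e & He & HL & HB).
    exists L, e; split; auto; intros z Hz; unfold c.
    set (y := upd z0 ct (z ct)).
    assert (Hy : box L e z0 y).
    { intros a Ha; unfold y, upd; destruct (coord_eq_dec ct a); [subst; now apply Hz|].
      now rewrite Rminus_diag, Rabs_R0. }
    (* The segment from [y] to [z] stays in the box by convexity. [y] and [z] have the same [t], and
       all other partial derivatives of [G] vanish, so [G] is constant along it. *)
    set (g := fun s (a : coord) => y a + s * (z a - y a)).
    assert (E1 : g 1 = z) by (apply functional_extensionality; intros a; unfold g; ring).
    assert (E0 : g 0 = y) by (apply functional_extensionality; intros a; unfold g; ring).
    rewrite <- E1, <- E0; symmetry.
    apply (eq_is_derive (fun s => G (g s)) 0 1); [|lra].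
    intros s Hs.
    assert (Hgs : box L e z0 (g s)).
    { intros a Ha; specialize (Hy a Ha); specialize (Hz a Ha); unfold g.
      apply Rle_lt_trans with (Rmax (Rabs (y a - z0 a)) (Rabs (z a - z0 a)));
        [|now apply Rmax_lub_lt].
      set (M := Rmax _ _).
      assert (M1 : Rabs (y a - z0 a) <= M) by apply Rmax_l.
      assert (M2 : Rabs (z a - z0 a) <= M) by apply Rmax_r.
      replace (y a + s * (z a - y a) - z0 a)
        with ((1 - s) * (y a - z0 a) + s * (z a - z0 a)) by ring.
      eapply Rle_trans; [apply Rabs_triang|].
      rewrite !Rabs_mult, (Rabs_right (1 - s)), (Rabs_right s) by lra; nra. }
    assert (Hch := diff_on_chain L e z0 G g s (fun a => z a - y a) HL Hgs).
    rewrite lsum_zero in Hch.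
    - apply Hch; intros a _; unfold g; auto_derive; auto; ring.
    - intros a _; destruct (HB _ Hgs) as (B1 & B2 & B3).
      destruct a as [| |i [|k] [|l]].
      + unfold y; rewrite upd_same; ring.
      + rewrite B1; ring.
      + rewrite B2, (is_pd_unique (is_pd_const _ 0 _)); ring.
      + rewrite B3; ring.
      + unfold G; rewrite evolved_pd_t; ring.
      + unfold G; rewrite evolved_pd_t; ring. }
  destruct HC as [[HC1 HC2] _].
  exists (Current (fun _ => 0) c), (Current (density C) (fun z => flux C z - c z)).
  split; [split; [split; [apply diff_fun_const|auto]|]|split; [split; [split|split]|]].
  - apply near_all; intros z; unfold divergence; simpl.
    assert (H0 : rdep (fun _ => 0)) by (intros y y' _ _ _; reflexivity).
    rewrite (proj1 (D_rdep _ z H0)).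
    rewrite (Dx_lsum (ct :: nil)).
    + unfold sum_dep; rewrite !(is_pd_unique (is_pd_const _ 0 z)); simpl; ring.
    + intros a; apply dep_pd_out.
      intros y y' _ _ Hyy; unfold c; rewrite Hyy; simpl; auto.
  - exact HC1.
  - now apply diff_fun_minus.
  - now apply vanishes_near.
  - apply vanishes_of_evolve; revert Hconst; apply near_imp; intros z Hz Hez; simpl.
    rewrite <- Hz; unfold G, evolved; rewrite Hez; ring.
  - apply near_all; intros z; simpl; split; ring.
Qed.

(** An exact condition on the chosen representative rather than on its class modulo trivial
    currents. It implies conservation and passes to linear combinations and symmetry images by
    direct computation, so it is the induction hypothesis for [span]. *)
Definition hydro_pair (z0 : jet) (C : current) : Prop :=
  rdep (density C) /\ rdep (flux C) /\ diff_pair z0 C /\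
  near z0 (fun z => forall i, pd (rr i) (flux C) z = speed i z * pd (rr i) (density C) z).

Lemma hydro_pair_conserved z0 C : hydro_pair z0 C -> conserved_current z0 C.
Proof.
  intros (H1 & H2 & H3 & H4); split; auto.
  apply vanishes_of_evolve; revert H4; apply near_imp; intros z Hz Hez.
  unfold divergence; rewrite (proj1 (D_rdep _ z H1)), (proj2 (D_rdep _ z H2)).
  unfold sum_dep; rewrite !Hz.
  assert (E : forall i, z (cu i 1 0)%nat = - (speed i z * z (cu i 0 1)%nat)).
  { intros i; rewrite <- evolve_t; now rewrite Hez. }
  rewrite !E; ring.
Qed.

Lemma hydro_pair_hydrodynamic z0 C : hydro_pair z0 C -> hydrodynamic z0 C.
Proof.
  intros H; assert (Hc := hydro_pair_conserved z0 C H).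
  split; auto; exists C; split; auto; split; [apply equivalent_refl, H|].
  exists (fun a b c => density C (fun q => match q with
    | cu I1 _ _ => a | cu I2 _ _ => b | cu I3 _ _ => c | _ => 0 end)).
  apply near_all; intros z; apply (proj1 H); auto.
  intros b [<-|[<-|[<-|[]]]]; reflexivity.
Qed.

(** * Symmetries and generators *)

Lemma jet_continuous_comp (f : R -> R) F z :
  continuous f (F z) -> jet_continuous_at F z -> jet_continuous_at (fun y => f (F y)) z.
Proof.
  intros Hf HF e He.
  destruct (Hf _ (locally_ball (f (F z)) (mkposreal e He))) as [d Hd].
  generalize (HF d (cond_pos d)); apply near_imp; intros y Hy; exact (Hd _ Hy).
Qed.

Lemma diff_fun_exp z0 F : diff_fun z0 F -> diff_fun z0 (fun z => exp (F z)).
Proof.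
  intros HF.
  apply (diff_fun_comp z0 (fun y => exp (y ct)) (fun z _ => F z)); auto.
  apply diff_fun_iff; exists (ct :: nil), 1; split; [lra|split].
  - intros y y' _ _ H; rewrite H; simpl; auto.
  - apply (sm_on_ext _ (fun y => 1 * exp (y ct))); [apply box_open|intros y _; ring|].
    apply (sm_on_coind _ (fun G => exists c, G = fun y => c * exp (y ct)));
      [apply box_open| | |now exists 1].
    + intros G [c ->] y _; apply jet_continuous_mult; [apply jet_continuous_const|].
      apply (jet_continuous_comp exp); [apply continuous_exp|apply jet_continuous_coord].
    + intros G [c ->] a; destruct (coord_eq_dec a ct) as [->|Ha].
      * exists (fun y => c * exp (y ct)); split; [now exists c|].
        intros y _; apply (is_derive_scal exp), is_derive_exp.
      * exists (fun y => 0 * exp (y ct)); split; [now exists 0|].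
        intros y _; rewrite Rmult_0_l.
        apply (is_derive_ext (fun _ => c * exp (y ct))); [|apply (is_derive_const (c * exp (y ct)))].
        intros s; now rewrite upd_other.
Qed.

Lemma is_pd_exp a F z d : is_pd a F z d -> is_pd a (fun y => exp (F y)) z (d * exp (F z)).
Proof.
  intros H; unfold is_pd.
  assert (E := is_derive_comp exp (fun s => F (upd z a s)) (z a) (exp (F z)) d).
  cbv beta in E; rewrite upd_self in E; apply E; [apply is_derive_exp|exact H].
Qed.

Lemma is_pd_minus a F G z d d' :
  is_pd a F z d -> is_pd a G z d' -> is_pd a (fun y => F y - G y) z (d - d').
Proof. intros H H'; exact (is_derive_minus _ _ _ _ _ H H'). Qed.

Lemma is_pd_eq {a F z d d'} : is_pd a F z d -> d = d' -> is_pd a F z d'.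
Proof. now intros H <-. Qed.

Definition delta (a b : coord) : R := if coord_eq_dec a b then 1 else 0.

Lemma hydro_pair_DHC z0 : hydro_pair z0 DHC.
Proof.
  assert (Hr : rdep (density DHC) /\ rdep (flux DHC)).
  { split; intros z z' _ _ H; simpl; rewrite !H; simpl; auto. }
  assert (Hd : diff_fun z0 (density DHC)).
  { apply (diff_fun_mult z0 (fun z => exp (z (rr I1) - z (rr I2))) (fun z => z (rr I3)));
      [|apply diff_fun_coord].
    apply (diff_fun_exp z0 (fun z => z (rr I1) - z (rr I2))).
    apply diff_fun_minus; apply diff_fun_coord. }
  split; [apply Hr|split; [apply Hr|split; [split; auto|]]].
  - apply (diff_fun_mult z0 (fun z => z (rr I1) + z (rr I2)) (density DHC)); auto.
    apply diff_fun_plus; apply diff_fun_coord.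
  - apply near_all; intros z i.
    assert (D : is_pd (rr i) (density DHC) z
       ((delta (rr i) (rr I1) - delta (rr i) (rr I2)) * exp (z (rr I1) - z (rr I2)) * z (rr I3)
        + exp (z (rr I1) - z (rr I2)) * delta (rr i) (rr I3))).
    { apply (is_pd_mult (rr i) (fun z => exp (z (rr I1) - z (rr I2))) (fun z => z (rr I3)));
        [|apply is_pd_coord].
      apply (is_pd_exp (rr i) (fun z => z (rr I1) - z (rr I2))).
      apply is_pd_minus; apply is_pd_coord. }
    assert (D' := is_pd_mult (rr i) (fun z => z (rr I1) + z (rr I2)) (density DHC) z _ _
      (is_pd_plus (rr i) _ _ z _ _ (is_pd_coord (rr i) (rr I1) z) (is_pd_coord (rr i) (rr I2) z)) D).
    etransitivity; [exact (is_pd_unique D')|].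
    rewrite (is_pd_unique D).
    destruct i; unfold delta, speed; simpl; ring.
Qed.

Lemma locally_2d_near z0 (Q : R -> R -> Prop) :
  locally_2d Q (z0 (rr I1)) (z0 (rr I2)) <-> near z0 (fun z => Q (z (rr I1)) (z (rr I2))).
Proof.
  split.
  - intros [d Hd].
    generalize (near_and (near_coord z0 (rr I1) d (cond_pos d))
                               (near_coord z0 (rr I2) d (cond_pos d))).
    apply near_imp; intros z [H1 H2]; auto.
  - intros (L & e & He & H); exists (mkposreal e He); simpl; intros a b Ha Hb.
    apply (H (upd (upd z0 (rr I1) a) (rr I2) b)).
    intros c _; unfold upd.
    destruct (coord_eq_dec (rr I2) c); subst; auto.
    destruct (coord_eq_dec (rr I1) c); subst; auto.
    now rewrite Rminus_diag, Rabs_R0.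
Qed.

Definition lift2 (Psi : R -> R -> R) : jet -> R := fun z => Psi (z (rr I1)) (z (rr I2)).

Lemma lift2_d1 Psi z : d1 Psi (z (rr I1)) (z (rr I2)) = pd (rr I1) (lift2 Psi) z.
Proof. reflexivity. Qed.

Lemma lift2_d2 Psi z : d2 Psi (z (rr I1)) (z (rr I2)) = pd (rr I2) (lift2 Psi) z.
Proof. reflexivity. Qed.

Lemma lift2_d2_d1 Psi z :
  d2 (d1 Psi) (z (rr I1)) (z (rr I2)) = pd (rr I2) (pd (rr I1) (lift2 Psi)) z.
Proof. reflexivity. Qed.

Definition rr12 : list coord := rr I1 :: rr I2 :: nil.

Lemma lift2_dep Psi : dep_on (fun _ => True) rr12 (lift2 Psi).
Proof. intros z z' _ _ H; unfold lift2; rewrite !H; simpl; auto. Qed.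

Lemma dep12_rdep F : dep_on (fun _ => True) rr12 F -> rdep F.
Proof. intros H z z' _ _ Hz; apply H; auto; intros b [<-|[<-|[]]]; apply Hz; simpl; auto. Qed.

Lemma dep_on_pd L F a : dep_on (fun _ => True) L F -> dep_on (fun _ => True) L (pd a F).
Proof. intros H z z' _ _; now apply dep_pd. Qed.

(** For [i = 1] and for [i = 2] alike, the difference of flux derivative and speed times density
    derivative is [Psi_1 - Psi_2 + 2 Psi_12], where 2 is the difference of the first two speeds. So
    both relations are the equation for [Psi]. *)
Lemma hydro_pair_EHC z0 Psi : smooth2 z0 Psi -> solves_Psi_eq z0 Psi -> hydro_pair z0 (EHC Psi).
Proof.
  intros Hs He; set (P := lift2 Psi).
  assert (HP : diff_fun z0 P) by exact Hs.
  set (P1 := pd (rr I1) P); set (P2 := pd (rr I2) P).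
  assert (HP1 : diff_fun z0 P1) by now apply diff_fun_pd.
  assert (HP2 : diff_fun z0 P2) by now apply diff_fun_pd.
  assert (Hdep1 : rdep P1) by apply dep12_rdep, dep_on_pd, lift2_dep.
  assert (Hdep2 : rdep P2) by apply dep12_rdep, dep_on_pd, lift2_dep.
  set (A := fun z : jet => z (rr I1) + z (rr I2) + 1).
  set (B := fun z : jet => z (rr I1) + z (rr I2) - 1).
  change (EHC Psi) with (Current (fun z => P1 z - P2 z) (fun z => A z * P1 z - B z * P2 z)).
  split; [|split; [|split; [split|]]]; simpl.
  - intros z z' Hz Hz' H; now rewrite (Hdep1 z z'), (Hdep2 z z').
  - intros z z' Hz Hz' H; rewrite (Hdep1 z z'), (Hdep2 z z') by auto.
    unfold A, B; rewrite !H; simpl; auto.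
  - now apply diff_fun_minus.
  - apply diff_fun_minus; apply diff_fun_mult; auto; unfold A, B.
    + repeat apply diff_fun_plus; try apply diff_fun_coord; apply diff_fun_const.
    + apply diff_fun_minus; [|apply diff_fun_const].
      apply diff_fun_plus; apply diff_fun_coord.
  - apply locally_2d_near in He.
    destruct (diff_fun_near z0 P _ HP He) as (L & e & He0 & [_ Hsm] & HB).
    exists L, e; split; auto; intros z Hz i.
    specialize (HB z Hz); simpl in HB.
    rewrite lift2_d2_d1, lift2_d1, lift2_d2 in HB; fold P in HB; fold P1 in HB; fold P2 in HB.
    assert (Hc : pd (rr I1) P2 z = pd (rr I2) P1 z).
    { apply (pd_comm (box L e z0)); auto using box_open. }
    assert (D1 : is_pd (rr i) P1 z (pd (rr i) P1 z)).
    { apply (sm_on_is_pd (box L e z0)); auto; now apply sm_on_pd. }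
    assert (D2 : is_pd (rr i) P2 z (pd (rr i) P2 z)).
    { apply (sm_on_is_pd (box L e z0)); auto; now apply sm_on_pd. }
    set (dr := delta (rr i) (rr I1) + delta (rr i) (rr I2)).
    assert (DA : is_pd (rr i) A z (dr + 0)).
    { apply (is_pd_plus (rr i) (fun z => z (rr I1) + z (rr I2)) (fun _ => 1));
        [|apply is_pd_const].
      apply is_pd_plus; apply is_pd_coord. }
    assert (DB : is_pd (rr i) B z (dr - 0)).
    { apply (is_pd_minus (rr i) (fun z => z (rr I1) + z (rr I2)) (fun _ => 1));
        [|apply is_pd_const].
      apply is_pd_plus; apply is_pd_coord. }
    rewrite (is_pd_unique (is_pd_minus _ _ _ _ _ _ D1 D2)).
    rewrite (is_pd_unique (is_pd_minus _ _ _ _ _ _ (is_pd_mult _ _ _ _ _ _ DA D1)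
                                                            (is_pd_mult _ _ _ _ _ _ DB D2))).
    assert (Z1 : pd (rr I3) P1 z = 0).
    { apply (dep_pd_out rr12); [apply dep_on_pd, lift2_dep|].
      intros [H|[H|[]]]; congruence. }
    assert (Z2 : pd (rr I3) P2 z = 0).
    { apply (dep_pd_out rr12); [apply dep_on_pd, lift2_dep|].
      intros [H|[H|[]]]; congruence. }
    unfold dr, delta, A, B, speed; destruct i; simpl.
    + rewrite Hc; lra.
    + lra.
    + rewrite Z1, Z2; ring.
Qed.

Lemma hydro_pair_generator z0 C : generator z0 C -> hydro_pair z0 C.
Proof. intros [|Psi H1 H2]; [apply hydro_pair_DHC|now apply hydro_pair_EHC]. Qed.

Lemma hydro_pair_lin z0 a C b C' :
  hydro_pair z0 C -> hydro_pair z0 C' -> hydro_pair z0 (lin_comb a C b C').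
Proof.
  intros (H1 & H2 & H3 & H4) (H1' & H2' & H3' & H4').
  split; [|split; [|split]].
  - intros z z' Hz Hz' H; simpl; now rewrite (H1 z z'), (H1' z z').
  - intros z z' Hz Hz' H; simpl; now rewrite (H2 z z'), (H2' z z').
  - now apply diff_pair_lin.
  - destruct H3 as [K1 K2], H3' as [K1' K2'].
    destruct (diff_fun_common_near z0 (density C :: density C' :: flux C :: flux C' :: nil)
      (fun z => (forall i, pd (rr i) (flux C) z = speed i z * pd (rr i) (density C) z) /\
                (forall i, pd (rr i) (flux C') z = speed i z * pd (rr i) (density C') z)))
      as (L & e & He & HL & HB).
    { intros F [<-|[<-|[<-|[<-|[]]]]]; auto. }
    { now apply near_and. }
    exists L, e; split; auto; intros z Hz i; simpl.
    destruct (HB z Hz) as [B1 B2].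
    assert (Hsm : forall F, In F (density C :: density C' :: flux C :: flux C' :: nil) ->
              sm_on (box L e z0) F) by (intros F HF; now apply HL).
    rewrite (pd_lin (box L e z0) (flux C) (flux C')) by (auto; apply Hsm; simpl; auto).
    rewrite (pd_lin (box L e z0) (density C) (density C')) by (auto; apply Hsm; simpl; auto).
    rewrite B1, B2; ring.
Qed.

(* The transformation prolonged to order zero only, which is all that matters for
   functions of the Riemann invariants. *)
Definition move_rr (g : transformation) (z0 : jet) (z : jet) : jet := fun a =>
  match a with cu i O O => new_r g i z | a => prolong g z0 a end.

Lemma hydro_pair_act z0 g C :
  point_symmetry z0 g -> hydro_pair (prolong g z0) C -> hydro_pair z0 (act g C).
Proof.
  intros (_ & HW & _) (H1 & H2 & [H3 H4] & H5).
  set (m := move_rr g z0).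
  (* The coordinates that [m] does not move are frozen at those of [prolong g z0], so the base point
     of the composition is the one at which the hypotheses on [C] hold. *)
  assert (Hm0 : m z0 = prolong g z0).
  { apply functional_extensionality; intros [| |i [|k] [|l]]; reflexivity. }
  assert (Hmr : forall z i, m z (rr i) = new_r g i z) by reflexivity.
  assert (Hm : forall a, diff_fun z0 (fun z => m z a)).
  { intros [| |i [|k] [|l]]; unfold m, move_rr; try apply diff_fun_const.
    destruct i; simpl.
    - apply diff_fun_plus; [apply diff_fun_coord|apply diff_fun_const].
    - apply diff_fun_plus; [apply diff_fun_coord|apply diff_fun_const].
    - exact HW. }
  assert (Hpr : forall F, rdep F -> forall z, F (prolong g z) = F (m z)).
  { intros F HF z; apply HF; auto; intros b [<-|[<-|[<-|[]]]]; reflexivity. }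
  assert (Hrd : forall F, rdep F -> rdep (fun z => F (m z))).
  { intros F HF z z' _ _ H; apply HF; auto.
    intros b [<-|[<-|[<-|[]]]]; simpl; rewrite H; simpl; auto. }
  set (C1 := Current (fun z => gT1 g * density C (m z))
                     (fun z => gT1 g * (flux C (m z) - gU0 g * density C (m z)))).
  replace (act g C) with C1.
  2: { unfold act, C1; f_equal; apply functional_extensionality; intros z;
       rewrite ?(Hpr (density C) H1), ?(Hpr (flux C) H2); reflexivity. }
  assert (Hdm : diff_fun z0 (fun z => density C (m z))).
  { apply diff_fun_comp; auto; now rewrite Hm0. }
  assert (Hfm : diff_fun z0 (fun z => flux C (m z))).
  { apply diff_fun_comp; auto; now rewrite Hm0. }
  split; [|split; [|split; [split|]]]; simpl.
  - intros z z' Hz Hz' H; now rewrite (Hrd _ H1 z z').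
  - intros z z' Hz Hz' H; now rewrite (Hrd _ H1 z z'), (Hrd _ H2 z z').
  - now apply diff_fun_scal.
  - apply diff_fun_scal, diff_fun_minus; auto; now apply diff_fun_scal.
  - destruct (diff_fun_near2 (prolong g z0) (density C) (flux C) _ H3 H4 H5)
      as (L & e & He & L1 & L2 & HB).
    assert (HWd : near z0 (fun z => ex_derive (gW g) (z (rr I3)))).
    { apply diff_fun_iff in HW; destruct HW as (M & d & Hd & _ & Hsm).
      exists M, d; split; auto; intros z Hz.
      eexists; exact (sm_on_is_pd _ _ z (rr I3) Hsm Hz). }
    assert (Hmn : near z0 (fun z => box L e (prolong g z0) (m z))).
    { apply (near_map m z0 (box L e (prolong g z0))).
      - intros a; now apply diff_fun_continuous.
      - rewrite Hm0; now apply near_box0. }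
    generalize (near_and HWd Hmn); apply near_imp; intros z [HWz Hz] i.
    assert (Hk : exists k, is_derive (fun s => new_r g i (upd z (rr i) s)) (z (rr i)) k).
    { destruct i; simpl.
      - exists 1; apply (is_derive_ext (fun s => s + (gU0 g + gV0 g) / 2)).
        + intros s; now rewrite upd_same.
        + auto_derive; auto; ring.
      - exists 1; apply (is_derive_ext (fun s => s + (gU0 g - gV0 g) / 2)).
        + intros s; now rewrite upd_same.
        + auto_derive; auto; ring.
      - destruct HWz as [k HWk]; exists k; apply (is_derive_ext (gW g));
          [intros s; now rewrite upd_same|exact HWk]. }
    destruct Hk as (k & Hk).
    assert (Hch : forall F, rdep F -> diff_on L e (prolong g z0) F ->
       is_pd (rr i) (fun z => F (m z)) z (k * pd (rr i) F (m z))).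
    { intros F Hrd' HF; unfold is_pd.
      assert (D := sm_on_is_pd _ F (m z) (rr i) (proj2 HF) Hz).
      apply (is_derive_ext (fun s => F (upd (m z) (rr i) (new_r g i (upd z (rr i) s))))).
      { intros s; apply Hrd'; auto.
        intros b [<-|[<-|[<-|[]]]]; destruct i; reflexivity. }
      apply (is_derive_comp (fun u => F (upd (m z) (rr i) u))
               (fun s => new_r g i (upd z (rr i) s))); auto.
      rewrite upd_self; exact D. }
    assert (D1 := Hch (density C) H1 L1); assert (D2 := Hch (flux C) H2 L2).
    assert (Dc := fun c => is_pd_const (rr i) c z).
    rewrite (is_pd_unique (is_pd_mult _ _ _ _ _ _ (Dc (gT1 g)) D1)).
    rewrite (is_pd_unique (is_pd_mult _ _ _ _ _ _ (Dc (gT1 g))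
       (is_pd_minus _ _ _ _ _ _ D2 (is_pd_mult _ _ _ _ _ _ (Dc (gU0 g)) D1)))).
    rewrite (HB (m z) Hz).
    (* A Galilean boost shifts every speed by [U0], which the term [- U0 * density] in the
       transformed flux compensates. *)
    replace (speed i (m z)) with (speed i z + gU0 g); [ring|].
    unfold speed; rewrite !Hmr; destruct i; simpl; lra.
Qed.

Lemma hydro_pair_span z C : span z C -> hydro_pair z C.
Proof.
  induction 1.
  - now apply hydro_pair_generator.
  - now apply hydro_pair_lin.
  - now apply hydro_pair_act.
Qed.

(** * Decomposition of hydrodynamic densities *)

Lemma between_close x0 e x y c :
  Rabs (x - x0) < e -> Rabs (y - x0) < e -> Rmin x y <= c <= Rmax x y -> Rabs (c - x0) < e.
Proof.
  intros Hx Hy Hc; apply Rabs_def2 in Hx; apply Rabs_def2 in Hy; apply Rabs_def1;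
    unfold Rmin, Rmax in Hc; destruct (Rle_dec x y); lra.
Qed.

(** [m] is the common mixed derivative that makes the form [p da + q db] closed; [Psi] integrates it
    first along [b = b0], then in [b]. Differentiating the second integral by [a] gives the integral
    of [m a], that is [p a b - p a b0], which completes [p a b0] to [p a b]. *)
Lemma potential_2d (p q m : R -> R -> R) a0 b0 e :
  0 < e ->
  (forall a b, Rabs (a - a0) < e -> Rabs (b - b0) < e ->
     is_derive (p a) b (m a b) /\ is_derive (fun a => q a b) a (m a b) /\
     ex_derive (fun a => p a b) a /\ ex_derive (q a) b /\ continuity_2d_pt m a b) ->
  let Psi a b := RInt (fun s => p s b0) a0 a + RInt (q a) b0 b in
  forall a b, Rabs (a - a0) < e -> Rabs (b - b0) < e ->
     is_derive (fun a => Psi a b) a (p a b) /\ is_derive (Psi a) b (q a b).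
Proof.
  intros He H Psi a b Ha Hb.
  assert (Ha0 : Rabs (a0 - a0) < e) by now rewrite Rminus_diag, Rabs_R0.
  assert (Hb0 : Rabs (b0 - b0) < e) by now rewrite Rminus_diag, Rabs_R0.
  assert (Cp : forall a, Rabs (a - a0) < e -> continuous (fun s => p s b0) a).
  { intros a' Ha'; apply (ex_derive_continuous (fun s => p s b0)).
    destruct (H a' b0 Ha' Hb0) as (_ & _ & E & _); exact E. }
  assert (Cq : forall a b, Rabs (a - a0) < e -> Rabs (b - b0) < e -> continuous (q a) b).
  { intros a' b' Ha' Hb'; apply (ex_derive_continuous (q a')).
    destruct (H a' b' Ha' Hb') as (_ & _ & _ & E & _); exact E. }
  assert (Hq : forall a b', Rabs (a - a0) < e -> Rabs (b' - b0) < e -> ex_RInt (q a) b0 b').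
  { intros a' b' Ha' Hb'; apply (ex_RInt_continuous (q a')); intros z Hz.
    apply Cq; auto; apply (between_close b0 e b0 b'); auto. }
  split.
  - unfold Psi; replace (p a b) with (p a b0 + (p a b - p a b0)) by ring.
    apply is_derive_Rplus.
    + apply (is_derive_RInt (fun s => p s b0) (RInt (fun s => p s b0) a0) a0 a).
      * generalize (interval_open a0 e a Ha); apply filter_imp; intros a' Ha'.
        apply (RInt_correct (fun s => p s b0)), (ex_RInt_continuous (fun s => p s b0)).
        intros z Hz; apply Cp, (between_close a0 e a0 a'); auto.
      * now apply Cp.
    + assert (Hbt : forall t, Rmin b0 b <= t <= Rmax b0 b -> Rabs (t - b0) < e).
      { intros t Ht; apply (between_close b0 e b0 b); auto. }
      assert (HD : RInt (fun t => Derive (fun u => q u t) a) b0 b = p a b - p a b0).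
      { rewrite (RInt_ext _ (m a)).
        - apply (is_RInt_unique (m a)), (is_RInt_derive (p a) (m a)).
          + intros t Ht; apply H; auto.
          + intros t Ht; apply continuity_pt_filterlim.
            assert (Hc : continuity_2d_pt m a t) by (apply H; auto).
            intros eps Heps; destruct (Hc (mkposreal eps Heps)) as [d Hd].
            exists d; split; [apply cond_pos|]; intros x [_ Hx].
            apply Hd; auto; rewrite Rminus_diag, Rabs_R0; apply cond_pos.
        - intros t Ht; apply is_derive_unique, H; auto; apply Hbt; lra. }
      rewrite <- HD; apply is_derive_RInt_param.
      * generalize (interval_open a0 e a Ha); apply filter_imp; intros a' Ha' t Ht.
        exists (m a' t); apply H; auto.
      * intros t Ht; assert (Hc : continuity_2d_pt m a t) by (apply H; auto).
        apply (continuity_2d_pt_ext_loc m); auto.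
        destruct (interval_open a0 e a Ha) as [d1 Hd1].
        destruct (interval_open b0 e t (Hbt t Ht)) as [d2 Hd2].
        exists (mkposreal _ (Rmin_stable_in_posreal d1 d2)); simpl; intros u v Hu Hv.
        symmetry; apply is_derive_unique, H.
        -- apply Hd1; eapply Rlt_le_trans; [exact Hu|apply Rmin_l].
        -- apply Hd2; eapply Rlt_le_trans; [exact Hv|apply Rmin_r].
      * generalize (interval_open a0 e a Ha); apply filter_imp; intros a' Ha'; auto.
  - unfold Psi; replace (q a b) with (0 + q a b) by ring.
    apply is_derive_Rplus; [apply (is_derive_const (RInt (fun s => p s b0) a0 a))|].
    apply (is_derive_RInt (q a) (RInt (q a) b0) b0 b).
    + generalize (interval_open b0 e b Hb); apply filter_imp; intros b' Hb'.
      apply (RInt_correct (q a)); auto.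
    + now apply Cq.
Qed.

(** For [M = rr12] this freezes [r^3] at its value in [z0], which is how the summand depending on
    [r^1, r^2] alone is extracted. *)
Definition restrict (M : list coord) (z0 : jet) (F : jet -> R) : jet -> R :=
  fun z => F (mix M z0 z).

Lemma diff_fun_restrict M z0 F : diff_fun z0 F -> diff_fun z0 (restrict M z0 F).
Proof.
  intros H; apply (diff_fun_comp z0 F (mix M z0)).
  - replace (mix M z0 z0) with z0; auto.
    apply functional_extensionality; intros a; unfold mix.
    now destruct (in_dec coord_eq_dec a M).
  - intros a; unfold mix; destruct (in_dec coord_eq_dec a M);
      [apply diff_fun_coord|apply diff_fun_const].
Qed.

Lemma dep_restrict M z0 F : dep_on (fun _ => True) M (restrict M z0 F).
Proof.
  intros z z' _ _ H; unfold restrict; f_equal; apply functional_extensionality.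
  intros a; unfold mix; destruct (in_dec coord_eq_dec a M); auto.
Qed.

Lemma pd_restrict M z0 F a z :
  In a M -> pd a (restrict M z0 F) z = pd a F (mix M z0 z).
Proof.
  intros Ha; unfold pd, restrict; rewrite mix_in by auto; apply Derive_ext; intros s.
  f_equal; apply functional_extensionality; intros b; unfold mix, upd.
  destruct (in_dec coord_eq_dec b M), (coord_eq_dec a b); subst; tauto.
Qed.

Definition jet12 (z0 : jet) (a b : R) : jet := upd (upd z0 (rr I1) a) (rr I2) b.

Lemma jet12_box e z0 a b :
  Rabs (a - z0 (rr I1)) < e -> Rabs (b - z0 (rr I2)) < e -> box rr12 e z0 (jet12 z0 a b).
Proof. intros Ha Hb c [<-|[<-|[]]]; assumption. Qed.

Lemma is_pd_speed i j z :
  is_pd (rr i) (speed j) z (match i with I3 => 0 | _ => 1 end).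
Proof.
  assert (D := is_pd_plus (rr i) _ _ z _ _ (is_pd_coord (rr i) (rr I1) z)
                                           (is_pd_coord (rr i) (rr I2) z)).
  unfold speed; destruct j.
  - refine (is_pd_eq (is_pd_plus _ _ _ _ _ _ D (is_pd_const _ 1 z)) _).
    destruct i; simpl; ring.
  - refine (is_pd_eq (is_pd_minus _ _ _ _ _ _ D (is_pd_const _ 1 z)) _).
    destruct i; simpl; ring.
  - refine (is_pd_eq D _); destruct i; simpl; ring.
Qed.

(* Solves [Psi_1 - Psi_2 = g], [(s + 1) Psi_1 - (s - 1) Psi_2 = S] with [s = r1 + r2]. *)
Lemma EHC_potential z0 g S :
  diff_fun z0 g -> diff_fun z0 S ->
  dep_on (fun _ => True) rr12 g -> dep_on (fun _ => True) rr12 S ->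
  near z0 (fun z => pd (rr I1) S z = speed I1 z * pd (rr I1) g z /\
                    pd (rr I2) S z = speed I2 z * pd (rr I2) g z) ->
  exists Psi, smooth2 z0 Psi /\ solves_Psi_eq z0 Psi /\
    near z0 (fun z => density (EHC Psi) z = g z).
Proof.
  intros Hg HS Hdg HdS Hrel.
  assert (Hspeed : forall i, dep_on (fun _ => True) rr12 (speed i)).
  { intros i z z' _ _ H; unfold speed; destruct i; rewrite !H; simpl; auto. }
  assert (Hspeed' : forall i, diff_fun z0 (speed i)).
  { intros [| |]; unfold speed.
    - apply diff_fun_plus; [apply diff_fun_plus; apply diff_fun_coord|apply diff_fun_const].
    - apply diff_fun_minus; [apply diff_fun_plus; apply diff_fun_coord|apply diff_fun_const].
    - apply diff_fun_plus; apply diff_fun_coord. }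
  (* The candidates for [Psi_1] and [Psi_2]; the linear system has determinant 2. *)
  set (p := fun z => / 2 * (S z - speed I2 z * g z)).
  set (q := fun z => / 2 * (S z - speed I1 z * g z)).
  assert (Hp : diff_fun z0 p).
  { apply diff_fun_scal, diff_fun_minus; auto; now apply diff_fun_mult. }
  assert (Hq : diff_fun z0 q).
  { apply diff_fun_scal, diff_fun_minus; auto; now apply diff_fun_mult. }
  assert (Hdp : dep_on (fun _ => True) rr12 p).
  { intros z z' Hz Hz' H; unfold p; now rewrite (Hdg z z'), (HdS z z'), (Hspeed I2 z z'). }
  assert (Hdq : dep_on (fun _ => True) rr12 q).
  { intros z z' Hz Hz' H; unfold q; now rewrite (Hdg z z'), (HdS z z'), (Hspeed I1 z z'). }
  destruct (diff_fun_dep_common z0 rr12 (g :: S :: p :: q :: nil)) as (e1 & E1 & D1).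
  { intros F [<-|[<-|[<-|[<-|[]]]]]; auto. }
  destruct Hrel as (L & e2 & E2 & Hrel).
  set (e := Rmin e1 e2).
  assert (He : 0 < e) by now apply Rmin_pos.
  assert (Le2 : e <= e2) by apply Rmin_r.
  set (B := box rr12 e z0).
  assert (HB : open_jets B) by apply box_open.
  assert (Hsm : forall F, In F (g :: S :: p :: q :: nil) -> sm_on B F).
  { intros F HF; apply (diff_on_incl rr12 rr12 e1 e z0 F (incl_refl _) (Rmin_l _ _) (D1 F HF)). }
  assert (Sg : sm_on B g) by (apply Hsm; simpl; auto).
  assert (SS : sm_on B S) by (apply Hsm; simpl; auto).
  assert (Sp : sm_on B p) by (apply Hsm; simpl; auto).
  assert (Sq : sm_on B q) by (apply Hsm; simpl; auto).
  (* [Hrel] holds on a box that may constrain further coordinates. All functions involved see only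
     [rr12], so the others can be reset to those of [z0]. *)
  assert (Hrel' : forall z, B z -> pd (rr I1) S z = speed I1 z * pd (rr I1) g z /\
                                  pd (rr I2) S z = speed I2 z * pd (rr I2) g z).
  { intros z Hz.
    assert (Hm : forall a, In a rr12 -> z a = mix rr12 z0 z a) by (intros; now rewrite mix_in).
    rewrite (dep_pd rr12 S _ z (mix rr12 z0 z)), (dep_pd rr12 S (rr I2) z (mix rr12 z0 z)),
      (dep_pd rr12 g _ z (mix rr12 z0 z)), (dep_pd rr12 g (rr I2) z (mix rr12 z0 z)),
      (Hspeed I1 z (mix rr12 z0 z)), (Hspeed I2 z (mix rr12 z0 z)) by auto.
    apply Hrel; intros a _; unfold mix; destruct (in_dec coord_eq_dec a rr12) as [Hi|Hi].
    - eapply Rlt_le_trans; [apply (Hz a Hi)|auto].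
    - now rewrite Rminus_diag, Rabs_R0. }
  assert (Dspeed : forall i j z, i <> I3 -> is_pd (rr i) (speed j) z 1).
  { intros i j z Hi; assert (D := is_pd_speed i j z); now destruct i. }
  (* The relations for [S] cancel the derivatives of [g], leaving [p_2 = q_1 = - g / 2]. Equality of
     the two is closedness; the common value, with [g = p - q], is the equation
     [2 Psi_12 = Psi_2 - Psi_1]. *)
  assert (Dp : forall z, B z -> is_pd (rr I2) p z (- / 2 * g z)).
  { intros z Hz; unfold p.
    refine (is_pd_eq (is_pd_mult _ _ _ _ _ _ (is_pd_const _ _ _)
      (is_pd_minus _ _ _ _ _ _ (sm_on_is_pd B S z _ SS Hz)
        (is_pd_mult _ _ _ _ _ _ (Dspeed I2 I2 z _) (sm_on_is_pd B g z _ Sg Hz)))) _);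
      [congruence|].
    rewrite (proj2 (Hrel' z Hz)); ring. }
  assert (Dq : forall z, B z -> is_pd (rr I1) q z (- / 2 * g z)).
  { intros z Hz; unfold q.
    refine (is_pd_eq (is_pd_mult _ _ _ _ _ _ (is_pd_const _ _ _)
      (is_pd_minus _ _ _ _ _ _ (sm_on_is_pd B S z _ SS Hz)
        (is_pd_mult _ _ _ _ _ _ (Dspeed I1 I1 z _) (sm_on_is_pd B g z _ Sg Hz)))) _);
      [congruence|].
    rewrite (proj1 (Hrel' z Hz)); ring. }
  set (J := jet12 z0).
  assert (HJ1 : forall F a b d, is_pd (rr I1) F (J a b) d -> is_derive (fun a => F (J a b)) a d).
  { intros F a b d HF; eapply is_derive_ext; [|exact HF].
    intros s; simpl; unfold J, jet12; f_equal.
    rewrite (upd_comm (upd z0 (rr I1) a) (rr I2) (rr I1)), upd_upd by congruence; reflexivity. }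
  assert (HJ2 : forall F a b d, is_pd (rr I2) F (J a b) d -> is_derive (fun b => F (J a b)) b d).
  { intros F a b d HF; eapply is_derive_ext; [|exact HF].
    intros s; simpl; unfold J, jet12; f_equal; now rewrite upd_upd. }
  assert (HPsi := potential_2d (fun a b => p (J a b)) (fun a b => q (J a b))
    (fun a b => - / 2 * g (J a b)) (z0 (rr I1)) (z0 (rr I2)) e He).
  cbv zeta in HPsi.
  set (Psi := fun a b => RInt (fun s => p (J s (z0 (rr I2)))) (z0 (rr I1)) a
                         + RInt (fun s => q (J a s)) (z0 (rr I2)) b).
  assert (HPsi' : forall a b, Rabs (a - z0 (rr I1)) < e -> Rabs (b - z0 (rr I2)) < e ->
     is_derive (fun a => Psi a b) a (p (J a b)) /\ is_derive (Psi a) b (q (J a b))).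
  { apply HPsi; intros a b Ha Hb.
    assert (HBJ : B (J a b)) by now apply jet12_box.
    split; [now apply HJ2, Dp|split; [now apply HJ1, Dq|split; [|split]]].
    - eexists; apply HJ1, (sm_on_is_pd B); auto.
    - eexists; apply HJ2, (sm_on_is_pd B); auto.
    - intros eps.
      assert (Hc := jet_continuous_mult _ _ _ (jet_continuous_const (- / 2) (J a b))
        (sm_on_continuous B g (J a b) Sg HBJ) eps (cond_pos eps)).
      destruct Hc as (L' & e' & He' & Hc).
      exists (mkposreal e' He'); simpl; intros u v Hu Hv; apply Hc.
      intros c _; unfold J, jet12, upd.
      destruct (coord_eq_dec (rr I2) c); auto.
      destruct (coord_eq_dec (rr I1) c); auto.
      now rewrite Rminus_diag, Rabs_R0. }
  clear HPsi.
  assert (HJz : forall z a, In a rr12 -> z a = J (z (rr I1)) (z (rr I2)) a)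
    by (intros z a [<-|[<-|[]]]; reflexivity).
  set (P := lift2 Psi).
  assert (DP1 : forall z, B z -> is_pd (rr I1) P z (p z)).
  { intros z Hz; rewrite (Hdp z (J (z (rr I1)) (z (rr I2)))) by auto.
    apply (HPsi' (z (rr I1)) (z (rr I2))); apply Hz; simpl; auto. }
  assert (DP2 : forall z, B z -> is_pd (rr I2) P z (q z)).
  { intros z Hz; rewrite (Hdq z (J (z (rr I1)) (z (rr I2)))) by auto.
    apply (HPsi' (z (rr I1)) (z (rr I2))); apply Hz; simpl; auto. }
  assert (HP : diff_on rr12 e z0 P).
  { apply (diff_fun_of_pd rr12 e z0 P (fun a => if coord_eq_dec a (rr I1) then p else q)); auto.
    - intros z z' _ _ H; now apply lift2_dep.
    - intros a [<-|[<-|[]]] z Hz; simpl; auto.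
    - intros a [<-|[<-|[]]]; simpl; auto. }
  exists Psi; split; [|split].
  - apply diff_fun_iff; exists rr12, e; auto.
  - apply locally_2d_near; exists rr12, e; split; auto; intros z Hz.
    rewrite lift2_d2_d1, lift2_d1, lift2_d2; fold P.
    rewrite (pd_ext (rr I2) (pd (rr I1) P) p).
    + rewrite (is_pd_unique (DP1 z Hz)), (is_pd_unique (DP2 z Hz)).
      rewrite (is_pd_unique (Dp z Hz)); unfold p, q, speed; field.
    + generalize (HB z Hz); apply near_imp; intros y Hy; now apply is_pd_unique, DP1.
  - exists rr12, e; split; auto; intros z Hz; simpl.
    rewrite lift2_d1, lift2_d2; fold P.
    rewrite (is_pd_unique (DP1 z Hz)), (is_pd_unique (DP2 z Hz)).
    unfold p, q, speed; field.
Qed.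

(* Compatibility of [G_i = V^i rho_i] forces [rho_13 = rho_3] and [rho_23 = - rho_3]. *)
Lemma density_decomposition z0 rho G :
  rdep rho -> diff_fun z0 rho -> diff_fun z0 G ->
  near z0 (fun z => forall i, pd (rr i) G z = speed i z * pd (rr i) rho z) ->
  exists W, diff_fun z0 (fun z => W (z (rr I3))) /\
    near z0 (fun z => rho z = exp (z (rr I1) - z (rr I2)) * W (z (rr I3))
                              + restrict rr12 z0 rho z).
Proof.
  intros Hr Hrho HG Hrel.
  set (c0 := z0 (rr I3)).
  (* The function [Phi] below at the base values of [r^1] and [r^2], where its value depends on
     [r^3] alone. *)
  set (W := fun c => exp (z0 (rr I2) - z0 (rr I1)) * (rho (upd z0 (rr I3) c) - rho z0)).
  exists W; split.
  { apply diff_fun_scal, diff_fun_minus; [|apply diff_fun_const].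
    apply (diff_fun_comp z0 rho (fun z => upd z0 (rr I3) (z (rr I3)))).
    - now rewrite upd_self.
    - intros a; unfold upd; destruct (coord_eq_dec (rr I3) a);
        [apply diff_fun_coord|apply diff_fun_const]. }
  destruct (diff_fun_near2 z0 rho G _ Hrho HG Hrel) as (L & e & He & [_ Srho] & [_ SG] & HB).
  set (B := box L e z0) in *.
  assert (Hop : open_jets B) by apply box_open.
  assert (Dsp3 : forall i z, i <> I3 -> is_pd (rr i) (speed I3) z 1).
  { intros i z Hi; assert (D := is_pd_speed i I3 z); now destruct i. }
  (* Equality of [G_i3] and [G_3i]: differentiating the i-th speed by [r^3] gives 0, differentiating
     the third speed by [r^i] gives 1. The speeds differ by 1 or -1, which yields the sign
     [sg i]. *)
  assert (Hmix : forall i z, i <> I3 -> B z ->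
     speed i z * pd (rr I3) (pd (rr i) rho) z
     = pd (rr I3) rho z + speed I3 z * pd (rr I3) (pd (rr i) rho) z).
  { intros i z Hi Hz.
    assert (Hc := pd_comm B G (rr I3) (rr i) z Hop SG Hz).
    assert (Hn : forall j, near z (fun y => pd (rr j) G y = speed j y * pd (rr j) rho y)).
    { intros j; generalize (Hop z Hz); apply near_imp; intros y Hy; now apply HB. }
    rewrite (pd_ext _ _ _ z (Hn i)), (pd_ext _ _ _ z (Hn I3)) in Hc.
    rewrite (is_pd_unique (is_pd_mult _ _ _ _ _ _ (is_pd_speed I3 i z)
      (sm_on_is_pd B _ z (rr I3) (sm_on_pd B rho (rr i) Srho) Hz))) in Hc.
    rewrite (is_pd_unique (is_pd_mult _ _ _ _ _ _ (Dsp3 i z Hi)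
      (sm_on_is_pd B _ z (rr i) (sm_on_pd B rho (rr I3) Srho) Hz))) in Hc.
    rewrite (pd_comm B rho (rr i) (rr I3) z) in Hc by auto. lra. }
  set (sg := fun i => match i with I1 => 1 | _ => -1 end : R).
  assert (H13 : forall i z, i <> I3 -> B z -> pd (rr I3) (pd (rr i) rho) z = sg i * pd (rr I3) rho z).
  { intros i z Hi Hz; assert (E := Hmix i z Hi Hz).
    unfold speed, sg in *; destruct i; [lra|lra|congruence]. }
  assert (Hup : forall z, B z -> B (upd z (rr I3) c0)).
  { intros z Hz; apply box_upd; auto; unfold c0; now rewrite Rminus_diag, Rabs_R0. }
  assert (Hconst : forall i z, i <> I3 -> B z ->
     pd (rr i) rho z - sg i * rho z
     = pd (rr i) rho (upd z (rr I3) c0) - sg i * rho (upd z (rr I3) c0)).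
  { intros i z Hi Hz; symmetry.
    assert (Q := pd_zero_const L e z0 (fun z => pd (rr i) rho z - sg i * rho z)
                   (rr I3) z (z (rr I3)) c0).
    rewrite upd_self in Q; apply Q; auto.
    - now apply Hup.
    - intros y Hy.
      refine (is_pd_eq (is_pd_minus _ _ _ _ _ _
        (sm_on_is_pd B _ y (rr I3) (sm_on_pd B rho (rr i) Srho) Hy)
        (is_pd_mult _ _ _ _ _ _ (is_pd_const _ (sg i) y) (sm_on_is_pd B rho y (rr I3) Srho Hy))) _).
      rewrite H13 by auto; ring. }
  (* By [Hconst], the difference of [rho] and its value at [r^3 = c0] satisfies [f_1 = f] and
     [f_2 = - f]. Removing the factor [e^(r1 - r2)] leaves a function of [r^3] only. *)
  set (Phi := fun z : jet => exp (z (rr I2) - z (rr I1)) * (rho z - rho (upd z (rr I3) c0))).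
  assert (DPhi : forall i z, i <> I3 -> B z -> is_pd (rr i) Phi z 0).
  { intros i z Hi Hz.
    assert (Dup : is_pd (rr i) (fun z => rho (upd z (rr I3) c0)) z
                        (pd (rr i) rho (upd z (rr I3) c0))).
    { assert (D := sm_on_is_pd B rho (upd z (rr I3) c0) (rr i) Srho (Hup z Hz)).
      unfold is_pd in *; rewrite upd_other in D by congruence.
      revert D; apply is_derive_ext; intros s.
      f_equal; apply upd_comm; congruence. }
    refine (is_pd_eq (is_pd_mult _ _ _ _ _ _
      (is_pd_exp _ _ _ _ (is_pd_minus _ _ _ _ _ _ (is_pd_coord (rr i) (rr I2) z)
                                                   (is_pd_coord (rr i) (rr I1) z)))
      (is_pd_minus _ _ _ _ _ _ (sm_on_is_pd B rho z (rr i) Srho Hz) Dup)) _).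
    assert (E := Hconst i z Hi Hz).
    set (E0 := exp _).
    replace (pd (rr i) rho z - pd (rr i) rho (upd z (rr I3) c0))
      with (sg i * (rho z - rho (upd z (rr I3) c0))) by lra.
    unfold sg; destruct i; simpl; [ring|ring|congruence]. }
  exists L, e; split; auto; intros z Hz; fold B in Hz.
  assert (Eg : restrict rr12 z0 rho z = rho (upd z (rr I3) c0)).
  { apply Hr; auto; intros b [<-|[<-|[<-|[]]]]; reflexivity. }
  assert (E0 : Phi z = W (z (rr I3))).
  { set (z1 := upd z (rr I1) (z0 (rr I1))); set (z2 := upd z1 (rr I2) (z0 (rr I2))).
    assert (Hz1 : B z1).
    { apply box_upd; auto; now rewrite Rminus_diag, Rabs_R0. }
    assert (Hz2 : B z2).
    { apply box_upd; auto; now rewrite Rminus_diag, Rabs_R0. }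
    assert (P1 : Phi z1 = Phi z).
    { unfold z1; rewrite <- (upd_self z (rr I1)) at 2.
      apply (pd_zero_const L e z0); auto; [now rewrite upd_self|].
      intros y Hy; apply DPhi; auto; congruence. }
    assert (P2 : Phi z2 = Phi z1).
    { unfold z2; rewrite <- (upd_self z1 (rr I2)) at 2.
      apply (pd_zero_const L e z0); auto; [now rewrite upd_self|].
      intros y Hy; apply DPhi; auto; congruence. }
    assert (A1 : rho z2 = rho (upd z0 (rr I3) (z (rr I3))))
      by (apply Hr; auto; intros b [<-|[<-|[<-|[]]]]; reflexivity).
    assert (A2 : rho (upd z2 (rr I3) c0) = rho z0)
      by (apply Hr; auto; intros b [<-|[<-|[<-|[]]]]; reflexivity).
    rewrite <- P1, <- P2; unfold Phi, W; rewrite A1, A2; reflexivity. }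
  rewrite Eg, <- E0; unfold Phi.
  rewrite <- Rmult_assoc, <- exp_plus.
  replace (z (rr I1) - z (rr I2) + (z (rr I2) - z (rr I1))) with 0 by ring.
  rewrite exp_0; ring.
Qed.

(* [DHC] enters twice because [W] may have critical points: [W + c id] has none
   for a suitable [c]. *)
Lemma span_of_decomposition z0 W Psi :
  diff_fun z0 (fun z => W (z (rr I3))) -> smooth2 z0 Psi -> solves_Psi_eq z0 Psi ->
  exists C, span z0 C /\
    forall z, density C z = exp (z (rr I1) - z (rr I2)) * W (z (rr I3)) + density (EHC Psi) z.
Proof.
  intros HW Hs He.
  (* Makes the derivative of [W + c id] at least 1 at the base point, hence nonzero nearby by
     continuity. *)
  set (c := 1 + Rabs (Derive W (z0 (rr I3)))).
  set (g := Transformation 0 1 0 0 0 (fun x => W x + c * x)).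
  set (F := fun z : jet => W (z (rr I3)) + c * z (rr I3)).
  assert (HF : diff_fun z0 F).
  { apply (diff_fun_plus z0 (fun z => W (z (rr I3))) (fun z => c * z (rr I3))); auto.
    apply diff_fun_scal, diff_fun_coord. }
  assert (HD : 1 <= pd (rr I3) F z0).
  { assert (H := HW); apply diff_fun_iff in H; destruct H as (L & e & He' & _ & Hsm).
    assert (D := sm_on_is_pd _ _ z0 (rr I3) Hsm (box_center L e z0 He')).
    assert (D' := is_pd_plus _ _ _ _ _ _ D (is_pd_mult _ _ _ _ _ _
      (is_pd_const (rr I3) c z0) (is_pd_coord (rr I3) (rr I3) z0))).
    change (pd (rr I3) F z0) with (pd (rr I3) (fun z => W (z (rr I3)) + c * z (rr I3)) z0).
    rewrite (is_pd_unique D'); simpl.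
    change (pd (rr I3) (fun z => W (z (rr I3))) z0) with (Derive W (z0 (rr I3))).
    assert (Q := Rle_abs (- Derive W (z0 (rr I3)))); rewrite Rabs_Ropp in Q.
    unfold c; lra. }
  assert (Hg : point_symmetry z0 g).
  { split; [simpl; lra|split; [exact HF|]].
    assert (Hc := diff_fun_continuous _ _ (diff_fun_pd z0 F (rr I3) HF) 1 Rlt_0_1).
    revert Hc; apply near_imp; intros z Hz.
    change (pd (rr I3) F z <> 0); intros E; rewrite E in Hz.
    rewrite Rminus_0_l, Rabs_Ropp, Rabs_right in Hz; lra. }
  exists (lin_comb 1 (lin_comb 1 (act g DHC) (- c) DHC) 1 (EHC Psi)); split.
  - apply span_lin; [apply span_lin|].
    + apply span_act; auto; apply span_gen, gen_DHC.
    + apply span_gen, gen_DHC.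
    + now apply span_gen, gen_EHC.
  - intros z; simpl.
    replace (z (rr I1) + (0 + 0) / 2 - (z (rr I2) + (0 - 0) / 2))
      with (z (rr I1) - z (rr I2)) by field.
    ring.
Qed.

Lemma hydrodynamic_generated z0 C : hydrodynamic z0 C -> generated z0 C.
Proof.
  intros (HC & C' & HC' & Heq & f & Hf); split; [apply HC|].
  destruct (classic (evolve z0 = z0)) as [Hz0|Hz0].
  - set (rho := fun z : jet => f (z (rr I1)) (z (rr I2)) (z (rr I3))).
    assert (Hr : rdep rho).
    { intros z z' _ _ H; unfold rho; rewrite !H; simpl; auto. }
    assert (Hrho : diff_fun z0 rho) by (apply (diff_fun_ext z0 (density C')); auto; apply HC').
    set (G := evolved (flux C')).
    assert (HG : diff_fun z0 G) by (apply diff_fun_evolved; auto; apply HC').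
    assert (Hrel : near z0 (fun z => forall i, pd (rr i) G z = speed i z * pd (rr i) rho z)).
    { generalize (hydrodynamic_flux z0 C' rho Hz0 HC' Hr Hrho Hf); apply near_imp.
      intros z (_ & H & _); exact H. }
    destruct (density_decomposition z0 rho G Hr Hrho HG Hrel) as (W & HW & HWe).
    destruct (EHC_potential z0 (restrict rr12 z0 rho) (restrict rr12 z0 G))
      as (Psi & Hs & He & HPsi); auto using diff_fun_restrict, dep_restrict.
    { assert (Hn : near z0 (fun z => forall i, pd (rr i) G (mix rr12 z0 z)
          = speed i (mix rr12 z0 z) * pd (rr i) rho (mix rr12 z0 z))).
      { destruct Hrel as (L & e & He & Hrel); exists L, e; split; auto; intros z Hz.
        apply Hrel, box_mix; auto; now apply box_center. }
      revert Hn; apply near_imp; intros z Hz.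
      rewrite !pd_restrict by (simpl; auto); rewrite !Hz; split; reflexivity. }
    destruct (span_of_decomposition z0 W Psi HW Hs He) as (C'' & HC'' & Hd).
    exists C''; split; auto.
    apply (equivalent_trans z0 C C' C''); auto.
    assert (HC2 := hydro_pair_conserved _ _ (hydro_pair_span _ _ HC'')).
    destruct HC' as [HC1 HC1'], HC2 as [HC2 HC2'].
    apply trivial_of_density_zero; auto.
    + split; [now apply diff_pair_lin|].
      apply (vanishes_ext z0 (fun z => 1 * divergence C' z + (-1) * divergence C'' z)).
      * generalize (divergence_lin z0 1 C' (-1) C'' HC1 HC2); apply near_imp; auto.
      * now apply vanishes_lin.
    + generalize (near_and Hf (near_and HWe HPsi)); apply near_imp.
      intros z (E1 & E2 & E3); cbn [density lin_comb].
      rewrite E1, Hd, E3; fold (rho z); rewrite E2; ring.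
  (* Here all currents are equivalent, so any element of the span will do, such as the zero
     current. *)
  - exists (lin_comb 0 DHC 0 DHC); split.
    + apply span_lin; apply span_gen, gen_DHC.
    + apply equivalent_off_evolve; [auto|apply HC|].
      apply diff_pair_lin; apply (hydro_pair_DHC z0).
Qed.

Lemma generated_hydrodynamic z0 C : generated z0 C -> hydrodynamic z0 C.
Proof.
  intros (HC & C' & Hs & He).
  destruct (hydro_pair_hydrodynamic z0 C' (hydro_pair_span _ _ Hs)) as (HC' & C1 & H1 & H2 & H3).
  split; [now apply (equivalent_conserved z0 C C')|].
  exists C1; split; auto; split; auto; now apply (equivalent_trans z0 C C' C1).
Qed.

(** With [w = e^((r2 - r1) / 2)] one has [(w Psi)_12 + w Psi / 4 = w (Psi_12 + Psi_1 / 2 - Psi_2 /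
    2)], and [w] is positive. *)
Lemma Klein_Gordon_reduction z0 Psi : smooth2 z0 Psi ->
  (solves_Psi_eq z0 Psi <-> solves_Klein_Gordon z0 (fun a b => exp ((b - a) / 2) * Psi a b)).
Proof.
  intros Hs; unfold solves_Psi_eq, solves_Klein_Gordon; rewrite !locally_2d_near.
  set (P := lift2 Psi).
  set (w := fun z : jet => exp ((z (rr I2) - z (rr I1)) * / 2)).
  assert (H := Hs); apply diff_fun_iff in H; destruct H as (L & e & He & _ & Hsm).
  fold (lift2 Psi) in Hsm; fold P in Hsm.
  set (B := box L e z0) in *.
  assert (Hop : open_jets B) by apply box_open.
  assert (Dw : forall i z, is_pd (rr i) w z
            ((delta (rr i) (rr I2) - delta (rr i) (rr I1)) * / 2 * w z)).
  { intros i z.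
    refine (is_pd_eq (is_pd_exp (rr i) _ z _ (is_pd_mult _ _ _ _ _ _
      (is_pd_minus _ _ _ _ _ _ (is_pd_coord (rr i) (rr I2) z) (is_pd_coord (rr i) (rr I1) z))
      (is_pd_const _ (/ 2) z))) _).
    unfold w, delta; ring. }
  set (Q1 := fun z => w z * (pd (rr I1) P z - / 2 * P z)).
  assert (DQ : forall z, B z -> is_pd (rr I1) (fun z => w z * P z) z (Q1 z)).
  { intros z Hz; refine (is_pd_eq (is_pd_mult _ _ _ _ _ _ (Dw I1 z)
      (sm_on_is_pd B P z _ Hsm Hz)) _).
    unfold Q1, delta; simpl; ring. }
  assert (DQ1 : forall z, B z -> pd (rr I2) Q1 z
     = w z * (pd (rr I2) (pd (rr I1) P) z + / 2 * pd (rr I1) P z - / 2 * pd (rr I2) P z - P z / 4)).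
  { intros z Hz; apply is_pd_unique.
    refine (is_pd_eq (is_pd_mult _ _ _ _ _ _ (Dw I2 z) (is_pd_minus _ _ _ _ _ _
      (sm_on_is_pd B _ z (rr I2) (sm_on_pd B P (rr I1) Hsm) Hz)
      (is_pd_mult _ _ _ _ _ _ (is_pd_const _ (/ 2) z) (sm_on_is_pd B P z (rr I2) Hsm Hz)))) _).
    unfold delta; simpl; field. }
  assert (E : near z0 (fun z =>
    2 * d2 (d1 Psi) (z (rr I1)) (z (rr I2)) = d2 Psi (z (rr I1)) (z (rr I2)) - d1 Psi (z (rr I1)) (z (rr I2))
    <-> d2 (d1 (fun a b => exp ((b - a) / 2) * Psi a b)) (z (rr I1)) (z (rr I2))
        = - (exp ((z (rr I2) - z (rr I1)) / 2) * Psi (z (rr I1)) (z (rr I2))) / 4)).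
  { exists L, e; split; auto; intros z Hz.
    rewrite !lift2_d2_d1, lift2_d1, lift2_d2; fold P.
    change (lift2 (fun a b => exp ((b - a) / 2) * Psi a b)) with (fun z => w z * P z).
    change (exp ((z (rr I2) - z (rr I1)) / 2) * Psi (z (rr I1)) (z (rr I2))) with (w z * P z).
    rewrite (pd_ext (rr I2) (pd (rr I1) (fun z => w z * P z)) Q1 z).
    - rewrite DQ1 by auto.
      assert (Hw : 0 < w z) by apply exp_pos.
      split; intros Heq.
      + replace (pd (rr I2) (pd (rr I1) P) z) with ((pd (rr I2) P z - pd (rr I1) P z) / 2) by lra.
        field.
      + assert (Heq' : w z * (pd (rr I2) (pd (rr I1) P) z + / 2 * pd (rr I1) P z
                       - / 2 * pd (rr I2) P z) = w z * 0) by lra.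
        apply Rmult_eq_reg_l in Heq'; lra.
    - generalize (Hop z Hz); apply near_imp; intros y Hy; now apply is_pd_unique, DQ. }
  split; intros H; generalize (near_and E H); apply near_imp; intros z [E1 E2];
    now apply E1.
Qed.

Theorem corollary23 (z0 : jet) :
  (forall C : current, generator z0 C -> hydrodynamic z0 C) /\
  (forall C : current, hydrodynamic z0 C <-> generated z0 C) /\
  (forall Psi : R -> R -> R, smooth2 z0 Psi ->
     (solves_Psi_eq z0 Psi <->
      solves_Klein_Gordon z0 (fun a b => exp ((b - a) / 2) * Psi a b))).
Proof.
  split; [|split].
  - intros C HC; now apply hydro_pair_hydrodynamic, hydro_pair_generator.
  - intros C; split; [apply hydrodynamic_generated|apply generated_hydrodynamic].
  - apply Klein_Gordon_reduction.
Qed.
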